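(* Let $p$ be as in the context, fix positive $a_l,a_r$ and consider the Riemann problem with data $\bar u_l,\bar u_r\in A_0$. Define $$l'=\max\left\{\hat\varphi_l(\bar u_l),\check\varphi_r(\bar u_r)\right\}\quad\text{and}\quad l''=\min\left\{\check\varphi_l(\bar u_l),\hat\varphi_r(\bar u_r)\right\}.$$ A necessary and sufficient condition for the existence and uniqueness of a (p)-solution to the Riemann problem attaining values in $A_0$ is $$\left\{\begin{array}{rcl}a_l\,L_1(l';\bar u_l)&\ge&a_r\,L_2^-(l';\bar u_r),\\ a_l\,L_1(l'';\bar u_l)&\le&a_r\,L_2^-(l'';\bar u_r).\end{array}\right.$$
   Context: Pressure: $p\in C^2(\mathbb{R}^+;\mathbb{R}^+)$, $\mathbb{R}^+=[0,+\infty[$, with $p'(\rho)>0$ and $p''(\rho)\ge0$ for all $\rho>0$. Write $u=(\rho,q)$, $c(\rho)=\sqrt{p'(\rho)}$, $P(u)=\frac{q^2}{\rho}+p(\rho)$, $\lambda_1(u)=\frac q\rho-c(\rho)$, $\lambda_2(u)=\frac q\rho+c(\rho)$. Subsonic region: $A_0=\{u\in\,]0,+\infty[\times\mathbb{R}\colon\lambda_1(u)<0<\lambda_2(u)\}$. Lax curves, for $u_o=(\rho_o,q_o)$ with $\rho_o>0$: the forward 1-Lax curve is $L_1(\rho;u_o)=\frac{\rho}{\rho_o}q_o-\rho\int_{\rho_o}^\rho\frac{c(r)}r\,dr$ if $\rho\le\rho_o$, and $L_1(\rho;u_o)=\frac{\rho}{\rho_o}q_o-\sqrt{\frac\rho{\rho_o}(\rho-\rho_o)(p(\rho)-p(\rho_o))}$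 if $\rho\ge\rho_o$. The reversed 2-Lax curve is $L_2^-(\rho;u_o)=\frac{\rho}{\rho_o}q_o+\rho\int_{\rho_o}^\rho\frac{c(r)}r\,dr$ if $\rho\le\rho_o$, and $L_2^-(\rho;u_o)=\frac{\rho}{\rho_o}q_o+\sqrt{\frac\rho{\rho_o}(\rho-\rho_o)(p(\rho)-p(\rho_o))}$ if $\rho\ge\rho_o$. For $\bar u\in A_0$, the densities $\check\varphi_l(\bar u),\hat\varphi_l(\bar u),\check\varphi_r(\bar u),\hat\varphi_r(\bar u)$ are the $\rho$-components of the intersections of the curves $\rho\mapsto(\rho,L_1(\rho;\bar u))$ (index $l$) and $\rho\mapsto(\rho,L_2^-(\rho;\bar u))$ (index $r$) with the boundary of $A_0$; they are uniquely determined by $$\lambda_2\left(\check\varphi_r,L_2^-(\check\varphi_r;\bar u)\right)=0,\quad\lambda_2\left(\check\varphi_l,L_1(\check\varphi_l;\bar u)\right)=0,\quad\lambda_1\left(\hat\varphi_r,L_2^-(\hat\varphi_r;\bar u)\right)=0,\quad\lambda_1\left(\hat\varphi_l,L_1(\hat\varphi_l;\bar u)\right)=0,$$ all evaluated at $\bar u$. Riemann problem: $\partial_t\rho+\partial_xq=0$, $\partial_tq+\partial_x(q^2/\rho+p(\rho))=0$, with $u(0,x)=\bar u_l$ for $x<0$ and $u(0,x)=\bar u_r$ for $x>0$. Given a junction function $\Phi$, a weak $\Phi$-solution is a map $u\in C^0(\mathbb{R}^+;L^1_{loc}(\mathbb{R};]0,+\infty[\times\mathbb{R}))$, with $u(t)$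 of bounded variation for a.e. $t\in\mathbb{R}^+$, such that: (1) $\int_{\mathbb{R}^+}\int_{\mathbb{R}}\left((\rho,q)\,\partial_t\phi+(q,P(\rho,q))\,\partial_x\phi\right)dx\,dt=0$ for all $\phi\in C^1_c(]0,+\infty[\times\mathbb{R};\mathbb{R})$ whose support does not intersect $x=0$; (2) $u(0,x)$ coincides with the Riemann initial datum for a.e. $x\in\mathbb{R}$; (3) for a.e. $t\in\mathbb{R}^+$, $\Phi(a_l,u(t,0-);a_r,u(t,0+))=0$. Solutions to Riemann problems are understood to be made of standard Lax waves: on $x<0$, $u$ is a (possibly trivial) Lax wave of the first family joining $\bar u_l$ to the trace $u(t,0-)$, so $q(t,0-)=L_1(\rho(t,0-);\bar u_l)$; on $x>0$, $u$ is a (possibly trivial) Lax wave of the second family joining the trace $u(t,0+)$ to $\bar u_r$, so $q(t,0+)=L_2^-(\rho(t,0+);\bar u_r)$. A (p)-solution is a weak $\Phi$-solution for the junction condition $a_lq_l=a_rq_r$ and $p(\rho_l)=p(\rho_r)$ on the traces $(\rho_l,q_l)=u(t,0-)$, $(\rho_r,q_r)=u(t,0+)$.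
   Formalization: If a_l L_1(l'') = a_r L_2^-(l''), a trace is sonic and fills an open sector, so no solution has values in the open set A_0. The formal theorem proves the printed condition for values in the closure of A_0, and for A_0 itself the condition with the second inequality strict. *)

(* Defs.v *)
From HB Require Import structures.
From mathcomp Require Import all_boot all_order all_algebra.
From mathcomp Require Import all_classical all_reals all_analysis.
Set Implicit Arguments.
Unset Strict Implicit.
Unset Printing Implicit Defensive.
Import Order.TTheory GRing.Theory Num.Theory.
Import numFieldNormedType.Exports.
Local Open Scope classical_set_scope.
Local Open Scope ring_scope.

Local Notation mu := lebesgue_measure.

(* A pair (rho, q); rho > 0 is imposed where it is needed. *)
Definition state (R : realType) : Type := (R * R)%type.

(* C^2 on the closed half-line: classical derivatives on ]0, +oo[, extending
   continuously to 0 (equivalently, one-sided derivatives at 0). *)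
Definition C2_halfline (R : realType) (p : R -> R) : Prop :=
  exists p1 p2 : R -> R,
    [/\ {within `[0, +oo[, continuous p}, {within `[0, +oo[, continuous p1},
        {within `[0, +oo[, continuous p2} &
        forall x : R, 0 < x ->
          is_derive x (1 : R) p (p1 x) /\ is_derive x (1 : R) p1 (p2 x)].

Definition pressure_law (R : realType) (p : R -> R) : Prop :=
  [/\ C2_halfline p, (forall x : R, 0 <= x -> 0 <= p x),
      (forall x : R, 0 < x -> 0 < derive1 p x) &
      (forall x : R, 0 < x -> 0 <= derive1 (derive1 p) x)].

Definition sound_speed (R : realType) (p : R -> R) (rho : R) : R :=
  Num.sqrt (derive1 p rho).

Definition flow_P (R : realType) (p : R -> R) (u : state R) : R :=
  u.2 ^+ 2 / u.1 + p u.1.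

Definition lambda1 (R : realType) (p : R -> R) (u : state R) : R :=
  u.2 / u.1 - sound_speed p u.1.

Definition lambda2 (R : realType) (p : R -> R) (u : state R) : R :=
  u.2 / u.1 + sound_speed p u.1.

Definition A0 (R : realType) (p : R -> R) : set (R * R) :=
  [set u | [/\ 0 < u.1, lambda1 p u < 0 & 0 < lambda2 p u]].

(* The integral from rho_o to rho of c(r)/r dr, for rho <= rho_o: the
   orientation is reversed, hence the sign. *)
Definition rarefaction_integral (R : realType) (p : R -> R) (rho rho_o : R)
    : R :=
  - \int[mu]_(r in `[rho, rho_o]) (sound_speed p r / r).

Definition shock_root (R : realType) (p : R -> R) (rho rho_o : R) : R :=
  Num.sqrt (rho / rho_o * (rho - rho_o) * (p rho - p rho_o)).

Definition L1 (R : realType) (p : R -> R) (rho : R) (uo : state R) : R :=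
  if rho <= uo.1 then rho / uo.1 * uo.2 - rho * rarefaction_integral p rho uo.1
  else rho / uo.1 * uo.2 - shock_root p rho uo.1.

Definition L2rev (R : realType) (p : R -> R) (rho : R) (uo : state R) : R :=
  if rho <= uo.1 then rho / uo.1 * uo.2 + rho * rarefaction_integral p rho uo.1
  else rho / uo.1 * uo.2 + shock_root p rho uo.1.

Definition unique_positive_root (R : realType) (f : R -> R) (r : R) : Prop :=
  [/\ 0 < r, f r = 0 & forall s : R, 0 < s -> f s = 0 -> s = r].

(* For an arbitrary convex pressure the four equations may have no root or
   several (e.g. p = rho^gamma with gamma > 3), so that the unique
   solvability on all of A0 is a condition on p. *)
Definition boundary_densities (R : realType) (p : R -> R)
    (check_l hat_l check_r hat_r : state R -> R) : Prop :=
  forall u : state R, A0 p u ->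
    [/\ unique_positive_root (fun s => lambda2 p (s, L2rev p s u)) (check_r u),
        unique_positive_root (fun s => lambda2 p (s, L1 p s u)) (check_l u),
        unique_positive_root (fun s => lambda1 p (s, L2rev p s u)) (hat_r u) &
        unique_positive_root (fun s => lambda1 p (s, L1 p s u)) (hat_l u)].

(* Scalar functions of (t, x), to be applied to each component; only t >= 0
   is relevant. *)
Definition C0_L1loc (R : realType) (w : R -> R -> R) : Prop :=
  forall t : R, 0 <= t ->
    locally_integrable [set: R] (w t) /\
    forall K : set R, compact K ->
      (\int[mu]_(x in K) (`|w s x - w t x|)%:E)%E
        @[s --> within [set s : R | 0 <= s] (nbhs t)] --> 0%E.

Definition essentially_BV (R : realType) (f : R -> R) : Prop :=
  exists g : R -> R, {ae mu, forall x, f x = g x} /\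
    exists M : R, forall a b : R, a <= b -> (total_variation a b g <= M%:E)%E.

(* One-sided traces at x = 0 do not depend on the representative. *)
Definition left_trace (R : realType) (f : R -> R * R) (w : R * R) : Prop :=
  exists g : R -> R * R,
    {ae mu, forall x : R, f x = g x} /\ g x @[x --> (0 : R)^'-] --> w.

Definition right_trace (R : realType) (f : R -> R * R) (w : R * R) : Prop :=
  exists g : R -> R * R,
    {ae mu, forall x : R, f x = g x} /\ g x @[x --> (0 : R)^'+] --> w.

Definition dt (R : realType) (phi : R -> R -> R) (t x : R) : R :=
  derive1 (fun s : R => phi s x) t.

Definition dx (R : realType) (phi : R -> R -> R) (t x : R) : R :=
  derive1 (phi t) x.

(* A C^1 function compactly supported in the open set ]0, +oo[ x R is
   represented by its extension by 0 to the plane. *)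
Definition test_function (R : realType) (phi : R -> R -> R) : Prop :=
  let supp := closure [set z : R * R | phi z.1 z.2 != 0] in
  [/\ (forall t x : R, derivable (fun s : R => phi s x) t 1 /\
                       derivable (phi t) x 1),
      continuous (fun z : R * R => dt phi z.1 z.2),
      continuous (fun z : R * R => dx phi z.1 z.2),
      compact supp &
      supp `<=` [set z : R * R | 0 < z.1 /\ z.2 != 0]].

(* The integral is iterated, and not over the product measure, because w t and
   f t are only defined up to a null set for each t. *)
Definition weak_conservation (R : realType) (w f : R -> R -> R) : Prop :=
  forall phi : R -> R -> R, test_function phi ->
    let g t x := w t x * dt phi t x + f t x * dx phi t x in
    [/\ {ae mu, forall t : R, 0 <= t ->
           mu.-integrable [set: R] (fun x => (g t x)%:E)},
        mu.-integrable `[0, +oo[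
          (fun t => (\int[mu]_(x in [set: R]) g t x)%:E) &
        \int[mu]_(t in `[0, +oo[) \int[mu]_(x in [set: R]) g t x = 0].

(* Phi takes its values in R^2, as for the (p)-junction condition below. *)
Definition weak_Phi_solution (R : realType) (p : R -> R)
    (Phi : R -> state R -> R -> state R -> R * R) (al ar : R)
    (ul ur : state R) (u : R -> R -> state R) : Prop :=
  let rho t x := (u t x).1 in
  let q t x := (u t x).2 in
  [/\ [/\ (forall t : R, 0 <= t -> {ae mu, forall x : R, 0 < rho t x}),
          C0_L1loc rho, C0_L1loc q &
          {ae mu, forall t : R, 0 <= t ->
             essentially_BV (rho t) /\ essentially_BV (q t)}],
      weak_conservation rho q /\
      weak_conservation q (fun t x => flow_P p (u t x)),
      {ae mu, forall x : R, (x < 0 -> u 0 x = ul) /\ (0 < x -> u 0 x = ur)} &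
      {ae mu, forall t : R, 0 <= t ->
         exists wl wr : state R,
           [/\ left_trace (u t) wl, right_trace (u t) wr &
               Phi al wl ar wr = (0, 0)]}].

Definition p_junction (R : realType) (p : R -> R) (al : R) (wl : state R)
    (ar : R) (wr : state R) : R * R :=
  (al * wl.2 - ar * wr.2, p wl.1 - p wr.1).

(* Self-similar profiles U(xi), xi = x / t, joining u0 (left) to u1 (right).
   The shock speed is given by the first Rankine-Hugoniot relation. *)
Definition shock_profile (R : realType) (u0 u1 : state R) (U : R -> state R)
    : Prop :=
  let s := (u1.2 - u0.2) / (u1.1 - u0.1) in
  (forall xi : R, xi < s -> U xi = u0) /\ (forall xi : R, s < xi -> U xi = u1).

(* Centred fan along the curve r |-> (r, L r), r between the densities of u0
   and u1: the state v of the fan is taken on the ray x / t = lambda v. *)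
Definition rarefaction_profile (R : realType) (lambda : state R -> R)
    (L : R -> R) (u0 u1 : state R) (U : R -> state R) : Prop :=
  [/\ (forall xi : R, xi <= lambda u0 -> U xi = u0),
      (forall xi : R, lambda u1 <= xi -> U xi = u1) &
      forall r : R, Num.min u0.1 u1.1 <= r -> r <= Num.max u0.1 u1.1 ->
        U (lambda (r, L r)) = (r, L r)].

(* First family: left state uo, right state um on the forward 1-Lax curve. *)
Definition lax_wave1 (R : realType) (p : R -> R) (uo um : state R)
    (U : R -> state R) : Prop :=
  [/\ 0 < um.1, um.2 = L1 p um.1 uo &
      [\/ um.1 = uo.1 /\ (forall xi : R, U xi = uo),
          uo.1 < um.1 /\ shock_profile uo um U |
          um.1 < uo.1 /\
          rarefaction_profile (lambda1 p) (fun r => L1 p r uo) uo um U]].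

(* Second family: right state uo, left state um on the reversed 2-Lax curve. *)
Definition lax_wave2 (R : realType) (p : R -> R) (um uo : state R)
    (U : R -> state R) : Prop :=
  [/\ 0 < um.1, um.2 = L2rev p um.1 uo &
      [\/ um.1 = uo.1 /\ (forall xi : R, U xi = uo),
          uo.1 < um.1 /\ shock_profile um uo U |
          um.1 < uo.1 /\
          rarefaction_profile (lambda2 p) (fun r => L2rev p r uo) um uo U]].

(* The trace requirements force the two waves to lie in x < 0 and in x > 0. *)
Definition made_of_lax_waves (R : realType) (p : R -> R) (ul ur : state R)
    (u : R -> R -> state R) : Prop :=
  exists (wl wr : state R) (U1 U2 : R -> state R),
    [/\ lax_wave1 p ul wl U1, lax_wave2 p wr ur U2 &
        forall t : R, 0 < t ->
          [/\ left_trace (u t) wl, right_trace (u t) wr &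
              {ae mu, forall x : R, (x < 0 -> u t x = U1 (x / t)) /\
                                    (0 < x -> u t x = U2 (x / t))}]].

Definition p_solution (R : realType) (p : R -> R) (al ar : R)
    (ul ur : state R) (u : R -> R -> state R) : Prop :=
  weak_Phi_solution p (p_junction p) al ar ul ur u /\
  made_of_lax_waves p ul ur u.

Definition valued_in (R : realType) (A : set (R * R)) (u : R -> R -> state R)
    : Prop :=
  forall t : R, 0 <= t -> {ae mu, forall x : R, A (u t x)}.

(* Uniqueness in C^0(R^+; L^1_loc). *)
Definition exists_unique_p_solution_in (R : realType) (A : set (R * R))
    (p : R -> R) (al ar : R) (ul ur : state R) : Prop :=
  exists u : R -> R -> state R,
    [/\ p_solution p al ar ul ur u, valued_in A u &
        forall v : R -> R -> state R,
          p_solution p al ar ul ur v -> valued_in A v ->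
          forall t : R, 0 <= t -> {ae mu, forall x : R, v t x = u t x}].

(* Main.v *)
Require Import Defs.
From mathcomp Require Import all_boot all_order all_algebra.
From mathcomp Require Import all_classical all_reals all_analysis.
From mathcomp Require Import measurable_realfun lra ring.
Import Order.TTheory GRing.Theory Num.Theory.
Import numFieldNormedType.Exports.
Local Open Scope classical_set_scope.
Local Open Scope ring_scope.

(* The forward 1-Lax curve is [L1 s u = s (q/rho - w s)], where [w] vanishes at
   [rho] and satisfies [w t - w s >= c s (1 - s/t)] for [s <= t]; hence [lambda1]
   decreases along it, and so does [L1] wherever [lambda1 <= 0]. The reflection
   [(x, rho, q) -> (- x, rho, - q)] exchanges the two families and turns the
   reversed 2-Lax curve into a forward 1-Lax curve.

   Equality of the pressures at the junction forces a common density [r], and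
   the other condition reads [F r = 0] with [F = al L1 - ar L2rev]. The first wave
   lies in [x < 0] and the second one in [x > 0] exactly when [l' <= r], and the
   traces are subsonic (up to the boundary) exactly when [r <= l'']. As [F] is
   strictly decreasing on [[l', +oo[], there is at most one such [r], and there is
   one exactly when [F l' >= 0 >= F l''] (these inequalities imply [l' <= l'']).

   Conversely, gluing the two self-similar waves at [x = 0] gives a solution: the
   change of variables [x = t xi] reduces the weak formulation to
   [(F - xi W)' = - W] for the profiles, which holds on each smooth piece and, by
   the Rankine-Hugoniot relations, across a shock. *)

Set Implicit Arguments.
Unset Strict Implicit.
Unset Printing Implicit Defensive.

Local Notation mu := lebesgue_measure.

(** * Lax curves *)

(** For a convex pressure [lambda1] is always monotone along a 1-Lax curve, but [lambda2], which is
    the initial velocity minus [w - c], need not be, since [w] and [c] both grow. Its sign is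
    therefore extracted from unique solvability over all of [A0]: [w - c] depends on the state only
    through its density [ro], so the states of density [ro] together say that it takes every value
    between [- c ro] and [c ro] exactly once, and the intermediate value theorem does the rest.

    The bound on the increments of [w] replaces derivatives of the curve. It has the same form on
    both branches and can be concatenated, so the change of branch at [ro] needs no regularity
    argument.

    Closure and open set differ only at the upper end [l'']: a shock shows its end state on an open
    sector, possibly with [lambda2 = 0], whereas a fan ending at [lambda1 = 0] reaches that state
    only at [x = 0]. *)

Section LaxCurves.
Context {R : realType} (p : R -> R).
Hypothesis hp : pressure_law p.
Local Notation c := (sound_speed p).
Implicit Types (a s t x y z ro : R) (u : state R).

Lemma MVT_gt (f df : R -> R) a s t : a < s -> s < t ->
  (forall x : R, a < x -> is_derive x (1 : R) f (df x)) ->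
  exists2 z, s < z < t & f t - f s = df z * (t - s).
Proof.
move=> as_ st fdf.
have pos x : x \in `[s, t] -> a < x.
  by rewrite in_itv/= => /andP[sx _]; exact: lt_le_trans sx.
have [x xst||z + e] := @MVT _ f df s t st.
- exact/fdf/pos/subset_itv_oo_cc.
- by apply: derivable_within_continuous => x xst; apply: ex_derive; exact/fdf/pos.
- by rewrite in_itv/= => zst; exists z.
Qed.

Lemma pressure_derive (x : R) : 0 < x -> is_derive x (1 : R) p (derive1 p x).
Proof.
move=> x0; have [[p1 [p2 [_ _ _ h]]] _ _ _] := hp.
have [h1 _] := h _ x0; rewrite derive1E.
by apply: DeriveDef => //; exact: ex_derive.
Qed.

Lemma pressure_derive2 (x : R) : 0 < x ->
  is_derive x (1 : R) (derive1 p) (derive1 (derive1 p) x).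
Proof.
move=> x0; have [[p1 [p2 [_ _ _ h]]] _ _ _] := hp.
suff h2 : is_derive x (1 : R) (derive1 p) (p2 x).
  by rewrite derive1E; apply: DeriveDef => //; exact: ex_derive.
apply: (@near_eq_is_derive _ _ _ p1); last exact: (h _ x0).2.
near=> y; have [|h1 _] := h y; first by near: y; exact: lt_nbhsr.
by rewrite derive1E; exact: esym (@derive_val _ _ _ _ _ _ _ h1).
Unshelve. all: by end_near. Qed.

Lemma sound_speed_gt0 x : 0 < x -> 0 < c x.
Proof. by move=> x0; rewrite sqrtr_gt0; case: hp => _ _ + _; apply. Qed.

Lemma sound_speed_sqr x : 0 < x -> c x ^+ 2 = derive1 p x.
Proof. by move=> x0; rewrite sqr_sqrtr// ltW//; case: hp => _ _ + _; apply. Qed.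

Lemma sound_speed_derive (x : R) : 0 < x ->
  exists2 d, 0 <= d & is_derive x (1 : R) c d.
Proof.
move=> x0; have p'0 : 0 < derive1 p x by case: hp => _ _ + _; apply.
exists ((2 * Num.sqrt (derive1 p x))^-1 * derive1 (derive1 p) x).
  rewrite mulr_ge0 ?invr_ge0 ?mulr_ge0 ?sqrtr_ge0//.
  by case: hp => _ _ _; apply.
have := @is_derive1_comp _ Num.sqrt (derive1 p) x _ _
  (is_derive1_sqrt p'0) (pressure_derive2 x0).
exact.
Qed.

Lemma sound_speed_continuous x : 0 < x -> {for x, continuous c}.
Proof.
move=> /sound_speed_derive[d _ cd].
by apply/differentiable_continuous/derivable1_diffP; exact: ex_derive.
Qed.

Lemma le_sound_speed x y : 0 < x -> x <= y -> c x <= c y.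
Proof.
move=> x0; rewrite le_eqVlt => /predU1P[->//|xy].
apply: ler_wsqrtr.
have [z /andP[xz _] e] := MVT_gt x0 xy pressure_derive2.
rewrite -subr_ge0 e mulr_ge0 ?subr_ge0 ?(ltW xy)//.
by case: hp => _ _ _; apply; exact: lt_trans xz.
Qed.

(** Mean value theorem for [p]: its derivative is [c ^+ 2], and [c] is nondecreasing by
    convexity. *)
Lemma pressure_increment x y : 0 < x -> x <= y ->
  c x ^+ 2 * (y - x) <= p y - p x <= c y ^+ 2 * (y - x).
Proof.
move=> x0; rewrite le_eqVlt => /predU1P[->|xy]; first by rewrite !subrr !mulr0 lexx.
have [z /andP[xz zy] ->] := MVT_gt x0 xy pressure_derive.
have z0 : 0 < z by exact: lt_trans xz.
rewrite -(sound_speed_sqr z0); have yx0 : 0 <= y - x by rewrite subr_ge0 ltW.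
have [xz' zy'] := (le_sound_speed x0 (ltW xz), le_sound_speed z0 (ltW zy)).
by apply/andP; split; apply: (ler_wpM2r yx0);
  apply: lerXn2r; rewrite ?nnegrE ?sqrtr_ge0.
Qed.

Lemma lt_pressure x y : 0 < x -> x < y -> p x < p y.
Proof.
move=> x0 xy; have /andP[+ _] := pressure_increment x0 (ltW xy).
rewrite -subr_gt0; apply: lt_le_trans.
by rewrite mulr_gt0 ?subr_gt0// exprn_gt0// sound_speed_gt0.
Qed.

Lemma pressure_inj x y : 0 < x -> 0 < y -> p x = p y -> x = y.
Proof.
move=> x0 y0 e; have [xy|yx|//] := ltgtP x y.
- by have := lt_pressure x0 xy; rewrite e ltxx.
- by have := lt_pressure y0 yx; rewrite e ltxx.
Qed.

(** The integral part of the Riemann invariants. The base point [a > 0] is arbitrary, because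
    [c r / r] may fail to be integrable at 0; each use picks an [a] below all densities in play. *)
Definition riemann_invariant (a x : R) := \int[mu]_(r in `[a, x]) (c r / r).

Lemma riemann_integrable a b : 0 < a ->
  mu.-integrable `[a, b] (EFin \o (fun r => c r / r)).
Proof.
move=> a0; apply: continuous_compact_integrable; first exact: segment_compact.
apply: continuous_in_subspaceT => x; rewrite inE/= in_itv/= => /andP[ax _].
have x0 : 0 < x by exact: lt_le_trans ax.
apply: cvgM; first exact: sound_speed_continuous.
by apply: cvgV => //; rewrite gt_eqF.
Qed.

Lemma riemann_derive (a x : R) : 0 < a -> a < x ->
  is_derive x (1 : R) (riemann_invariant a) (c x / x).
Proof.
move=> a0 ax; have x0 := lt_trans a0 ax.
have [||||] := @continuous_FTC1_closed _ (fun r => c r / r) a x (x + 1).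
- by rewrite ltrDl.
- exact: riemann_integrable.
- exact: ax.
- apply: cvgM; first exact: sound_speed_continuous.
  by apply: cvgV => //; rewrite gt_eqF.
- by move=> d e; rewrite -e derive1E; exact: DeriveDef.
Qed.

Lemma rarefaction_integralE a x y : 0 < a -> a < x -> x <= y ->
  rarefaction_integral p x y = riemann_invariant a x - riemann_invariant a y.
Proof.
move=> a0 ax xy; rewrite /rarefaction_integral -[RHS]opprB; congr (- _).
rewrite /riemann_invariant (@Rintegral_itvB _ _ (BLeft a) (BRight y) x)//=;
  last 2 first.
- exact: riemann_integrable.
- by rewrite bnd_simp ltW.
rewrite Rintegral_itv_obnd_cbnd//.
by apply: integrableS (@riemann_integrable x y (lt_trans a0 ax)) => //;
  exact: subset_itv_oc_cc.
Qed.

(** At the mean value point [z] of [[x, y]] the derivative [c z / z] is at least [c x / y]. *)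
Lemma riemann_increment a x y : 0 < a -> a < x -> x <= y ->
  c x * (1 - x / y) <= riemann_invariant a y - riemann_invariant a x.
Proof.
move=> a0 ax; have x0 := lt_trans a0 ax.
rewrite le_eqVlt => /predU1P[<-|xy]; first by rewrite divff ?gt_eqF// !subrr mulr0.
have [z /andP[xz zy] ->] :=
  MVT_gt ax xy (fun z az => @riemann_derive a z a0 az).
have z0 := lt_trans x0 xz; have y0 := lt_trans z0 zy.
  have -> : 1 - x / y = (y - x) / y by field; rewrite gt_eqF.
rewrite mulrA mulrAC; apply: ler_wpM2r; first by rewrite subr_ge0 ltW.
apply: ler_pM; rewrite ?sqrtr_ge0 ?invr_ge0 ?(ltW y0)//.
  exact/le_sound_speed/ltW.
by rewrite lef_pV2 ?posrE// ltW.
Qed.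

(** The velocity along the forward 1-Lax curve is [u.2 / u.1 - w], and along the reversed 2-Lax
    curve [u.2 / u.1 + w]. Only the density of the base state enters [w]. *)
Definition lax_speed (s ro : R) :=
  if s <= ro then rarefaction_integral p s ro else shock_root p s ro / s.
Local Notation w := lax_speed.

Lemma L1E s u : 0 < s -> L1 p s u = s * (u.2 / u.1 - w s u.1).
Proof.
move=> s0; rewrite /L1 /w; case: ifP => _; rewrite mulrBr mulrCA mulrC.
  by rewrite mulrA mulrAC.
by rewrite mulrA mulrAC [s * (_ / s)]mulrCA divff ?mulr1// gt_eqF.
Qed.

Lemma L2revE s u : 0 < s -> L2rev p s u = s * (u.2 / u.1 + w s u.1).
Proof.
move=> s0; rewrite /L2rev /w; case: ifP => _; rewrite mulrDr mulrCA mulrC.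
  by rewrite mulrA mulrAC.
by rewrite mulrA mulrAC [s * (_ / s)]mulrCA divff ?mulr1// gt_eqF.
Qed.

Lemma shock_rootE s ro : 0 < s -> 0 < ro ->
  shock_root p s ro / s = Num.sqrt ((ro^-1 - s^-1) * (p s - p ro)).
Proof.
move=> s0 ro0; rewrite /shock_root.
have -> : s / ro * (s - ro) * (p s - p ro) =
    s ^+ 2 * ((ro^-1 - s^-1) * (p s - p ro)).
  by field; rewrite !gt_eqF.
rewrite sqrtrM ?sqr_ge0// sqrtr_sqr gtr0_norm// mulrAC divff ?mul1r//.
by rewrite gt_eqF.
Qed.

Lemma lax_speed_id ro : 0 < ro -> w ro ro = 0.
Proof.
move=> ro0; rewrite /w lexx (@rarefaction_integralE (ro / 2)) ?subrr ?divr_gt0//.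
by rewrite ltr_pdivrMr// ltr_pMr// ltr1n.
Qed.

Lemma lax_speed_rarefaction a s ro : 0 < a -> a < s -> s <= ro ->
  w s ro = riemann_invariant a s - riemann_invariant a ro.
Proof. by move=> a0 as_ sro; rewrite /w sro -rarefaction_integralE. Qed.

Lemma lax_speed_shock s ro : 0 < ro -> ro <= s ->
  w s ro = Num.sqrt ((ro^-1 - s^-1) * (p s - p ro)).
Proof.
move=> ro0; rewrite le_eqVlt => /predU1P[<-|ros].
  by rewrite lax_speed_id// !subrr mulr0 sqrtr0.
by rewrite /w leNgt ros/= shock_rootE// (lt_trans ro0).
Qed.

(** Cauchy-Schwarz for the vectors of square roots of [A, B] and [C, D]; the deficit is the square
    considered in the proof. *)
Lemma sqrt_superadditive (A B C D : R) :
  0 <= A -> 0 <= B -> 0 <= C -> 0 <= D ->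
  Num.sqrt (A * C) + Num.sqrt (B * D) <= Num.sqrt ((A + B) * (C + D)).
Proof.
move=> A0 B0 C0 D0; rewrite -ler_sqr ?nnegrE ?addr_ge0 ?sqrtr_ge0//.
rewrite sqr_sqrtr ?mulr_ge0 ?addr_ge0// !sqrtrM//.
have := sqr_ge0 (Num.sqrt A * Num.sqrt D - Num.sqrt B * Num.sqrt C).
have := sqr_sqrtr A0; have := sqr_sqrtr B0.
have := sqr_sqrtr C0; have := sqr_sqrtr D0.
move: (Num.sqrt A) (Num.sqrt B) (Num.sqrt C) (Num.sqrt D) => a b e d <- <- <- <-.
nra.
Qed.

(** Meant for [q = s / m] and [q' = m / t], so that [q * q' = s / t]. The sum of [1 - q] and
    [1 - q'] exceeds [1 - q * q'] by exactly [(1 - q) * (1 - q')]; this surplus is kept, as it is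
    the source of strictness. *)
Lemma concatenate_increments (k k' q q' d d' : R) :
  0 <= k -> k <= k' -> 0 <= 1 - q -> 0 <= 1 - q' ->
  k * (1 - q) <= d -> k' * (1 - q') <= d' ->
  k * (1 - q * q') + k * ((1 - q) * (1 - q')) <= d + d'.
Proof.
move=> k0 kk' q1 q1' kd kd'; have := ler_wpM2r q1' kk'; nra.
Qed.

(* Superadditivity of [sqrt] along the shock curve, and the mean value theorem
   along the rarefaction curve, give one and the same lower bound. *)
Lemma le_lax_speed_increment s t ro : 0 < ro -> 0 < s -> s <= t ->
  c s * (1 - s / t) <= w t ro - w s ro.
Proof.
move=> ro0.
have shock x y : ro <= x -> x <= y -> c x * (1 - x / y) <= w y ro - w x ro.
  move=> rox xy; have x0 := lt_le_trans ro0 rox; have y0 := lt_le_trans x0 xy.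
  rewrite !lax_speed_shock ?(le_trans rox)//.
  have i1 : 0 <= ro^-1 - x^-1 by rewrite subr_ge0 lef_pV2 ?posrE.
  have i2 : 0 <= x^-1 - y^-1 by rewrite subr_ge0 lef_pV2 ?posrE.
  have /andP[d1 _] := pressure_increment ro0 rox.
  have /andP[d2 _] := pressure_increment x0 xy.
  have d1' : 0 <= p x - p ro.
    by apply: le_trans d1; rewrite mulr_ge0 ?sqr_ge0 ?subr_ge0.
  have d2' : 0 <= p y - p x.
    by apply: le_trans d2; rewrite mulr_ge0 ?sqr_ge0 ?subr_ge0.
  (* Both factors under the root split at [x]: the one in inverse densities and the one in
     pressures. *)
  have := sqrt_superadditive i1 i2 d1' d2'.
  rewrite addrA subrK [_ + (p y - _)]addrC addrA subrK => h.
  rewrite lerBrDl; apply: le_trans h; rewrite lerD2l.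
  rewrite -[leLHS]ger0_norm -?sqrtr_sqr; last first.
    by rewrite mulr_ge0 ?sqrtr_ge0// subr_ge0 ler_pdivrMr// mul1r.
  apply: ler_wsqrtr; rewrite exprMn.
  apply: (@le_trans _ _ ((x^-1 - y^-1) * (c x ^+ 2 * (y - x)))); last first.
    by rewrite ler_wpM2l.
  rewrite [leRHS]mulrCA; apply: ler_wpM2l; first exact: sqr_ge0.
  (* The factor [y / x >= 1] is given up to reach the same bound as on the rarefaction branch. *)
  have -> : (x^-1 - y^-1) * (y - x) = (1 - x / y) ^+ 2 * (y / x).
    by field; rewrite !gt_eqF.
  by rewrite ler_peMr ?sqr_ge0// ler_pdivlMr// mul1r.
have raref x y : 0 < x -> x <= y -> y <= ro -> c x * (1 - x / y) <= w y ro - w x ro.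
  move=> x0 xy yro; have x20 : 0 < x / 2 by rewrite divr_gt0.
  have x2x : x / 2 < x by rewrite ltr_pdivrMr// ltr_pMr// ltr1n.
  rewrite !(@lax_speed_rarefaction (x / 2))// ?(lt_le_trans x2x)// ?(le_trans xy)//.
  by rewrite opprB addrA subrK; exact: riemann_increment.
move=> s0 st; have [tro|rot] := leP t ro; first exact: raref.
have [ros|sro] := leP ro s; first exact: shock.
have t0 := lt_trans s0 (lt_trans sro rot).
have q1 : 0 <= 1 - s / ro by rewrite subr_ge0 ler_pdivrMr// mul1r ltW.
have q2 : 0 <= 1 - ro / t by rewrite subr_ge0 ler_pdivrMr// mul1r ltW.
have := concatenate_increments (sqrtr_ge0 _) (le_sound_speed s0 (ltW sro)) q1 q2
  (raref _ _ s0 (ltW sro) (lexx _)) (shock _ _ (lexx _) (ltW rot)).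
rewrite mulrA divfK ?gt_eqF// [w ro ro - _ + _]addrC addrA subrK.
by apply: le_trans; rewrite lerDl !mulr_ge0 ?sqrtr_ge0.
Qed.

(** Cutting at the midpoint and concatenating the two large inequalities leaves a positive surplus,
    whichever branches are involved. *)
Lemma lax_speed_increment s t ro : 0 < ro -> 0 < s -> s < t ->
  c s * (1 - s / t) < w t ro - w s ro.
Proof.
move=> ro0 s0 st; have [sm mt] := midf_lt st.
set m := (s + t) / 2 in sm mt.
have m0 := lt_trans s0 sm; have t0 := lt_trans m0 mt.
have q1 : 0 < 1 - s / m by rewrite subr_gt0 ltr_pdivrMr// mul1r.
have q2 : 0 < 1 - m / t by rewrite subr_gt0 ltr_pdivrMr// mul1r.
have := concatenate_increments (sqrtr_ge0 _) (le_sound_speed s0 (ltW sm))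
  (ltW q1) (ltW q2) (le_lax_speed_increment ro0 s0 (ltW sm))
  (le_lax_speed_increment ro0 m0 (ltW mt)).
rewrite mulrA divfK ?gt_eqF// [w m ro - _ + _]addrC addrA subrK.
by apply: lt_le_trans; rewrite ltrDl !mulr_gt0 ?sound_speed_gt0.
Qed.

Lemma lt_lax_speed s t ro : 0 < ro -> 0 < s -> s < t -> w s ro < w t ro.
Proof.
move=> ro0 s0 st; rewrite -subr_gt0.
apply: le_lt_trans (lax_speed_increment ro0 s0 st).
rewrite mulr_ge0 ?sqrtr_ge0// subr_ge0 ler_pdivrMr ?(lt_trans s0)//.
by rewrite mul1r ltW.
Qed.

Lemma lax_speed_continuous s ro : 0 < ro -> 0 < s ->
  {for s, continuous (w ^~ ro)}.
Proof.
move=> ro0 s0; pose a := Num.min s ro / 2.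
have m0 : 0 < Num.min s ro by rewrite lt_min s0.
have a0 : 0 < a by rewrite divr_gt0.
have am : a < Num.min s ro by rewrite ltr_pdivrMr// ltr_pMr// ltr1n.
have [as_ aro] : a < s /\ a < ro by move: am; rewrite lt_min => /andP.
(* One continuous formula for both branches: [Num.min] freezes the rarefaction part beyond [ro],
   [Num.max] the shock part before it, and each frozen part is 0. *)
pose g x := riemann_invariant a (Num.min x ro) - riemann_invariant a ro +
  Num.sqrt ((ro^-1 - (Num.max x ro)^-1) * (p (Num.max x ro) - p ro)).
have gw : {near s, g =1 w ^~ ro}.
  near=> x; have ax : a < x by near: x; exact: lt_nbhsr.
  rewrite /g; have [xro|rox] := leP x ro.
    by rewrite !subrr mulr0 sqrtr0 addr0 (@lax_speed_rarefaction a).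
  by rewrite subrr add0r lax_speed_shock// ltW.
rewrite /prop_for /continuous_at -(nbhs_singleton gw).
apply: cvg_trans (near_eq_cvg gw) _.
have cmin : Num.min x ro @[x --> s] --> Num.min s ro.
  by apply: continuous_min => //; exact: cvg_cst.
have cmax : Num.max x ro @[x --> s] --> Num.max s ro.
  by apply: continuous_max => //; exact: cvg_cst.
have max0 : 0 < Num.max s ro by rewrite lt_max s0.
apply: cvgD.
  apply: cvgB; last exact: cvg_cst.
  apply: continuous_cvg => //.
  apply/differentiable_continuous/derivable1_diffP/ex_derive.
  exact: riemann_derive.
apply: continuous_cvg; first exact: sqrt_continuous.
apply: cvgM.
  apply: cvgB; first exact: cvg_cst.
  by apply: cvgV => //; rewrite gt_eqF.
apply: cvgB; last exact: cvg_cst.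
apply: continuous_cvg => //.
apply/differentiable_continuous/derivable1_diffP/ex_derive.
exact: pressure_derive.
Unshelve. all: by end_near. Qed.

Lemma IVT_pos (f : R -> R) s t y : 0 < s -> s <= t ->
  (forall x : R, 0 < x -> {for x, continuous f}) ->
  (f s <= y <= f t) || (f t <= y <= f s) ->
  exists2 x, s <= x <= t & f x = y.
Proof.
move=> s0 st fc h; have [||x] := @IVT R f s t y st.
- apply: continuous_in_subspaceT => x; rewrite inE/= in_itv/= => /andP[sx _].
  exact/fc/(lt_le_trans s0).
- by case/orP: h => /andP[h1 h2]; rewrite ge_min le_max h1 h2 ?orbT.
by rewrite in_itv/= => xst; exists x.
Qed.

(** * Characteristic speeds along the Lax curves *)

Lemma lambda1_L1 s u : 0 < s ->
  lambda1 p (s, L1 p s u) = u.2 / u.1 - (w s u.1 + c s).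
Proof.
by move=> s0; rewrite /lambda1/= L1E// mulrAC divff ?gt_eqF// mul1r opprD addrA.
Qed.

Lemma lambda2_L1 s u : 0 < s ->
  lambda2 p (s, L1 p s u) = u.2 / u.1 - (w s u.1 - c s).
Proof.
by move=> s0; rewrite /lambda2/= L1E// mulrAC divff ?gt_eqF// mul1r opprB addrA addrAC.
Qed.

Definition refl u : state R := (u.1, - u.2).

Lemma L2rev_refl s u : 0 < s -> L2rev p s u = - L1 p s (refl u).
Proof. by move=> s0; rewrite L2revE// L1E//= -mulrN opprB mulNr opprK addrC. Qed.

Lemma lambda2_refl u : lambda2 p (refl u) = - lambda1 p u.
Proof. by rewrite /lambda1 /lambda2/= mulNr opprB addrC. Qed.

Lemma lambda1_refl u : lambda1 p (refl u) = - lambda2 p u.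
Proof. by rewrite /lambda1 /lambda2/= mulNr opprD. Qed.

Lemma A0_refl u : A0 p u -> A0 p (refl u).
Proof.
by case=> u0 l1 l2; split => //; rewrite (lambda1_refl, lambda2_refl) (oppr_lt0, oppr_gt0).
Qed.

Lemma A0_velocity u : A0 p u -> - c u.1 < u.2 / u.1 < c u.1.
Proof.
by case=> _; rewrite /lambda1 /lambda2 subr_lt0 -ltrBlDr sub0r => -> ->.
Qed.

Lemma A0_of_velocity ro v : 0 < ro -> - c ro < v < c ro -> A0 p (ro, ro * v).
Proof.
move=> ro0 /andP[v1 v2]; split => //.
  by rewrite /lambda1/= mulrAC divff ?gt_eqF// mul1r subr_lt0.
by rewrite /lambda2/= mulrAC divff ?gt_eqF// mul1r -ltrBlDr sub0r.
Qed.

Lemma L1_id u : 0 < u.1 -> L1 p u.1 u = u.2.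
Proof.
by move=> u0; rewrite L1E// lax_speed_id// subr0 mulrC divfK ?gt_eqF.
Qed.

(** Multiplied by [t], the increment bound on [w] says that [L1 p t u - L1 p s u] is less than
    [t - s] times [lambda1] at [s]. *)
Lemma L1_decreasing s t u : 0 < u.1 -> 0 < s -> s < t ->
  lambda1 p (s, L1 p s u) <= 0 -> L1 p t u < L1 p s u.
Proof.
move=> u0 s0 st; rewrite lambda1_L1// => l1; have t0 := lt_trans s0 st.
have := lax_speed_increment u0 s0 st; rewrite -(ltr_pM2l t0) !L1E//.
have -> : t * (c s * (1 - s / t)) = c s * (t - s) by field; rewrite gt_eqF.
move: l1; rewrite -subr_gt0 in st.
move: (u.2 / u.1) (w s u.1) (w t u.1) (c s) => v x y e l1.
have : (t - s) * (v - (x + e)) <= 0 by rewrite pmulr_rle0.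
by nra.
Qed.

Lemma L1_continuous s u : 0 < u.1 -> 0 < s -> {for s, continuous (L1 p ^~ u)}.
Proof.
move=> u0 s0.
have h : {near s, (fun x => x * (u.2 / u.1 - w x u.1)) =1 L1 p ^~ u}.
  near=> x; rewrite L1E//; near: x; exact: lt_nbhsr.
rewrite /prop_for /continuous_at -(nbhs_singleton h).
apply: cvg_trans (near_eq_cvg h) _; apply: cvgM; first exact: cvg_id.
by apply: cvgB; [exact: cvg_cst|exact: lax_speed_continuous].
Unshelve. all: by end_near. Qed.

(* [h] and [k] are the densities at which the 1-Lax curve through [u] leaves the
   subsonic region. *)
Definition sonic_densities u (h k : R) :=
  [/\ 0 < h, h < u.1, u.1 < k,
    (forall s, 0 < s -> (lambda1 p (s, L1 p s u) <= 0) = (h <= s) /\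
                        (lambda1 p (s, L1 p s u) < 0) = (h < s)) &
    (forall s, 0 < s -> (0 <= lambda2 p (s, L1 p s u)) = (s <= k) /\
                        (0 < lambda2 p (s, L1 p s u)) = (s < k))].

Lemma lambda1_L1_decreasing s t u : 0 < u.1 -> 0 < s -> s < t ->
  lambda1 p (t, L1 p t u) < lambda1 p (s, L1 p s u).
Proof.
move=> u0 s0 st; have t0 := lt_trans s0 st.
rewrite !lambda1_L1// ltrD2l ltrN2; by rewrite ltr_leD ?lt_lax_speed// le_sound_speed// ltW.
Qed.

Lemma lambda1_root_sign u h : A0 p u ->
  unique_positive_root (fun s => lambda1 p (s, L1 p s u)) h ->
  [/\ 0 < h, h < u.1 & forall s, 0 < s ->
    (lambda1 p (s, L1 p s u) <= 0) = (h <= s) /\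
    (lambda1 p (s, L1 p s u) < 0) = (h < s)].
Proof.
move=> [u0 l1 _] [h0 hE _]; have sgn s : 0 < s ->
    (lambda1 p (s, L1 p s u) <= 0) = (h <= s) /\
    (lambda1 p (s, L1 p s u) < 0) = (h < s).
  move=> s0; rewrite -hE; have [sh|hs|->] := ltgtP s h; last by rewrite lexx ltxx.
    by have := lambda1_L1_decreasing u0 s0 sh; rewrite ltNge; case: ltgtP.
  by have := lambda1_L1_decreasing u0 h0 hs; case: ltgtP.
split=> //; have [_ <-] := sgn _ u0.
by rewrite L1_id//; move: l1; rewrite /lambda1.
Qed.

(** Along the curve [lambda2] is [v - M], where [M = w - c] need not be monotone. The hypothesis on
    all subsonic states, applied to those of density [ro], makes every value between [- c ro] and
    [c ro] have exactly one preimage under [M]; a wrong sign on either side of [k] would create a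
    second one. *)
Lemma lambda2_root_sign u k :
  (forall v, A0 p v -> exists r,
     unique_positive_root (fun s => lambda2 p (s, L1 p s v)) r) ->
  A0 p u -> unique_positive_root (fun s => lambda2 p (s, L1 p s u)) k ->
  u.1 < k /\ forall s, 0 < s ->
    (0 <= lambda2 p (s, L1 p s u)) = (s <= k) /\
    (0 < lambda2 p (s, L1 p s u)) = (s < k).
Proof.
move=> H Au; have [u0 _ _] := Au; have /andP[v1 v2] := A0_velocity Au.
set ro := u.1 in u0 v1 v2 *; pose M s := w s ro - c s.
have c0 := sound_speed_gt0 u0.
have Mc x : 0 < x -> {for x, continuous M}.
  by move=> x0; apply: cvgB; [exact: lax_speed_continuous|exact: sound_speed_continuous].
have Mro : M ro = - c ro by rewrite /M lax_speed_id// sub0r.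
have Mlt0 s : 0 < s -> s <= ro -> M s < 0.
  move=> s0; rewrite le_eqVlt => /predU1P[->|sro]; first by rewrite Mro oppr_lt0.
  rewrite subr_lt0; apply: lt_trans (sound_speed_gt0 s0).
  by rewrite -(lax_speed_id u0) lt_lax_speed.
have rootE (v : R) : - c ro < v < c ro -> exists r, unique_positive_root (fun s => v - M s) r.
  move=> hv; have [r [r0 rE rU]] := H _ (A0_of_velocity u0 hv).
  have e s : 0 < s -> lambda2 p (s, L1 p s (ro, ro * v)) = v - M s.
    by move=> s0; rewrite lambda2_L1//= [ro * v]mulrC mulfK// gt_eqF.
  exists r; split=> // [|s s0]; first by rewrite -e.
  by rewrite -e//; exact: rU.
have uniq (v : R) s t : - c ro < v < c ro -> 0 < s -> 0 < t -> M s = v -> M t = v -> s = t.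
  move=> /rootE[r [r0 _ rU]] s0 t0 Ms Mt.
  by rewrite (rU s) ?Ms ?subrr// (rU t) ?Mt ?subrr.
have above (v r : R) : - c ro < v < c ro -> 0 < r -> M r = v -> ro < r.
  move=> /andP[va vb] r0 Mr; rewrite ltNge; apply/negP => rro.
  (* Any positive admissible value would do. Since [M < 0] up to [ro], it is taken beyond [ro], and
     on the way up from [- c ro] the function [M] meets [v] again. *)
  have [|r1 [r10 /eqP + _]] := rootE (c ro / 2).
    by apply/andP; split; lra.
  rewrite subr_eq0 eq_sym => /eqP Mr1.
  have ror1 : ro < r1.
    by rewrite ltNge; apply/negP => /(Mlt0 _ r10); rewrite Mr1; lra.
  have v0 : v < 0 by rewrite -Mr; exact: Mlt0.
  have [x /andP[rox _] Mx] : exists2 x, ro <= x <= r1 & M x = v.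
    by apply: IVT_pos => //; [exact: ltW|rewrite Mro Mr1; apply/orP; left; lra].
  have xr : x = r by apply: (@uniq v) => //; [exact/andP|exact: lt_le_trans rox].
  have : r = ro by apply/eqP; rewrite eq_le rro -xr.
  by move=> rE; move: va; rewrite -Mr rE Mro ltxx.
move=> [k0 + kU]; set v := u.2 / u.1 in v1 v2.
have e s : 0 < s -> lambda2 p (s, L1 p s u) = v - M s by exact: lambda2_L1.
have hv : - c ro < v < c ro by exact/andP.
rewrite e// => /eqP; rewrite subr_eq0 eq_sym => /eqP Mk.
have rok := above _ _ hv k0 Mk.
(* Otherwise [M] takes the value [v] between [s] and [ro], where it equals [- c ro < v]; both points
   lie before [k]. *)
have below s : 0 < s -> s < k -> M s < v.
  move=> s0 sk; rewrite ltNge; apply/negP => vs.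
  suff [x /andP[x0 xk] Mx] : exists2 x, 0 < x < k & M x = v.
    by move: xk; rewrite (uniq _ _ _ hv x0 k0 Mx Mk) ltxx.
  have [sro|ros] := leP s ro.
    have [|x /andP[sx xro] Mx] := IVT_pos s0 sro Mc (y := v).
      by rewrite Mro vs (ltW v1) orbT.
    by exists x; rewrite // (lt_le_trans s0)// (le_lt_trans xro).
  have [|x /andP[rox xs] Mx] := IVT_pos u0 (ltW ros) Mc (y := v).
    by rewrite Mro vs (ltW v1).
  by exists x; rewrite // (lt_le_trans u0)// (le_lt_trans xs).
have over s : k < s -> v < M s.
  move=> ks; have s0 := lt_trans k0 ks; rewrite ltNge le_eqVlt; apply/negP => /predU1P[|sv].
    by move=> /(uniq _ _ _ hv s0 k0)/(_ Mk) sk; move: ks; rewrite sk ltxx.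
  (* A value [y] slightly below [v] is taken once in [[ro, k]] and once in [[k, s]]. Uniqueness puts
     both points at [k], where [M] is [v]. The maximum keeps [y] admissible even if [M s] drops
     below [- c ro]. *)
  have mv : Num.max (M s) (- c ro) < v by rewrite gt_max sv.
  have [my yv] := midf_lt mv; set y := (_ / 2) in my yv.
  move: my; rewrite gt_max => /andP[sy cy].
  have [|x /andP[rox xk] Mx] := IVT_pos u0 (ltW rok) Mc (y := y).
    by rewrite Mro Mk (ltW cy) (ltW yv).
  have [|z /andP[kz zs] Mz] := IVT_pos k0 (ltW ks) Mc (y := y).
    by rewrite Mk (ltW sy) (ltW yv) orbT.
  have xz : x = z.
    by apply: (@uniq y) => //; [apply/andP; split=> //; exact: lt_trans yv v2
      |exact: lt_le_trans rox|exact: lt_le_trans kz].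
  have xk' : x = k by apply/eqP; rewrite eq_le xk xz.
  by move: yv; rewrite -Mx xk' Mk ltxx.
split=> // s s0; rewrite e// subr_ge0 subr_gt0.
have [sk|ks|->] := ltgtP s k; last by rewrite Mk lexx ltxx.
  by have := below _ s0 sk; case: ltgtP.
by have := over _ ks; case: ltgtP.
Qed.

Lemma sonic_densitiesP u h k :
  (forall v, A0 p v -> exists r,
     unique_positive_root (fun s => lambda2 p (s, L1 p s v)) r) ->
  A0 p u -> unique_positive_root (fun s => lambda1 p (s, L1 p s u)) h ->
  unique_positive_root (fun s => lambda2 p (s, L1 p s u)) k ->
  sonic_densities u h k.
Proof.
move=> H Au hh hk; have [h0 hu hs] := lambda1_root_sign Au hh.
by have [uk ks] := lambda2_root_sign H Au hk; split.
Qed.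

Lemma boundary_densities_left cl hl cr hr u :
  boundary_densities p cl hl cr hr -> A0 p u -> sonic_densities u (hl u) (cl u).
Proof.
move=> H Au; have [_ rcl _ rhl] := H _ Au; apply: sonic_densitiesP => // v /H.
by case=> _ + _ _; exists (cl v).
Qed.

Lemma unique_positive_root_opp (f g : R -> R) r :
  (forall s, 0 < s -> f s = - g s) ->
  unique_positive_root f r -> unique_positive_root g r.
Proof.
move=> fg [r0 fr fU]; split=> // [|s s0 gs].
  by apply: oppr_inj; rewrite oppr0 -fg.
by apply: fU => //; rewrite fg// gs oppr0.
Qed.

(** Reflection exchanges the two speeds up to sign, so [cr], a zero of [lambda2], plays the part of
    [h], and [hr], a zero of [lambda1], that of [k]. *)
Lemma boundary_densities_right cl hl cr hr u :
  boundary_densities p cl hl cr hr -> A0 p u ->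
  sonic_densities (refl u) (cr u) (hr u).
Proof.
move=> H Au; have [rcr _ rhr _] := H _ Au; apply: sonic_densitiesP.
- move=> v Av; have [_ + _ _] := H _ Av; by exists (cl v).
- exact: A0_refl.
- apply: unique_positive_root_opp rcr => s s0.
  by rewrite -lambda2_refl /refl/= L2rev_refl.
- apply: unique_positive_root_opp rhr => s s0.
  by rewrite -lambda1_refl /refl/= L2rev_refl ?opprK.
Qed.

(** * Flux balance at the junction as a function of the common density *)

Section Junction.
Variables (al ar : R) (u1 u2 : state R) (h1 k1 h2 k2 : R).
Hypotheses (al0 : 0 < al) (ar0 : 0 < ar).
Hypotheses (S1 : sonic_densities u1 h1 k1) (S2 : sonic_densities u2 h2 k2).
(** [u2] stands for the reflected right state, hence a sum: its second term is [- ar * L2rev]. *)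
Let F r := al * L1 p r u1 + ar * L1 p r u2.
Let l' := Num.max h1 h2.
Let l'' := Num.min k1 k2.

Lemma junction_lower_gt0 : 0 < l'.
Proof. by case: S1 => h0 _ _ _ _; rewrite lt_max h0. Qed.

Lemma junction_decreasing s t : l' <= s -> s < t -> F t < F s.
Proof.
rewrite ge_max => /andP[hs1 hs2] st.
have [a0 au _ al1 _] := S1; have [b0 bu _ bl1 _] := S2.
have s0 := lt_le_trans a0 hs1.
rewrite /F ltrD// ltr_pM2l//; apply: L1_decreasing => //.
- exact: lt_trans au.
- by rewrite (al1 _ s0).1.
- exact: lt_trans bu.
- by rewrite (bl1 _ s0).1.
Qed.

Lemma junction_continuous s : 0 < s -> {for s, continuous F}.
Proof.
move=> s0; have [a0 au _ _ _] := S1; have [b0 bu _ _ _] := S2.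
by apply: cvgD; apply: cvgM; (try exact: cvg_cst); apply: L1_continuous => //;
  exact: lt_trans au || exact: lt_trans bu.
Qed.

End Junction.

(* If the first curve only becomes subsonic after the second has left the
   subsonic region, the two inequalities compare the fluxes [± s c(s)] and force
   both [ar < al] and [al < ar]. *)
Lemma sonic_densities_order_aux (al ar : R) u1 u2 (h1 k1 h2 k2 : R) : 0 < al -> 0 < ar ->
  sonic_densities u1 h1 k1 -> sonic_densities u2 h2 k2 ->
  0 <= al * L1 p h1 u1 + ar * L1 p h1 u2 ->
  al * L1 p k2 u1 + ar * L1 p k2 u2 <= 0 -> h1 <= k2.
Proof.
move=> al0 ar0 [h10 hu1 uk1 s1 _] [h20 hu2 uk2 _ s2].
have k20 : 0 < k2 by rewrite (lt_trans h20)// (lt_trans hu2).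
rewrite [_ <= k2]leNgt => F1 F2; apply/negP => kh.
have flux2 s u : 0 < s -> 0 < lambda2 p (s, L1 p s u) = (- (s * c s) < L1 p s u).
  move=> s0; rewrite /lambda2/= -(ltr_pM2r s0) mulrDl mul0r divfK ?gt_eqF//.
  by rewrite -ltrBlDr sub0r mulrC.
have flux1 s u : 0 < s -> lambda1 p (s, L1 p s u) < 0 = (L1 p s u < s * c s).
  move=> s0; rewrite /lambda1/= -(ltr_pM2r s0) mulrBl mul0r divfK ?gt_eqF//.
  by rewrite subr_lt0 mulrC.
(* At its own sonic density each curve carries exactly the sonic flux, positive at [h1] and negative
   at [k2]. *)
have L1h : h1 * c h1 <= L1 p h1 u1 by rewrite leNgt -flux1// (s1 _ h10).2 ltxx.
have L1h' : L1 p h1 u1 <= h1 * c h1.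
  have := (s1 _ h10).1; rewrite lexx /lambda1/= -(ler_pM2r h10) mulrBl mul0r.
  by rewrite divfK ?gt_eqF// subr_le0 mulrC.
have L1k : L1 p k2 u2 <= - (k2 * c k2) by rewrite leNgt -flux2// (s2 _ k20).2 ltxx.
have L1k' : - (k2 * c k2) <= L1 p k2 u2.
  have := (s2 _ k20).1; rewrite lexx /lambda2/= -(ler_pM2r k20) mulrDl mul0r.
  by rewrite divfK ?gt_eqF// -lerBlDr sub0r mulrC.
(* As [k2 < h1], each curve is strictly supersonic at the sonic density of the other. *)
have L2h : L1 p h1 u2 < - (h1 * c h1).
  have := (s2 _ h10).1; rewrite leNgt [RHS]leNgt kh /= => /negbFE.
  rewrite /lambda2/= -(ltr_pM2r h10) mulrDl mul0r divfK ?gt_eqF//.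
  by rewrite -ltrBrDr sub0r mulrC.
have L2k : k2 * c k2 < L1 p k2 u1.
  have := (s1 _ k20).1; rewrite leNgt [RHS]leNgt kh /= => /negbFE.
  rewrite /lambda1/= -(ltr_pM2r k20) mulrBl mul0r divfK ?gt_eqF//.
  by rewrite subr_gt0 mulrC.
have C1 := mulr_gt0 h10 (sound_speed_gt0 h10).
have C2 := mulr_gt0 k20 (sound_speed_gt0 k20).
have e1 : L1 p h1 u1 = h1 * c h1 by apply/eqP; rewrite eq_le L1h L1h'.
have e2 : L1 p k2 u2 = - (k2 * c k2) by apply/eqP; rewrite eq_le L1k L1k'.
have g1 : ar < al.
  rewrite -(ltr_pM2r C1).
  have : ar * L1 p h1 u2 < ar * - (h1 * c h1) by rewrite ltr_pM2l.
  by move: F1; rewrite e1; lra.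
have g2 : al < ar.
  rewrite -(ltr_pM2r C2).
  have : al * (k2 * c k2) < al * L1 p k2 u1 by rewrite ltr_pM2l.
  by move: F2; rewrite e2; lra.
by have := lt_trans g1 g2; rewrite ltxx.
Qed.

Section JunctionDensity.
Variables (al ar : R) (u1 u2 : state R) (h1 k1 h2 k2 : R).
Hypotheses (al0 : 0 < al) (ar0 : 0 < ar).
Hypotheses (S1 : sonic_densities u1 h1 k1) (S2 : sonic_densities u2 h2 k2).
Let F r := al * L1 p r u1 + ar * L1 p r u2.
Let l' := Num.max h1 h2.
Let l'' := Num.min k1 k2.

(** If the maximum and the minimum belong to the same curve, the order is built into
    [sonic_densities]. The two mixed cases are exchanged by swapping the curves. *)
Lemma junction_order : 0 <= F l' -> F l'' <= 0 -> l' <= l''.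
Proof.
rewrite /F /l' /l'' => F1 F2.
have [_ a1 a2 _ _] := S1; have [_ b1 b2 _ _] := S2.
have hk1 := lt_trans a1 a2; have hk2 := lt_trans b1 b2.
have comm r : al * L1 p r u1 + ar * L1 p r u2 = ar * L1 p r u2 + al * L1 p r u1.
  exact: addrC.
have [h21|h12] := leP h2 h1.
- rewrite (max_idPl h21) in F1 *; have [k12|k21] := leP k1 k2; first exact: ltW.
  rewrite (min_idPr (ltW k21)) in F2.
  exact: (sonic_densities_order_aux al0 ar0 S1 S2).
- rewrite (max_idPr (ltW h12)) in F1 *; have [k12|k21] := leP k1 k2; last exact: ltW.
  rewrite (min_idPl k12) in F2; rewrite comm in F1; rewrite comm in F2.
  exact: (sonic_densities_order_aux ar0 al0 S2 S1).
Qed.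

Lemma junction_density_le :
  (0 <= F l' /\ F l'' <= 0) <-> exists2 r, l' <= r <= l'' & F r = 0.
Proof.
have l0 : 0 < l' by exact: junction_lower_gt0 S1.
have dec := junction_decreasing al0 ar0 S1 S2.
split=> [[F1 F2]|[r /andP[r1 r2] Fr]].
  apply: IVT_pos (l0) (junction_order F1 F2) _ _.
    by move=> x; exact: junction_continuous S1 S2 x.
  by rewrite F1 F2 orbT.
have dec' s t : l' <= s -> s <= t -> F t <= F s.
  by move=> l's; rewrite le_eqVlt => /predU1P[->//|/(dec _ _ l's)/ltW].
by rewrite -Fr; split; exact: dec'.
Qed.

Lemma junction_density_lt :
  (0 <= F l' /\ F l'' < 0) <-> exists2 r, l' <= r < l'' & F r = 0.
Proof.
have dec := junction_decreasing al0 ar0 S1 S2.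
split=> [[F1 F2]|[r /andP[r1 r2] Fr]].
  have [|r /andP[r1 r2] Fr] := junction_density_le.1; first by split=> //; exact: ltW.
  exists r => //; rewrite r1 lt_neqAle r2 andbT; apply/eqP => rE.
  by move: F2; rewrite -rE Fr ltxx.
have [F1 _] : 0 <= F l' /\ F l'' <= 0.
  by apply/junction_density_le; exists r; rewrite ?r1 ?ltW.
by split=> //; rewrite -Fr; exact: dec.
Qed.

End JunctionDensity.

End LaxCurves.

(** * Self-similar weak solutions *)

Section SelfSimilar.
Context {R : realType}.
Implicit Types (f g W F : R -> R) (s t x y M N : R).

(** * Integrals of bounded, compactly supported functions, and dilations *)

Lemma integrable_bounded_itv f M a b : measurable_fun [set: R] f ->
  (forall x, `|f x| <= M) -> mu.-integrable `[a, b] (EFin \o f).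
Proof.
move=> mf bf; apply: measurable_bounded_integrable => //.
- by apply: compact_finite_measure; exact: segment_compact.
- exact: measurable_funTS.
- exists M; split; first exact: num_real.
  by move=> x Mx y _; exact: le_trans (bf y) (ltW Mx).
Qed.

Lemma Rintegral_eq0 f (A : set R) : (forall x, A x -> f x = 0) ->
  \int[mu]_(x in A) f x = 0.
Proof. by move=> f0; rewrite /Rintegral integral0_eq// => x /f0 ->. Qed.

Lemma restrict_csupp f N : (forall x, N < `|x| -> f x = 0) ->
  f \_ `[- N, N] = f.
Proof.
move=> f0; apply/funext => x; rewrite patchE; case: ifPn => //.
by rewrite notin_setE/= in_itv/= -ler_norml => /negP; rewrite -ltNge => /f0.
Qed.

Lemma Rintegral_csupp f N : (forall x, N < `|x| -> f x = 0) ->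
  \int[mu]_x f x = \int[mu]_(x in `[- N, N]) f x.
Proof. by move=> f0; rewrite [RHS]Rintegral_mkcond restrict_csupp. Qed.

Lemma integrable_csupp f M N : measurable_fun [set: R] f ->
  (forall x, `|f x| <= M) -> (forall x, N < `|x| -> f x = 0) ->
  mu.-integrable [set: R] (EFin \o f).
Proof.
move=> mf bf f0; rewrite -(restrict_csupp f0) -restrict_EFin.
apply/integrable_restrict => //; rewrite setTI.
exact: integrable_bounded_itv bf.
Qed.

(** By uniqueness of Lebesgue measure, half-open intervals suffice. Negative [t] is included because
    [t = -1] is the reflection that exchanges the two half-lines. *)
Lemma lebesgue_measure_scale t (A : set R) : t != 0 -> measurable A ->
  mu A = (`|t|%:E * mu ((fun x => t * x)%R @^-1` A))%E.
Proof.
move=> t0 mA; pose tn : {nonneg R} := NngNum (normr_ge0 t).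
have mS : measurable_fun [set: R] (fun x => t * x) by exact: mulrl_measurable.
rewrite (@lebesgue_measure_unique R
  (mscale tn (pushforward mu (fun x : measurableTypeR R => (t * x : measurableTypeR R)))) )//.
move=> _ [[a b] _ <-] /=; rewrite /mscale /= /pushforward.
move: t0; rewrite neq_lt => /orP[t0|t0].
- have -> : (fun x => t * x) @^-1` `]a, b] = `[b / t, a / t[%classic.
    apply/seteqP; split => x /=; rewrite !in_itv/= ler_ndivrMr// ltr_ndivlMr// mulrC.
      by move=> /andP[-> ->].
    by move=> /andP[-> ->].
  rewrite !lebesgue_measure_itv/= !lte_fin ltr_nM2r ?invr_lt0//.
  case: ifP => _; last by rewrite mule0.
  by rewrite -!EFinD -EFinM; congr (_%:E); rewrite ltr0_norm//; field; rewrite lt_eqF.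
- have -> : (fun x => t * x) @^-1` `]a, b] = `]a / t, b / t]%classic.
    by apply/seteqP; split => x /=; rewrite !in_itv/= ltr_pdivrMr// ler_pdivlMr// mulrC.
  rewrite !lebesgue_measure_itv/= !lte_fin ltr_pM2r ?invr_gt0//.
  case: ifP => _; last by rewrite mule0.
  by rewrite -!EFinB -EFinM -mulrBl gtr0_norm// mulrC divfK// gt_eqF.
Qed.

Lemma ge0_integral_scale t (f : R -> \bar R) : t != 0 ->
  measurable_fun [set: R] f -> (forall x, 0 <= f x)%E ->
  (\int[mu]_x f x = `|t|%:E * \int[mu]_x f (t * x)%R)%E.
Proof.
move=> t0 mf f0; pose tn : {nonneg R} := NngNum (normr_ge0 t).
pose S := fun x : measurableTypeR R => (t * x : measurableTypeR R).
have mS : measurable_fun [set: measurableTypeR R] S by exact: mulrl_measurable.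
rewrite (@eq_measure_integral _ _ _ _ (mscale tn (pushforward mu S)))//=; last first.
  by move=> A mA _; rewrite (lebesgue_measure_scale t0).
by rewrite ge0_integral_mscale//= ge0_integral_pushforward.
Qed.

Lemma integrable_scale t f : t != 0 -> mu.-integrable [set: R] (EFin \o f) ->
  mu.-integrable [set: R] (EFin \o (fun x => f (t * x))).
Proof.
move=> t0 /integrableP[mf fi]; apply/integrableP; split.
  by apply: (@measurableT_comp _ _ _ _ _ _ (EFin \o f)) => //; exact: mulrl_measurable.
have mf' : measurable_fun [set: R] (fun x => `|(f x)%:E|)%E.
  exact: (measurableT_comp (@abse_measurable R _) mf).
move: fi; rewrite (ge0_integral_scale t0 mf')//=.
rewrite !ltey; apply: contraNN => /eqP ->.
by rewrite gt0_muley// lte_fin normr_gt0.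
Qed.

Lemma Rintegral_scale t f : t != 0 -> mu.-integrable [set: R] (EFin \o f) ->
  \int[mu]_x f x = `|t| * \int[mu]_x f (t * x).
Proof.
move=> t0 fi; rewrite /Rintegral; have /integrableP[mf' _] := fi.
have {}fi := integrable_scale t0 fi.
have ep := ge0_integral_scale t0 (measurable_funepos mf') (funepos_ge0 _).
have en := ge0_integral_scale t0 (measurable_funeneg mf') (funeneg_ge0 _).
rewrite integralE ep en.
pose S x := t * x; pose g := EFin \o f.
have -> : (fun x => (f (t * x))%:E) = g \o S by [].
have := integrable_pos_fin_num measurableT fi.
have := integrable_neg_fin_num measurableT fi.
have -> : EFin \o (fun x => f (t * x)) = g \o S by [].
rewrite (funepos_comp g S) (funeneg_comp g S) => in_ ip.
rewrite [in RHS]integralE (funepos_comp g S) (funeneg_comp g S).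
rewrite -muleBr//; last exact: fin_num_adde_defr.
by rewrite fineM// fin_numB ip.
Qed.

Lemma is_derive_mul f g x (df dg : R) :
  is_derive x (1 : R) f df -> is_derive x (1 : R) g dg ->
  is_derive x (1 : R) (fun y => f y * g y) (df * g x + f x * dg).
Proof.
move=> hf hg; have h := is_deriveM hf hg.
by apply: is_derive_eq h _; rewrite addrC [df * _]mulrC.
Qed.

Lemma MVT_between f (df : R -> R) s t :
  (forall x : R, is_derive x (1 : R) f (df x)) ->
  exists2 z, `|z - t| <= `|s - t| & f s - f t = df z * (s - t).
Proof.
move=> fdf; have cf a b : {within `[a, b], continuous f}.
  by apply: derivable_within_continuous => x _; exact: ex_derive.
have [st|ts|->] := ltgtP s t; last by exists t; rewrite // !subrr mulr0.
- have [z] := MVT st (fun x _ => fdf x) (cf _ _).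
  rewrite in_itv/= => /andP[sz zt] e; exists z.
    by rewrite !ltr0_norm ?subr_lt0// lerN2 lerD2r ltW.
  by rewrite -opprB e -mulrN opprB.
- have [z] := MVT ts (fun x _ => fdf x) (cf _ _).
  rewrite in_itv/= => /andP[tz zs] e; exists z => //.
  by rewrite !gtr0_norm ?subr_gt0// lerD2r ltW.
Qed.

(** * Regularity and support of test functions *)

Section TestFunction.
Variable phi : R -> R -> R.
Hypothesis tphi : test_function phi.
Let supp := closure [set z : R * R | phi z.1 z.2 != 0].

Lemma test_function_dt t x : is_derive t (1 : R) (phi ^~ x) (dt phi t x).
Proof.
case: tphi => /(_ t x)[d _] _ _ _ _.
by rewrite /dt derive1E; exact: DeriveDef.
Qed.

Lemma test_function_dx t x : is_derive x (1 : R) (phi t) (dx phi t x).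
Proof.
case: tphi => /(_ t x)[_ d] _ _ _ _.
by rewrite /dx derive1E; exact: DeriveDef.
Qed.

(** The support is closed, so [phi] vanishes on a whole neighbourhood of such a point. *)
Lemma test_function_notin t x : ~ supp (t, x) ->
  [/\ phi t x = 0, dt phi t x = 0 & dx phi t x = 0].
Proof.
move=> nsupp.
have nz : \forall z \near (t, x), phi z.1 z.2 = 0.
  have : open_nbhs (t, x) (~` supp).
    by split=> //; apply: closed_openC; exact: closed_closure.
  move=> /open_nbhs_nbhs; apply: filterS => z nz.
  by apply/eqP/negPn/negP => pz; apply: nz; exact: subset_closure.
split; first exact: (nbhs_singleton nz).
- rewrite /dt derive1E (@near_eq_derive _ _ _ _ (cst 0)) ?derive_cst//.
  have : (y, x) @[y --> t] --> (t, x).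
    exact: (cvg_pair cvg_id (cvg_cst x)).
  by move/(_ _ nz).
- rewrite /dx derive1E (@near_eq_derive _ _ _ _ (cst 0)) ?derive_cst//.
  have : (t, y) @[y --> x] --> (t, x).
    exact: (cvg_pair (cvg_cst t) cvg_id).
  by move/(_ _ nz).
Qed.

Lemma test_function_box : exists a b N : R, [/\ 0 < a, a < b, 0 < N &
  forall t x, supp (t, x) -> a <= t <= b /\ `|x| <= N].
Proof.
case: tphi => _ _ _ cs sub.
(* Times stay away from 0 because [t^-1] is continuous, hence bounded, on the compact support. *)
have cfst : compact [set z.1^-1 | z in supp].
  apply: continuous_compact cs; apply: continuous_in_subspaceT => z.
  rewrite inE => /sub[z0 _]; apply: cvgV; first by rewrite gt_eqF.
  exact: cvg_fst.
have [B1 [_ b1]] := compact_bounded cfst.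
have [B2 [_ b2]] := compact_bounded cs.
pose N : R := `|B2| + 1; pose C : R := `|B1| + 1.
have N0 : 0 < N by rewrite ltr_pwDr.
have C0 : 0 < C by rewrite ltr_pwDr.
have BN : B2 < N by rewrite (le_lt_trans (ler_norm _))// ltrDl.
have BC : B1 < C by rewrite (le_lt_trans (ler_norm _))// ltrDl.
exists C^-1, (N + C^-1), N; split; rewrite ?invr_gt0// ?ltrDr// => t x s.
have /= := b2 _ BN (t, x) s; rewrite prod_normE/= ge_max => /andP[tN xN].
split=> //; have [/= t0 _] := sub _ s.
rewrite -[t]invrK lef_pV2 ?posrE ?invr_gt0//; apply/andP; split.
  have /(b1 _ BC _) /= : [set z.1^-1 | z in supp] t^-1 by exists (t, x).
  by rewrite gtr0_norm ?invr_gt0.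
by rewrite invrK -[t]gtr0_norm// (le_trans tN)// lerDl invr_ge0 ltW.
Qed.

(** Total differentiability from continuous partial derivatives: the increment is split into a move
    in time at position [y] and a move in space at time [t], with one mean value point for each. *)
Lemma test_function_estimate t x (e : R) : 0 < e ->
  \forall z \near (t, x),
    `|phi z.1 z.2 - phi t x - ((z.1 - t) * dt phi t x + (z.2 - x) * dx phi t x)|
    <= e * (`|z.1 - t| + `|z.2 - x|).
Proof.
move=> e0; case: tphi => _ cdt cdx _ _.
have n1 : \forall z \near (t, x), `|dt phi t x - dt phi z.1 z.2| <= e.
  by move/cvgrPdist_le : (cdt (t, x)) => /(_ e e0).
have n2 : \forall z \near (t, x), `|dx phi t x - dx phi z.1 z.2| <= e.
  by move/cvgrPdist_le : (cdx (t, x)) => /(_ e e0).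
have [d /= d0 sub] := (nbhs_ballP _ _).1 (filterI n1 n2).
apply/nbhs_ballP; exists d => //= -[s y] [/= ts xy].
have ball_R (a b : R) : ball a d b = (`|b - a| < d) by rewrite -ball_normE/= distrC.
rewrite !ball_R in ts xy.
have [c1 ct e1] := MVT_between s t (fun z => test_function_dt z y).
have [c2 cx e2] := MVT_between y x (fun z => test_function_dx t z).
have ct' : ball t d c1 by rewrite ball_R (le_lt_trans ct).
have cx' : ball x d c2 by rewrite ball_R (le_lt_trans cx).
have [/= h1 _] : `|dt phi t x - dt phi c1 y| <= e /\ `|dx phi t x - dx phi c1 y| <= e.
  by apply: (sub (c1, y)); split=> //=; rewrite ball_R.
have [/= _ h2] : `|dt phi t x - dt phi t c2| <= e /\ `|dx phi t x - dx phi t c2| <= e.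
  by apply: (sub (t, c2)); split=> //=; exact: ballxx.
have -> : phi s y - phi t x - ((s - t) * dt phi t x + (y - x) * dx phi t x) =
    (s - t) * (dt phi c1 y - dt phi t x) + (y - x) * (dx phi t c2 - dx phi t x).
  have -> : phi s y - phi t x = (phi s y - phi t y) + (phi t y - phi t x).
    by rewrite addrA subrK.
  by rewrite e1 e2; ring.
rewrite (le_trans (ler_normD _ _))// !normrM mulrDr.
by rewrite lerD// mulrC ler_wpM2r// distrC.
Qed.

Lemma test_function_continuous : continuous (fun z : R * R => phi z.1 z.2).
Proof.
move=> [t x]; apply/cvgrPdist_le => e e0.
pose C : R := 1 + `|dt phi t x| + (1 + `|dx phi t x|).
have C0 : 0 < C by rewrite addr_gt0// ltr_pwDl.
have eC0 : 0 < e / C by rewrite divr_gt0.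
near=> z.
have /= h : `|phi z.1 z.2 - phi t x -
    ((z.1 - t) * dt phi t x + (z.2 - x) * dx phi t x)|
    <= 1 * (`|z.1 - t| + `|z.2 - x|).
  by near: z; exact: test_function_estimate.
have [/= z1 z2] : ball (t, x) (e / C) z by near: z; exact: (@nbhsx_ballx R (R * R)%type (t, x) _ eC0).
rewrite -ball_normE/= distrC in z1; rewrite -ball_normE/= distrC in z2.
rewrite distrC -[X in `|X|](subrK ((z.1 - t) * dt phi t x + (z.2 - x) * dx phi t x)).
rewrite (le_trans (ler_normD _ _))//.
apply: (le_trans (lerD h (ler_normD _ _))); rewrite !normrM mul1r.
rewrite -[leRHS](divfK (lt0r_neq0 C0)).
have D0 := normr_ge0 (dt phi t x); have D1 := normr_ge0 (dx phi t x).
move: (ltW z1) (ltW z2) D0 D1; rewrite /C.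
have := normr_ge0 (z.1 - t); have := normr_ge0 (z.2 - x).
move: `|z.1 - t| `|z.2 - x| `|dt phi t x| `|dx phi t x| => a b D D'.
move: (_ / _) => k; nra.
Unshelve. all: by end_near. Qed.

(** The chain rule along the ray of slope [x]; the displacement has size [1 + |x|] times [|h|],
    whence the constant [C]. *)
Lemma test_function_ray t x :
  is_derive t (1 : R) (fun s => phi s (s * x)) (dt phi t (t * x) + x * dx phi t (t * x)).
Proof.
set L := _ + _.
suff H : h^-1 *: (((fun s => phi s (s * x)) \o shift t) h%:A - phi t (t * x))
    @[h --> 0^'] --> L.
  have dL : 'D_1 (fun s => phi s (s * x)) t = L by exact: cvg_lim H.
  by apply: DeriveDef => //; apply/cvg_ex; exists L.
apply/cvgrPdist_le => e e0.
pose C := 1 + `|x|; have C0 : 0 < C by rewrite ltr_pwDl.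
have eC0 : 0 < e / C by rewrite divr_gt0.
have ray : (h + t, (h + t) * x) @[h --> 0^'] --> (t, t * x).
  apply: cvg_within_filter.
  have c1 : h + t @[h --> 0] --> t by rewrite -[X in _ --> X]add0r; apply: cvgD; [exact: cvg_id|exact: cvg_cst].
  exact: (cvg_pair c1 (cvgM c1 (cvg_cst x))).
have := ray _ (test_function_estimate t (t * x) eC0); rewrite /nbhs/= => hn.
near=> h; have h0 : h != 0 by near: h; exact: nbhs_dnbhs_neq.
have : `|phi (h + t) ((h + t) * x) - phi t (t * x) -
    ((h + t - t) * dt phi t (t * x) + ((h + t) * x - t * x) * dx phi t (t * x))|
    <= e / C * (`|h + t - t| + `|(h + t) * x - t * x|).
  by near: h.
have -> : h + t - t = h by rewrite addrK.
have -> : (h + t) * x - t * x = h * x by rewrite mulrDl addrK.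
have -> : e / C * (`|h| + `|h * x|) = e * `|h|.
  by rewrite normrM /C; field; rewrite gt_eqF.
rewrite /= [h%:A]mulr1 distrC => H.
have -> : L - h^-1 *: (phi (h + t) ((h + t) * x) - phi t (t * x)) =
    h^-1 * (h * dt phi t (t * x) + h * x * dx phi t (t * x) -
    (phi (h + t) ((h + t) * x) - phi t (t * x))).
  by rewrite /L /GRing.scale/=; field.
by rewrite normrM normfV ler_pdivrMl ?normr_gt0// [leRHS]mulrC.
Unshelve. all: by end_near. Qed.

End TestFunction.

Lemma bounded_off_compact (g : R * R -> R) (A : set (R * R)) :
  compact A -> continuous g -> (forall z, ~ A z -> g z = 0) ->
  exists2 B : R, 0 < B & forall z, `|g z| <= B.
Proof.
move=> cA cg g0.
have cgA : compact [set g z | z in A].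
  by apply: continuous_compact cA; exact: continuous_subspaceT.
have [B0 [_ hB]] := compact_bounded cgA.
have BB : B0 < `|B0| + 1 by rewrite (le_lt_trans (ler_norm _))// ltrDl.
exists (`|B0| + 1); first by rewrite ltr_pwDr.
move=> z; have [Az|nAz] := pselect (A z); last by rewrite g0// normr0 addr_ge0.
by have /(hB _ BB) : [set g z | z in A] (g z) by exists z.
Qed.

Lemma continuous_ray (h : R * R -> R) t : continuous h ->
  continuous (fun x => h (t, t * x)).
Proof.
move=> ch x; have c2 : t * y @[y --> x] --> t * x.
  by apply: cvgM; [exact: cvg_cst|exact: cvg_id].
exact: (cvg_comp (fun y => (t, t * y)) h (cvg_pair (cvg_cst t) c2) (ch (t, t * x))).
Qed.

Lemma continuous_ray_time (h : R * R -> R) x : continuous h ->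
  continuous (fun t => h (t, t * x)).
Proof.
move=> ch t; have c2 : s * x @[s --> t] --> t * x.
  by apply: cvgM; [exact: cvg_id|exact: cvg_cst].
exact: (cvg_comp (fun s => (s, s * x)) h (cvg_pair cvg_id c2) (ch (t, t * x))).
Qed.

Lemma continuous_slice (h : R * R -> R) t : continuous h ->
  continuous (fun x => h (t, x)).
Proof.
move=> ch x.
exact: (cvg_comp (fun y => (t, y)) h (cvg_pair (cvg_cst t) cvg_id) (ch (t, x))).
Qed.

(* Weak form, away from 0, of [(F - x W)' = - W]. *)
Definition selfsimilar_flux W F := forall psi dpsi N,
  (forall x : R, is_derive x (1 : R) psi (dpsi x)) -> continuous dpsi ->
  (forall x, N < `|x| -> psi x = 0 /\ dpsi x = 0) -> psi 0 = 0 ->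
  \int[mu]_x ((F x - x * W x) * dpsi x - W x * psi x) = 0.

(** * Reduction of the weak formulation to an equation for the profile *)

Section WeakSelfSimilar.
Variables (W F : R -> R) (M : R).
Hypotheses (mW : measurable_fun [set: R] W) (mF : measurable_fun [set: R] F).
Hypotheses (bW : forall x, `|W x| <= M) (bF : forall x, `|F x| <= M).
Hypothesis (WF : selfsimilar_flux W F).
Variable phi : R -> R -> R.
Hypothesis tphi : test_function phi.
Let supp := closure [set z : R * R | phi z.1 z.2 != 0].
Variables (w f : R -> R -> R).
Hypothesis wE : forall t x, 0 < t -> w t x = W (x / t).
Hypothesis fE : forall t x, 0 < t -> f t x = F (x / t).
Let g t x := w t x * dt phi t x + f t x * dx phi t x.
(* Along the ray of slope [x], [K t x] is the derivative of [t phi(t, t x)], and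
   [t g(t, t x) = W x * K t x + ((F x - x W x) d/dx - W x) phi(t, t x)]. *)
Let K t x := phi t (t * x) + t * (dt phi t (t * x) + x * dx phi t (t * x)).

Let cphi := test_function_continuous tphi.
Let cdt : continuous (fun z : R * R => dt phi z.1 z.2).
Proof. by case: tphi. Qed.
Let cdx : continuous (fun z : R * R => dx phi z.1 z.2).
Proof. by case: tphi. Qed.

Let K_ray x : continuous (K ^~ x).
Proof.
have c1 := @continuous_ray_time _ x cphi; have c2 := @continuous_ray_time _ x cdt.
have c3 := @continuous_ray_time _ x cdx; move=> t.
apply: cvgD; first exact: c1.
apply: cvgM; first exact: cvg_id.
by apply: cvgD; [exact: c2|apply: cvgM; [exact: cvg_cst|exact: c3]].
Qed.

Let mK t : measurable_fun [set: R] (K t).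
Proof.
apply: continuous_measurable_fun => x.
have c1 := @continuous_ray _ t cphi; have c2 := @continuous_ray _ t cdt.
have c3 := @continuous_ray _ t cdx.
apply: cvgD; first exact: c1.
apply: cvgM; first exact: cvg_cst.
by apply: cvgD; [exact: c2|apply: cvgM; [exact: cvg_id|exact: c3]].
Qed.

(** After [x = t xi] the space integral of [g t] becomes that of [W * K t], the rest being the
    profile equation tested with [phi t (t * xi)]. As [K] is a time derivative, differentiation
    under the integral gives [J = I'], and [I] vanishes outside [[a, b]], so the time integral is
    0. *)
Lemma weak_conservation_selfsimilar_test :
  [/\ forall t, 0 <= t -> mu.-integrable [set: R] (EFin \o g t),
      mu.-integrable `[0, +oo[ (fun t => (\int[mu]_x g t x)%:E) &
      \int[mu]_(t in `[0, +oo[) \int[mu]_x g t x = 0].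
Proof.
have [a [b [N [/= a0 ab N0 box]]]] := test_function_box tphi.
have notin t x (h : ~ supp (t, x)) := test_function_notin h.
have [_ _ _ csupp _] := tphi.
have [|B1 B10 hB1] := bounded_off_compact csupp cphi; first by move=> [t x] /notin[].
have [|B2 B20 hB2] := bounded_off_compact csupp cdt; first by move=> [t x] /notin[].
have [|B3 B30 hB3] := bounded_off_compact csupp cdx; first by move=> [t x] /notin[].
have M0 : 0 <= M by exact: le_trans (bW 0).
have offt t x : ~~ (a <= t <= b) -> ~ supp (t, x).
  by move=> /negP h /box[].
have offx t x : N < `|x| -> ~ supp (t, x).
  by move=> h /box[_]; rewrite leNgt h.
(* On the support [t >= a], so [|t * x| <= N] forces [|x| <= N / a]: one interval serves all
   times. *)
pose N1 : R := N / a; have N10 : 0 < N1 by rewrite divr_gt0.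
have offray t x : N1 < `|x| -> ~ supp (t, t * x).
  move=> h /box[/andP[a_t _]]; rewrite normrM leNgt => /negP; apply.
  have t0 := lt_le_trans a0 a_t; rewrite gtr0_norm//.
  by move: h; rewrite /N1 ltr_pdivrMr// mulrC => /lt_le_trans; apply; rewrite ler_wpM2r.
have K0 t x : ~ supp (t, t * x) -> K t x = 0.
  by move=> /notin[e1 e2 e3]; rewrite /K e1 e2 e3 mulr0 addr0 mulr0 addr0.
pose D := `[- N1, N1]%classic; pose T : R := b + 2.
have b0 := lt_trans a0 ab.
have T0 : 0 < T by rewrite addr_gt0.
pose C : R := B1 + T * (B2 + N1 * B3).
have C0 : 0 <= C.
  exact: ltW (addr_gt0 B10 (mulr_gt0 T0 (addr_gt0 B20 (mulr_gt0 N10 B30)))).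
have bK t x : 0 < t < T -> `|K t x| <= C.
  move=> /andP[t0 tT]; have [xN1|N1x] := leP `|x| N1; last first.
    by rewrite K0 ?normr0//; exact: offray.
  rewrite (le_trans (ler_normD _ _))// lerD ?hB1//; first exact: (hB1 (t, t * x)).
  rewrite normrM gtr0_norm// ler_pM ?(ltW t0) ?(ltW tT)//.
  rewrite (le_trans (ler_normD _ _))// lerD//; first exact: (hB2 (t, t * x)).
  by rewrite normrM ler_pM//; exact: (hB3 (t, t * x)).
pose J t := \int[mu]_(x in D) (W x * K t x).
have bWK t x : 0 < t < T -> `|W x * K t x| <= M * C.
  by move=> ht; rewrite normrM ler_pM// bK.
have mWK t : measurable_fun [set: R] (fun x => W x * K t x) by exact: measurable_funM.
have intWK t : 0 < t < T -> mu.-integrable D (EFin \o (fun x => W x * K t x)).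
  by move=> ht; apply: integrable_bounded_itv => // x; exact: bWK.
have intC (C' : R) : mu.-integrable D (EFin \o cst C').
  by apply: (@integrable_bounded_itv _ `|C'|).
have mD : measurable D by exact: measurable_itv.
have cJ : {in `]0, T[%classic, continuous J}.
  apply: (@continuity_under_integral R _ _ mu (fun t x => W x * K t x) D _ 0 T _ _ (cst (M * C))) => //.
  - by apply: aeW => x _ t _; apply: cvgM; [exact: cvg_cst|exact: K_ray].
  - move=> t ht; apply: aeW => x _; apply: bWK.
    by rewrite /= in_itv/= in ht.
pose I t := \int[mu]_(x in D) (W x * (t * phi t (t * x))).
have dI t : 0 < t < T -> is_derive t (1 : R) I (J t).
  move=> tT; have It : `]0, T[%classic t by rewrite /= in_itv.
  have dW s x : is_derive s (1 : R) (fun s => W x * (s * phi s (s * x))) (W x * K s x).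
    have h := is_derive_mul (is_derive_cst (W x) s 1)
      (is_derive_mul (is_derive_id s 1) (test_function_ray tphi s x)).
    by apply: is_derive_eq h _; rewrite mul0r add0r mul1r.
  have d1E s x : partial1of2 (fun t x => W x * (t * phi t (t * x))) s x = W x * K s x.
    by rewrite partial1of2E; exact: derive_val.
  have intf s : `]0, T[%classic s ->
      mu.-integrable D (EFin \o (fun x => W x * (s * phi s (s * x)))).
    rewrite /= in_itv/= => /andP[s0 sT].
    apply: (@integrable_bounded_itv _ (M * (T * B1))).
      apply: measurable_funM => //; apply: measurable_funM => //.
      by apply: continuous_measurable_fun; exact: (@continuous_ray _ s cphi).
    move=> x; rewrite !normrM ler_pM// ler_pM//; first by rewrite gtr0_norm// ltW.
    exact: (hB1 (s, s * x)).
  have derf s x : `]0, T[%classic s -> D x ->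
      derivable (fun t => W x * (t * phi t (t * x))) s 1.
    by move=> _ _; exact: (@ex_derive _ _ _ _ _ _ _ (dW s x)).
  have dub s x : `]0, T[%classic s -> D x ->
      `|partial1of2 (fun t x => W x * (t * phi t (t * x))) s x| <= cst (M * C) x.
    by rewrite /= in_itv/= => sT _; rewrite d1E bWK.
  have G0 x : 0 <= (cst (M * C) : R -> R) x by rewrite mulr_ge0.
  apply: DeriveDef.
    exact: (@derivable_under_integral R _ _ mu _ D mD t 0 T It intf derf (cst (M * C)) G0 (intC _) dub).
  rewrite -derive1E
    (@differentiation_under_integral R _ _ mu _ D mD t 0 T It intf derf (cst (M * C)) G0 (intC _) dub).
  by apply: eq_Rintegral => x _; rewrite d1E.
have J0 t : ~~ (a <= t <= b) -> J t = 0.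
  move=> ht; apply: Rintegral_eq0.
  by move=> x _ /=; rewrite K0 ?mulr0//; exact: offt.
(* Slightly larger than [[a, b]], so that [I] is 0 at both ends, yet inside []0, T[], where the
   bounds on [K] hold. *)
pose a' : R := a / 2; pose b' : R := b + 1.
have a'0 : 0 < a' by rewrite divr_gt0.
have a'a : a' < a by rewrite ltr_pdivrMr// ltr_pMr// ltr1n.
have bb' : b < b' by rewrite ltrDl.
have b'T : b' < T by rewrite ltrD2l ltr1n.
have a'b' : a' < b' by rewrite (lt_trans a'a)// (lt_trans ab).
have sub : `[a', b'] `<=` `]0, T[%classic.
  by move=> t /=; rewrite !in_itv/= => /andP[h1 h2]; rewrite (lt_le_trans a'0)// (le_lt_trans h2).
have cJ' : {within `[a', b'], continuous J}.
  apply: continuous_in_subspaceT => t; rewrite inE => /sub It.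
  by apply: cJ; rewrite inE.
have intJ : \int[mu]_(t in `[a', b']) J t = 0.
  have dI' t : t \in `[a', b'] -> is_derive t (1 : R) I (J t).
    by move=> /sub; rewrite /= in_itv/=; exact: dI.
  have I0 t : ~~ (a <= t <= b) -> I t = 0.
    move=> ht; apply: Rintegral_eq0.
    move=> x _ /=; have [-> _ _] := notin _ _ (offt _ (t * x) ht).
    by rewrite !mulr0.
  have cI t : t \in `[a', b'] -> {for t, continuous I}.
    by move=> /dI' d; apply/differentiable_continuous/derivable1_diffP/ex_derive.
  rewrite /Rintegral (@continuous_FTC2 _ J I)//; last 2 first.
  - split.
    + by move=> t /subset_itv_oo_cc /dI' d; exact: ex_derive.
    + by apply: cvg_at_right_filter; apply: cI; rewrite bound_itvE ltW.
    + by apply: cvg_at_left_filter; apply: cI; rewrite bound_itvE ltW.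
  - by move=> t /subset_itv_oo_cc /dI' d; rewrite derive1E; exact: derive_val.
  by rewrite !I0 ?subee// -?ltNge negb_and -!ltNge ?a'a ?bb' ?orbT.
have gE t x : 0 < t -> g t (t * x) = W x * dt phi t (t * x) + F x * dx phi t (t * x).
  by move=> t0; rewrite /g wE// fE// mulrAC divff ?gt_eqF// mul1r.
have g0 t x : ~ supp (t, x) -> g t x = 0.
  by move=> /notin[_ e2 e3]; rewrite /g e2 e3 !mulr0 addr0.
(* [wE] and [fE] say nothing at time 0; there the test function vanishes. *)
have g00 x : g 0 x = 0.
  by apply/g0/offt; rewrite negb_and -ltNge a0.
have mg t : 0 < t -> measurable_fun [set: R] (g t).
  move=> t0; rewrite /g.
  have mdiv : measurable_fun [set: R] (fun x : R => x / t) by exact: mulrr_measurable.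
  have e1 : w t = (fun x => W (x / t)) by apply/funext => x; exact: wE.
  have e2 : f t = (fun x => F (x / t)) by apply/funext => x; exact: fE.
  rewrite e1 e2; apply: measurable_funD; apply: measurable_funM.
  - exact: measurableT_comp.
  - by apply: continuous_measurable_fun; exact: (@continuous_slice _ t cdt).
  - exact: measurableT_comp.
  - by apply: continuous_measurable_fun; exact: (@continuous_slice _ t cdx).
have bg t x : 0 < t -> `|g t x| <= M * B2 + M * B3.
  move=> t0; rewrite /g wE// fE// (le_trans (ler_normD _ _))// !normrM lerD// ler_pM//.
    exact: (hB2 (t, x)).
  exact: (hB3 (t, x)).
have ig t : 0 <= t -> mu.-integrable [set: R] (EFin \o g t).
  rewrite le_eqVlt => /predU1P[<-|t0].
    have -> : g 0 = cst 0 by apply/funext => x; exact: g00.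
    exact: integrable0.
  by apply: (@integrable_csupp _ (M * B2 + M * B3) N) => [|x|x /offx/g0//]; [exact: mg|exact: bg].
have igray t : 0 < t -> mu.-integrable [set: R] (EFin \o (fun x => g t (t * x))).
  move=> t0; apply: (@integrable_csupp _ (M * B2 + M * B3) N1).
  - by apply: measurableT_comp; [exact: mg|exact: mulrl_measurable].
  - by move=> x; exact: bg.
  - by move=> x /offray/g0.
have gJ t : 0 <= t -> \int[mu]_x g t x = J t.
  have [tab _|tab _] := boolP (a <= t <= b); last first.
    by rewrite J0//; apply: Rintegral_eq0 => x _; exact/g0/offt.
  have [t0 tT] : 0 < t /\ t < T.
    move/andP: tab => [a_t t_b]; split; first exact: lt_le_trans a_t.
    by rewrite (le_lt_trans t_b)// ltrDl.
  rewrite (Rintegral_scale (lt0r_neq0 t0) (ig _ (ltW t0))) gtr0_norm// -RintegralZl//; last exact: igray.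
  pose h x := (F x - x * W x) * (t * dx phi t (t * x)) - W x * phi t (t * x).
  have hE x : h x = t * g t (t * x) - W x * K t x.
    by rewrite /h gE// /K; ring.
  have iWK : mu.-integrable [set: R] (EFin \o (fun x => W x * K t x)).
    apply: (@integrable_csupp _ (M * C) N1) => // [x|x /offray/K0 ->]; last by rewrite mulr0.
    by apply: bWK; rewrite t0.
  have itg : mu.-integrable [set: R] (EFin \o (fun x => t * g t (t * x))).
    have := integrableZl measurableT t (igray _ t0).
    by apply: eq_integrable => // x _; rewrite /= EFinM.
  have ih : mu.-integrable [set: R] (EFin \o h).
    have := integrableB measurableT itg iWK.
    by apply: eq_integrable => // x _; rewrite /= hE EFinB.
  have h0 : \int[mu]_x h x = 0.
    apply: (WF (psi := fun x => phi t (t * x)) (dpsi := fun x => t * dx phi t (t * x)) (N := N1)).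
    - move=> x; have d := @is_derive_mul (cst t) id x _ _ (is_derive_cst _ _ _) (is_derive_id x 1).
      have := @is_derive1_comp _ (phi t) (fun x => t * x) x _ _ (test_function_dx tphi t (t * x)) d.
      by move/is_derive_eq; apply; rewrite mul0r add0r mulr1 mulrC.
    - by move=> x; apply: cvgM; [exact: cvg_cst|exact: (@continuous_ray _ t cdx)].
    - by move=> x h1; have [-> _ ->] := notin _ _ (offray t x h1); rewrite mulr0.
    (* The condition [psi 0 = 0]: the support of [phi] avoids [x = 0]. *)
    - rewrite mulr0; have [|->//] := notin t 0.
      by case: tphi => _ _ _ _ /[apply] -[_ /=]; rewrite eqxx.
  transitivity (\int[mu]_x (W x * K t x + h x)).
    by apply: eq_Rintegral => x _; rewrite hE addrC subrK.
  rewrite RintegralD// h0 addr0 (@Rintegral_csupp _ N1)//.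
  by move=> x /offray/K0 ->; rewrite mulr0.
have JE : J \_ `[a', b'] = J.
  apply/funext => t; rewrite patchE; case: ifPn => //; rewrite notin_setE/= in_itv/=.
  move=> /negP h; rewrite J0//; apply: contra h => /andP[a_t t_b].
  by rewrite (le_trans (ltW a'a))// (le_trans t_b)// ltW.
have iJ : mu.-integrable [set: R] (EFin \o J).
  rewrite -JE -restrict_EFin; apply/integrable_restrict => //; rewrite setTI.
  by apply: continuous_compact_integrable => //; exact: segment_compact.
split; first exact: ig.
- apply: eq_integrable (integrableS measurableT _ _ iJ) => // t.
  by rewrite inE/= in_itv/= andbT => t0; rewrite gJ.
- transitivity (\int[mu]_(t in `[0, +oo[) J t).
    by apply: eq_Rintegral => t; rewrite inE/= in_itv/= andbT => /gJ.
  rewrite -JE -Rintegral_mkcondr; apply: etrans intJ; congr (Rintegral mu _ J).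
  apply/seteqP; split=> t /=; first by case.
  by rewrite !in_itv/= andbT => /andP[h1 h2]; rewrite h1 h2 (le_trans (ltW a'0) h1).
Qed.

End WeakSelfSimilar.

Lemma weak_conservation_selfsimilar W F M (w f : R -> R -> R) :
  measurable_fun [set: R] W -> measurable_fun [set: R] F ->
  (forall x, `|W x| <= M) -> (forall x, `|F x| <= M) -> selfsimilar_flux W F ->
  (forall t x, 0 < t -> w t x = W (x / t)) ->
  (forall t x, 0 < t -> f t x = F (x / t)) -> weak_conservation w f.
Proof.
move=> mW mF bW bF WF wE fE phi tphi.
have [h1 h2 h3] := weak_conservation_selfsimilar_test mW mF bW bF WF tphi wE fE.
by split=> //; apply: aeW => t /h1.
Qed.

(** * Weak form on a half-line for piecewise smooth profiles *)

Lemma Rintegral_itv_oo f a b : mu.-integrable `[a, b] (EFin \o f) ->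
  \int[mu]_(x in `[a, b]) f x = \int[mu]_(x in `]a, b[) f x.
Proof.
move=> fi; rewrite -Rintegral_itv_bndo_bndc; last first.
  by apply: integrableS fi => //; exact: subset_itv_co_cc.
rewrite -Rintegral_itv_obnd_cbnd//.
by apply: integrableS fi => //; exact: subset_itv_oo_cc.
Qed.

Lemma Rintegral_itv_cat f a b c : a <= b -> b <= c ->
  mu.-integrable `[a, c] (EFin \o f) ->
  \int[mu]_(x in `[a, c]) f x =
  \int[mu]_(x in `[a, b]) f x + \int[mu]_(x in `[b, c]) f x.
Proof.
move=> ab bc fi.
have := @Rintegral_itvB _ f (BLeft a) (BRight c) b fi.
rewrite !bnd_simp => /(_ ab bc) h.
rewrite addrC -[LHS](subrK (\int[mu]_(x in `[a, b]) f x)) h; congr (_ + _).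
apply: Rintegral_itv_obnd_cbnd; apply: integrableS fi => //.
by apply: subset_itv; rewrite bnd_simp.
Qed.

(* [H] is the antiderivative of [- W] that equals [F - x W]; only its values at
   the end points survive, whatever [W] and [F] are there. *)
Lemma flux_piece W F H W' a b (psi dpsi : R -> R) : a <= b ->
  mu.-integrable `[a, b] (EFin \o (fun x => (F x - x * W x) * dpsi x - W x * psi x)) ->
  {within `[a, b], continuous H} -> {within `[a, b], continuous W'} ->
  (forall x, a < x < b ->
     [/\ W x = W' x, F x - x * W x = H x & is_derive x (1 : R) H (- W' x)]) ->
  (forall x : R, is_derive x (1 : R) psi (dpsi x)) -> continuous dpsi ->
  \int[mu]_(x in `[a, b]) ((F x - x * W x) * dpsi x - W x * psi x) =
  H b * psi b - H a * psi a.
Proof.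
rewrite le_eqVlt => /predU1P[<- _ _ _ _ _ _|ab iQ cH cW' HW dpsiE cdpsi].
  by rewrite subrr set_itv1 Rintegral_set1.
have cpsi : continuous psi.
  by move=> x; apply/differentiable_continuous/derivable1_diffP; exact: ex_derive.
pose q x := - W' x * psi x + H x * dpsi x.
have cq : {within `[a, b], continuous q}.
  move=> x; apply: cvgD; apply: cvgM.
  - by apply: cvgN; exact: cW'.
  - exact: continuous_subspaceT cpsi x.
  - exact: cH.
  - exact: continuous_subspaceT cdpsi x.
have iq : mu.-integrable `[a, b] (EFin \o q).
  by apply: continuous_compact_integrable => //; exact: segment_compact.
have [_ cHa cHb] := (continuous_within_itvP H ab).1 cH.
have dHpsi x : x \in `]a, b[ -> is_derive x (1 : R) (fun y => H y * psi y) (q x).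
  by rewrite in_itv/= => /HW[_ _ dH]; exact: is_derive_mul.
rewrite Rintegral_itv_oo//; transitivity (\int[mu]_(x in `[a, b]) q x).
  rewrite [RHS]Rintegral_itv_oo//; apply: eq_Rintegral => x.
  rewrite inE/= in_itv/= => /HW[e1 e2 _]; rewrite e2 e1 /q; ring.
rewrite /Rintegral (@continuous_FTC2 _ q (fun y => H y * psi y))//.
- split.
  + by move=> x /dHpsi d; exact: ex_derive.
  + by apply: cvgM => //; exact/cvg_at_right_filter/cpsi.
  + by apply: cvgM => //; exact/cvg_at_left_filter/cpsi.
- by move=> x /dHpsi d; rewrite derive1E; exact: derive_val.
Qed.

(* No boundary term appears since the test functions of the problem, hence
   [psi], vanish at the junction. *)
Definition left_flux W F := forall psi dpsi N,
  (forall x : R, is_derive x (1 : R) psi (dpsi x)) -> continuous dpsi ->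
  (forall x, N < `|x| -> psi x = 0 /\ dpsi x = 0) -> psi 0 = 0 ->
  \int[mu]_(x in `]-oo, 0[) ((F x - x * W x) * dpsi x - W x * psi x) = 0.

Lemma eq_left_flux W F W' F' : (forall x, x < 0 -> W x = W' x /\ F x = F' x) ->
  left_flux W F -> left_flux W' F'.
Proof.
move=> e h psi dpsi N h1 h2 h3 h4; rewrite -[RHS](h psi dpsi N)//.
by apply: eq_Rintegral => x; rewrite inE/= in_itv/= => /e[-> ->].
Qed.

Lemma flux_integrable W F M (psi dpsi : R -> R) a b :
  measurable_fun [set: R] W -> measurable_fun [set: R] F ->
  (forall x, `|W x| <= M) -> (forall x, `|F x| <= M) ->
  (forall x : R, is_derive x (1 : R) psi (dpsi x)) -> continuous dpsi ->
  mu.-integrable `[a, b] (EFin \o (fun x => (F x - x * W x) * dpsi x - W x * psi x)).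
Proof.
move=> mW mF bW bF dpsiE cdpsi.
have cpsi : continuous psi.
  by move=> x; apply/differentiable_continuous/derivable1_diffP; exact: ex_derive.
have bdd (h : R -> R) : continuous h -> exists B : R, forall x, x \in `[a, b] -> `|h x| <= B.
  move=> ch; have : compact [set h x | x in `[a, b]].
    by apply: continuous_compact; [exact: continuous_subspaceT|exact: segment_compact].
  move=> /compact_bounded[B [_ hB]]; exists (B + 1) => x xab.
  have /(hB _) /= : B < B + 1 by rewrite ltrDl.
  by apply; exists x.
have cid : continuous (id : R -> R) by move=> x; exact: cvg_id.
have [B1 b1] := bdd _ cpsi; have [B2 b2] := bdd _ cdpsi; have [B3 b3] := bdd _ cid.
apply: measurable_bounded_integrable => //.
- by apply: compact_finite_measure; exact: segment_compact.
- apply: measurable_funTS; apply: measurable_funB; apply: measurable_funM => //.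
  + by apply: measurable_funB => //; apply: measurable_funM.
  + exact: continuous_measurable_fun.
  + exact: continuous_measurable_fun.
- exists ((M + B3 * M) * B2 + M * B1); split; first exact: num_real.
  move=> C hC x xab; rewrite /=; apply: le_trans (ltW hC).
  rewrite (le_trans (ler_normB _ _))// !normrM lerD// ler_pM//; last exact: b1.
    rewrite (le_trans (ler_normB _ _))// lerD// normrM ler_pM//; exact: b3.
  exact: b2.
Qed.

(* A constant state, then a continuous wave over [[a, b]], then a constant
   state; a shock is the case [a = b], and the two conditions on [H] are then
   the Rankine-Hugoniot relation. *)
Lemma left_flux_wave W F H M a b (w0 f0 w1 f1 : R) :
  measurable_fun [set: R] W -> measurable_fun [set: R] F ->
  (forall x, `|W x| <= M) -> (forall x, `|F x| <= M) ->
  a <= b -> b <= 0 ->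
  (forall x, x < a -> W x = w0 /\ F x = f0) ->
  (forall x, b < x < 0 -> W x = w1 /\ F x = f1) ->
  H a = f0 - a * w0 -> H b = f1 - b * w1 ->
  {within `[a, b], continuous H} -> {within `[a, b], continuous W} ->
  (forall x, a < x < b ->
     F x - x * W x = H x /\ is_derive x (1 : R) H (- W x)) ->
  left_flux W F.
Proof.
move=> mW mF bW bF ab b0 hl hr Ha Hb cH cW HW psi dpsi N dpsiE cdpsi zero psi0.
pose Q x := (F x - x * W x) * dpsi x - W x * psi x.
have iQ c d : mu.-integrable `[c, d] (EFin \o Q) by exact: flux_integrable.
(* Large enough both for [psi] to vanish at [- L] and for [- L] to lie to the left of the wave. *)
pose L := Num.max N (- a) + 1.
have LN : N < L by rewrite (le_lt_trans (_ : N <= Num.max N (- a))) ?le_max ?lexx// ltrDl.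
have La : - L < a.
  by rewrite ltrNl (le_lt_trans (_ : - a <= Num.max N (- a))) ?le_max ?lexx ?orbT// ltrDl.
have L0 : - L <= 0 by rewrite ltW// (lt_le_trans La)// (le_trans ab).
have psiL : psi (- L) = 0.
  by apply: (zero _ _).1; rewrite normrN (lt_le_trans LN)// ler_norm.
have affine (w f : R) x : is_derive x (1 : R) (fun y => f - y * w) (- w).
  have h := is_deriveB (is_derive_cst f x 1)
    (is_derive_mul (is_derive_id x 1) (is_derive_cst w x 1)).
  by apply: is_derive_eq h _; rewrite mulr0 addr0 mul1r sub0r.
have caffine (w f c d : R) : {within `[c, d], continuous (fun y => f - y * w)}.
  by apply: derivable_within_continuous => x _; exact: (@ex_derive _ _ _ _ _ _ _ (affine w f x)).
have ccst (w c d : R) : {within `[c, d], continuous (cst w : R -> R)}.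
  by apply: continuous_subspaceT => x; exact: cvg_cst.
transitivity (\int[mu]_(x in `[- L, 0]) Q x).
  rewrite -Rintegral_itv_bndo_bndc; last first.
    by apply: integrableS (iQ (- L) 0) => //; exact: subset_itv_co_cc.
  rewrite [RHS]Rintegral_mkcond Rintegral_mkcond; congr (Rintegral mu _ _).
  apply/funext => x; rewrite !patchE !mem_setE !in_itv/=; case: ltP => x0.
    rewrite andbT; case: leP => //= xL.
    rewrite -/(Q x) /Q; have [|-> ->] := zero x; last by rewrite !mulr0 subrr.
    by rewrite (lt_le_trans LN)// ltr0_norm// lerNr ltW.
  by rewrite andbF.
rewrite (@Rintegral_itv_cat _ _ a)// ?(ltW La) ?(le_trans ab)//.
rewrite (@Rintegral_itv_cat _ a b)//.
rewrite (@flux_piece _ _ (fun y => f0 - y * w0) (cst w0))//; first last.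
- by move=> x /andP[_ /hl[-> ->]]; split.
- exact: ltW.
rewrite (@flux_piece _ _ H W)//; last by move=> x /HW[].
rewrite (@flux_piece _ _ (fun y => f1 - y * w1) (cst w1))//; last first.
  by move=> x /hr[-> ->]; split.
(* The boundary terms at [a] and [b] cancel between neighbouring pieces by [Ha] and [Hb]; those at
   [- L] and 0 vanish with [psi]. *)
by rewrite -Ha -Hb psiL psi0 !mulr0; ring.
Qed.

(** The right half is treated as a left half: under [x -> - x] a density is carried over and its
    flux changes sign. *)
Lemma selfsimilar_flux_halves W F M :
  measurable_fun [set: R] W -> measurable_fun [set: R] F ->
  (forall x, `|W x| <= M) -> (forall x, `|F x| <= M) ->
  left_flux W F ->
  left_flux (fun x => W (- x)) (fun x => - F (- x)) ->
  selfsimilar_flux W F.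
Proof.
move=> mW mF bW bF lf rf psi dpsi N dpsiE cdpsi zero psi0.
pose Q x := (F x - x * W x) * dpsi x - W x * psi x.
have mQ : measurable_fun [set: R] Q.
  apply: measurable_funB; apply: measurable_funM => //.
  - by apply: measurable_funB => //; apply: measurable_funM.
  - exact: continuous_measurable_fun.
  - apply: continuous_measurable_fun => x.
    by apply/differentiable_continuous/derivable1_diffP; exact: ex_derive.
have Q0 x : N < `|x| -> Q x = 0 by move=> /zero[e1 e2]; rewrite /Q e1 e2 !mulr0 subrr.
have iQ : mu.-integrable [set: R] (EFin \o Q).
  rewrite -(restrict_csupp Q0) -restrict_EFin; apply/integrable_restrict => //.
  by rewrite setTI; exact: flux_integrable.
have dpsiN x : is_derive x (1 : R) (fun y => psi (- y)) (- dpsi (- x)).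
  have := @is_derive1_comp _ psi (fun x => - x) x _ _ (dpsiE (- x)) (is_deriveNid x 1).
  by move/is_derive_eq; apply; rewrite mulrN1.
have right : \int[mu]_(x in `]-oo, 0[) Q (- x) = 0.
  rewrite -[RHS](rf (fun x => psi (- x)) (fun x => - dpsi (- x)) N)//.
  - by apply: eq_Rintegral => x _; rewrite /Q; ring.
  - move=> x; apply: cvgN; apply: continuous_comp; last exact: cdpsi.
    exact: opp_continuous.
  - by move=> x Nx; have [|-> ->] := zero (- x); rewrite ?normrN// oppr0.
  - by rewrite oppr0.
pose Q1 := Q \_ `]-oo, 0[; pose Q2 := Q \_ `[0, +oo[.
have mQ12 (A : set R) : measurable A -> measurable_fun [set: R] (Q \_ A).
  by move=> mA; apply/(measurable_restrictT _ mA); exact: measurable_funTS.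
have iQA (A : set R) : measurable A -> mu.-integrable [set: R] (EFin \o (Q \_ A)).
  move=> mA; rewrite -restrict_EFin; apply/integrable_restrict => //.
  by rewrite setTI; exact: integrableS iQ.
have QE x : Q x = Q1 x + Q2 x.
  rewrite /Q1 /Q2 !patchE !mem_setE !in_itv/= andbT.
  by case: ltP; rewrite ?addr0 ?add0r.
transitivity (\int[mu]_x (Q1 x + Q2 x)); first by apply: eq_Rintegral => x _; rewrite -QE.
rewrite RintegralD//; [|exact: iQA..].
rewrite -Rintegral_mkcond (lf psi dpsi N)// add0r.
have n1 : -1 != 0 :> R by rewrite oppr_eq0 oner_eq0.
rewrite (Rintegral_scale n1) ?normrN1 ?mul1r; last exact: iQA.
have iQN : mu.-integrable [set: R] (EFin \o (fun x => Q (- x))).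
  have := integrable_scale n1 iQ; congr (integrable _ _ (EFin \o _)).
  by apply/funext => x; rewrite mulN1r.
rewrite -[RHS]right [RHS]Rintegral_itv_bndo_bndc; last first.
  by apply: integrableS iQN.
rewrite [RHS]Rintegral_mkcond; apply: eq_Rintegral => x _.
by rewrite /Q2 !patchE !mem_setE !in_itv/= andbT mulN1r oppr_ge0.
Qed.

(** * Continuity in time with values in L1, and bounded variation *)

Lemma L1_continuity (w : R -> R -> R) M t (S K : set R) :
  (forall s, measurable_fun [set: R] (w s)) -> (forall s x, `|w s x| <= M) ->
  0 <= t -> measurable S -> mu S = 0%E ->
  (forall x, ~ S x -> w s x @[s --> within [set s : R | 0 <= s] (nbhs t)] --> w t x) ->
  compact K ->
  (\int[mu]_(x in K) (`|w s x - w t x|)%:E)%E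
    @[s --> within [set s : R | 0 <= s] (nbhs t)] --> 0%E.
Proof.
move=> mw bw t0 mS S0 wS cK.
have mK : measurable K by exact: compact_measurable.
have bdd s : forall x, `|w s x - w t x| <= M + M.
  by move=> x; rewrite (le_trans (ler_normB _ _))// lerD.
have iw s : mu.-integrable K (EFin \o (fun x => `|w s x - w t x|)).
  apply: measurable_bounded_integrable => //; first exact: compact_finite_measure.
    apply: measurable_funTS; apply: measurableT_comp => //.
    by apply: measurable_funB; exact: mw.
  exists (M + M); split; first exact: num_real.
  by move=> C MC x _ /=; rewrite normr_id (le_trans (bdd s x))// ltW.
(* [Num.max s 0] turns the limit restricted to [0 <= s] into an ordinary limit at [t], to which the
   sequential criterion and dominated convergence apply. *)
pose G s := \int[mu]_(x in K) `|w (Num.max s 0) x - w t x|.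
have tmax : Num.max t 0 = t by exact/max_idPl.
have maxw : Num.max s 0 @[s --> t] --> within [set s : R | 0 <= s] (nbhs t).
  move=> P; rewrite /within/= => hP.
  have : Num.max s 0 @[s --> t] --> t.
    rewrite -[X in _ --> X]tmax; apply: continuous_max; [exact: cvg_id|exact: cvg_cst].
  have {}hP : nbhs t (fun s => 0 <= s -> P s) by exact: hP.
  move=> /(_ _ hP) h.
  have {}h : \forall s \near t, 0 <= Num.max s 0 -> P (Num.max s 0) by exact: h.
  suff : \forall s \near t, P (Num.max s 0) by [].
  near=> s; have : 0 <= Num.max s 0 by rewrite le_max lexx orbT.
  by near: s.
have cG : G s @[s --> t] --> 0.
  apply/(@cvg_nbhsP _ R^o) => v vt.
  have fcv : {ae mu, forall x, K x ->
      (w (Num.max (v n) 0) x)%:E @[n --> \oo] --> (w t x)%:E}.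
    exists S; split=> // x /= nx; apply: contrapT => nSx; apply: nx => _.
    apply: cvg_EFin; first exact: nearW.
    exact: (cvg_comp _ (fun s => w s x) (cvg_comp _ (fun s => Num.max s 0) vt maxw) (wS _ nSx)).
  have mE s : measurable_fun K (fun x => (w s x)%:E).
    by apply/measurable_EFinP; exact: measurable_funTS.
  have iM : mu.-integrable K (cst M%:E).
    by apply: measurable_bounded_integrable => //; [exact: compact_finite_measure|exact: bounded_cst].
  have fM : {ae mu, forall x n, K x -> (`|(w (Num.max (v n) 0) x)%:E| <= cst M%:E x)%E}.
    by apply: aeW => x n _; rewrite lee_fin.
  have [_ + _] := @dominated_convergence _ _ _ mu K mK
    (fun n x => (w (Num.max (v n) 0) x)%:E) (fun x => (w t x)%:E) (cst M%:E)
    (fun n => mE _) (mE t) fcv iM fM.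
  by move=> h; exact: (fine_cvg h).
have cGw : (G s)%:E @[s --> within [set s : R | 0 <= s] (nbhs t)] --> 0%E.
  by apply: cvg_EFin; [exact: nearW|apply: cvg_within_filter; exact: cG].
apply: cvg_trans cGw; apply: near_eq_cvg; rewrite near_withinE.
near=> s => /= s0; rewrite /G (max_idPl s0) /Rintegral fineK//.
by apply: (@integrable_fin_num _ _ _ mu K mK (fun x => (`|w s x - w t x|)%:E)); exact: iw.
Unshelve. all: by end_near. Qed.

(** Density, momentum and momentum flux are monotone across a single wave, which gives
    measurability, bounds by the end states and bounded variation at once. *)
Definition monotone_fun f := nondecreasing_fun f \/ nonincreasing_fun f.

Lemma monotone_measurable f : monotone_fun f -> measurable_fun [set: R] f.
Proof.
by case; [exact: nondecreasing_measurable|exact: nonincreasing_measurable].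
Qed.

Lemma monotone_step (l r : R) : monotone_fun (fun x => if x < 0 then l else r).
Proof.
have [lr|rl] := leP l r; [left|right] => x y xy /=.
  have [y0|y0] := ltP y 0; first by rewrite (le_lt_trans xy y0).
  by case: ifP.
have [y0|y0] := ltP y 0; first by rewrite (le_lt_trans xy y0).
by case: ifP => // _; exact: ltW.
Qed.

Lemma monotone_comp f g : monotone_fun f -> nondecreasing_fun g ->
  monotone_fun (f \o g).
Proof. by move=> [mf|mf] mg; [left|right] => x y xy /=; exact/mf/mg. Qed.

Lemma monotone_total_variation f M : monotone_fun f -> (forall x, `|f x| <= M) ->
  forall a b, a <= b -> (total_variation a b f <= (M + M)%:E)%E.
Proof.
move=> mf bf a b ab.
have inc g : nondecreasing_fun g -> (forall x, `|g x| <= M) ->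
    (total_variation a b g <= (M + M)%:E)%E.
  move=> ndg bg; rewrite nondecreasing_total_variation//; last by move=> x y _ _; exact: ndg.
  rewrite lee_fin; apply: lerD; first exact: le_trans (ler_norm _) (bg b).
  by apply: le_trans (ler_norm _) _; rewrite normrN.
case: mf => mf; first exact: inc.
rewrite -total_variationN; apply: inc => [x y xy|x]; last by rewrite normrN.
by rewrite lerN2; exact: mf.
Qed.

Lemma essentially_BV_halves f g M : monotone_fun f -> monotone_fun g ->
  (forall x, `|f x| <= M) -> (forall x, `|g x| <= M) ->
  essentially_BV (fun x => if x < 0 then f x else g x).
Proof.
move=> mf mg bf bg; exists (fun x => if x < 0 then f x else g x).
split; first exact: aeW.
(* Three monotone functions: on each side of 0 one of [A], [B] is frozen at its value at 0, and the
   step [C] removes that constant. *)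
pose A x := f (Num.min x 0); pose B x := g (Num.max x 0).
pose C x := if x < 0 then - g 0 else - f 0.
have mA : monotone_fun A.
  by apply: monotone_comp mf _ => x y xy; exact: le_min2.
have mB : monotone_fun B.
  by apply: monotone_comp mg _ => x y xy; exact: le_max2.
have mC : monotone_fun C.
  exact: monotone_step.
have bC x : `|C x| <= M by rewrite /C; case: ifP => _; rewrite normrN.
have -> : (fun x => if x < 0 then f x else g x) = A \+ (B \+ C).
  apply/funext => x; rewrite /A /B /C /=; case: ltP => x0.
    by rewrite addrN addr0.
  by rewrite addrC subrK.
exists ((M + M) + ((M + M) + (M + M))) => a b ab.
apply: (le_trans (total_variation_le _ _ ab)); rewrite EFinD leeD//.
  by apply: monotone_total_variation => // x; exact: bf.
apply: (le_trans (total_variation_le _ _ ab)); rewrite EFinD leeD//.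
  by apply: monotone_total_variation => // x; exact: bg.
exact: monotone_total_variation.
Qed.

Lemma C0_L1loc_selfsimilar W M N (vl vr a b : R) (w : R -> R -> R) :
  measurable_fun [set: R] W -> (forall x, `|W x| <= M) -> 0 < N ->
  (forall x, x < - N -> W x = vl) -> (forall x, N < x -> W x = vr) ->
  (forall x, x != a -> x != b -> x != 0 -> {for x, continuous W}) ->
  (forall t x, 0 < t -> w t x = W (x / t)) ->
  (forall t x, t <= 0 -> w t x = if x < 0 then vl else vr) ->
  C0_L1loc w.
Proof.
move=> mW bW N0 Wl Wr cW wE w0.
have bl : `|vl| <= M by rewrite -(Wl (- (N + 1))) ?ltrN2 ?ltrDl.
have br : `|vr| <= M by rewrite -(Wr (N + 1)) ?ltrDl.
have bw s x : `|w s x| <= M.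
  by have [s0|s0] := ltP 0 s; [rewrite wE|rewrite w0//; case: ifP].
have mw s : measurable_fun [set: R] (w s).
  have [s0|s0] := ltP 0 s.
    have -> : w s = W \o (fun x => x / s) by apply/funext => x; exact: wE.
    by apply: measurableT_comp => //; exact: mulrr_measurable.
  have -> : w s = (fun x => if x < 0 then vl else vr) by apply/funext => x; exact: w0.
  by apply: monotone_measurable; exact: monotone_step.
move=> t t0; split.
  split=> //; first exact: openT.
  move=> K _ cK.
  have : mu.-integrable K (EFin \o w t).
    apply: measurable_bounded_integrable.
    - exact: compact_measurable.
    - exact: compact_finite_measure.
    - exact: measurable_funTS (mw t).
    - exists M; split; first exact: num_real.
      by move=> C MC x _ /=; exact: le_trans (bw t x) (ltW MC).
  by move=> /integrableP[_].
(* The null set of positions at time [t] where pointwise convergence may fail: the two rays of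
   discontinuity and the junction. *)
move=> K cK; pose S := [set a * t; b * t; 0].
have mS : measurable S by apply: measurableU; [apply: measurableU|]; exact: measurable_set1.
have S0 : mu S = 0%E.
  apply: countable_lebesgue_measure0; apply: finite_set_countable.
  by rewrite /S !finite_setU; do !split; exact: finite_set1.
apply: (@L1_continuity _ M _ S) => // x nSx.
have [xa xb x0] : [/\ x != a * t, x != b * t & x != 0].
  by split; apply/eqP => e; apply: nSx; rewrite /S; [left; left|left; right|right].
move: t0; rewrite le_eqVlt => /predU1P[t0|t0].
- apply: (@cvg_trans _ (w t x @[s --> within [set s : R | 0 <= s] (nbhs t)])); last exact: cvg_cst.
  apply: near_eq_cvg; rewrite near_withinE -t0 w0//.
  near=> s => /= s0.
  move: (s0); rewrite le_eqVlt => /predU1P[<-|{}s0]; first by rewrite w0.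
  (* At fixed [x != 0] and small [s], the point [x / s] has left the waves, so the solution already
     equals the initial datum. *)
  have sx : s * N < `|x|.
    by rewrite -ltr_pdivlMr//; near: s; apply: lt_nbhsl; rewrite divr_gt0 ?normr_gt0.
  rewrite wE//; case: ltP => x0'.
    by rewrite Wl// ltr_pdivrMr// mulNr ltrNr mulrC -ltr0_norm.
  by rewrite Wr// ltr_pdivlMr// mulrC -(ger0_norm x0').
- have xta : x / t != a by apply: contraNneq xa => <-; rewrite divfK// gt_eqF.
  have xtb : x / t != b by apply: contraNneq xb => <-; rewrite divfK// gt_eqF.
  have xt0 : x / t != 0 by rewrite mulf_neq0// invr_eq0 gt_eqF.
  have cws : W (x / s) @[s --> t] --> W (x / t).
    apply: continuous_cvg; first exact: cW.
    by apply: cvgM; [exact: cvg_cst|apply: cvgV; [rewrite gt_eqF|exact: cvg_id]].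
  apply: cvg_within_filter; rewrite wE//; apply: cvg_trans cws.
  apply: near_eq_cvg; near=> s; rewrite wE//.
  by near: s; exact: lt_nbhsr.
Unshelve. all: by end_near. Qed.

End SelfSimilar.

(** * The Riemann problem *)

Section Profiles.
Context {R : realType} (p : R -> R).
Hypothesis hp : pressure_law p.
Local Notation c := (sound_speed p).
Implicit Types (s t x y z ro r h k : R) (u uo um : state R) (U : R -> state R).

(* What is needed of a wave of the first family from [uo] to [um]; waves of the
   second family are handled through their reflections. *)
Definition left_profile uo um U :=
  [/\ lax_wave1 p uo um U /\ (forall x, 0 < (U x).1),
      [/\ monotone_fun (fst \o U), monotone_fun (snd \o U) &
          monotone_fun (flow_P p \o U)],
      (exists N, [/\ 0 < N, (forall x, x < - N -> U x = uo) &
                     (forall x, N < x -> U x = um)]),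
      (exists s, forall x, x != s -> {for x, continuous (fst \o U)} /\
                                     {for x, continuous (snd \o U)}) /\
      (U x @[x --> (0 : R)^'-] --> um) &
      left_flux (fst \o U) (snd \o U) /\ left_flux (snd \o U) (flow_P p \o U)].

(** * Constant and shock profiles *)

Lemma monotone_bounded (f : R -> R) N (l m : R) : monotone_fun f ->
  (forall x, x < - N -> f x = l) -> (forall x, N < x -> f x = m) -> 0 < N ->
  forall x, `|f x| <= Num.max `|l| `|m|.
Proof.
move=> mf fl fm N0 x; have [xN|Nx] := ltP x (- N); first by rewrite fl// le_max lexx.
have [Nx'|xN'] := ltP N x; first by rewrite fm// le_max lexx orbT.
have f1 : f (- N - 1) = l by apply: fl; rewrite ltrBlDr ltrDl.
have f2 : f (N + 1) = m by apply: fm; rewrite ltrDl.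
have x1 : - N - 1 <= x by rewrite (le_trans _ Nx)// lerBlDr lerDl.
have x2 : x <= N + 1 by rewrite (le_trans xN')// lerDl.
have hl := lexx (Num.max `|l| `|m|).
rewrite {1}ge_max in hl; have /andP[al am] := hl.
have hl' : - Num.max `|l| `|m| <= l <= Num.max `|l| `|m| by rewrite -ler_norml.
have hm' : - Num.max `|l| `|m| <= m <= Num.max `|l| `|m| by rewrite -ler_norml.
case/andP: hl' => l1 l2; case/andP: hm' => m1 m2.
rewrite ler_norml; case: mf => mf; have := mf _ _ x1; have := mf _ _ x2; rewrite f1 f2 => a b.
  by rewrite (le_trans l1 b) (le_trans a m2).
by rewrite (le_trans m1 a) (le_trans b l2).
Qed.

Lemma monotone_jump s (l m : R) : monotone_fun (fun x => if x < s then l else m).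
Proof.
have -> : (fun x => if x < s then l else m) =
    (fun x => if x < 0 then l else m) \o (fun x => x - s).
  by apply/funext => x /=; rewrite subr_lt0.
by apply: monotone_comp; [exact: monotone_step|move=> x y xy; rewrite lerD2r].
Qed.

Lemma jump_continuous s (l m : R) x : x != s ->
  {for x, continuous (fun x => if x < s then l else m)}.
Proof.
move=> xs; apply: cvg_near_cst; have [xs'|sx|xE] := ltgtP x s; last by rewrite xE eqxx in xs.
  by near=> y; rewrite ifT//; near: y; exact: lt_nbhsl.
by near=> y; rewrite ifF//; apply/negbTE; rewrite -leNgt ltW//; near: y; exact: lt_nbhsr.
Unshelve. all: by end_near. Qed.

Lemma left_flux_jump (W F : R -> R) s (w0 f0 w1 f1 : R) : s <= 0 ->
  (forall x, W x = if x < s then w0 else w1) ->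
  (forall x, F x = if x < s then f0 else f1) ->
  f1 - f0 = s * (w1 - w0) -> left_flux W F.
Proof.
move=> s0 WE FE rh.
have WE' : W = (fun x => if x < s then w0 else w1) by apply/funext.
have FE' : F = (fun x => if x < s then f0 else f1) by apply/funext.
pose M := Num.max (Num.max `|w0| `|w1|) (Num.max `|f0| `|f1|).
apply: (@left_flux_wave _ _ _ (cst (f0 - s * w0)) M s s w0 f0 w1 f1) => //.
- by rewrite WE'; apply: monotone_measurable; exact: monotone_jump.
- by rewrite FE'; apply: monotone_measurable; exact: monotone_jump.
- by move=> x; rewrite WE /M !le_max; case: ifP => _; rewrite lexx ?orbT.
- by move=> x; rewrite FE /M !le_max; case: ifP => _; rewrite lexx ?orbT.
- by move=> x xs; rewrite WE FE xs.
- by move=> x /andP[sx _]; rewrite WE FE ltNge (ltW sx).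
- by rewrite /=; move: rh; lra.
- by rewrite set_itv1; exact: continuous_subspace1.
- by rewrite set_itv1; exact: continuous_subspace1.
- by move=> x /andP[sx xs]; have := lt_trans sx xs; rewrite ltxx.
Qed.

(** The first relation defines [s]. For the second, the square of [w] determines the pressure jump,
    and substituting it leaves a rational identity. *)
Lemma rankine_hugoniot uo r : 0 < uo.1 -> uo.1 < r ->
  let um := (r, L1 p r uo) in
  let s := (um.2 - uo.2) / (um.1 - uo.1) in
  um.2 - uo.2 = s * (um.1 - uo.1) /\
  flow_P p um - flow_P p uo = s * (um.2 - uo.2).
Proof.
move=> u0 ur um s; have r0 := lt_trans u0 ur.
have d0 : r - uo.1 != 0 by rewrite subr_eq0 gt_eqF.
split; first by rewrite /s divfK.
rewrite /s /um /flow_P/= L1E//.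
have := lax_speed_shock hp u0 (ltW ur).
set w := lax_speed p r uo.1 => wE.
have w2 : w ^+ 2 = (uo.1^-1 - r^-1) * (p r - p uo.1).
  rewrite wE sqr_sqrtr// mulr_ge0//.
    by rewrite subr_ge0 lef_pV2 ?posrE// ltW.
  by rewrite subr_ge0 ltW//; exact: lt_pressure.
have pE : p r - p uo.1 = w ^+ 2 * (r * uo.1 / (r - uo.1)).
  by rewrite w2; field; rewrite d0 !gt_eqF.
have -> : (r * (uo.2 / uo.1 - w)) ^+ 2 / r + p r - (uo.2 ^+ 2 / uo.1 + p uo.1) =
   (r * (uo.2 / uo.1 - w)) ^+ 2 / r - uo.2 ^+ 2 / uo.1 + (p r - p uo.1) by ring.
by rewrite pE; field; rewrite d0 !gt_eqF.
Qed.

Lemma shock_speed_lt0 uo r : A0 p uo -> uo.1 < r ->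
  (L1 p r uo - uo.2) / (r - uo.1) < 0.
Proof.
move=> [u0 l1 _] ur; rewrite pmulr_llt0 ?invr_gt0 ?subr_gt0// subr_lt0.
rewrite -[ltRHS](L1_id hp u0); apply: L1_decreasing => //.
by rewrite L1_id// ltW.
Qed.

Lemma left_profile_shock uo r : A0 p uo -> uo.1 < r ->
  let um := (r, L1 p r uo) in
  let s := (um.2 - uo.2) / (um.1 - uo.1) in
  left_profile uo um (fun x => if x < s then uo else um).
Proof.
move=> Au ur um s; have [u0 _ _] := Au; have r0 := lt_trans u0 ur.
have s0 : s < 0 by exact: shock_speed_lt0.
have [rh1 rh2] := rankine_hugoniot u0 ur.
have e1 : fst \o (fun x => if x < s then uo else um) = (fun x => if x < s then uo.1 else um.1).
  by apply/funext => x /=; case: ifP.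
have e2 : snd \o (fun x => if x < s then uo else um) = (fun x => if x < s then uo.2 else um.2).
  by apply/funext => x /=; case: ifP.
have e3 : flow_P p \o (fun x => if x < s then uo else um) =
    (fun x => if x < s then flow_P p uo else flow_P p um).
  by apply/funext => x /=; case: ifP.
rewrite /left_profile e1 e2 e3; split.
- split; last by move=> x; case: ifP.
  split=> //; apply: Or32; split=> //; split=> x xs; first by rewrite xs.
  by rewrite ltNge (ltW xs).
- by split; exact: monotone_jump.
- exists (- s); split=> [|x|x sx]; first by rewrite oppr_gt0.
    by rewrite opprK => ->.
  by rewrite ltNge (ltW (lt_trans s0 (lt_trans _ sx)))// oppr_gt0.
- split.
    by exists s => x xs; split; exact: jump_continuous.
  apply: cvg_near_cst; near=> x; rewrite ifF//; apply/negbTE; rewrite -leNgt.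
  by near: x; exact: nbhs_left_ge.
- split; first by apply: (@left_flux_jump _ _ s uo.1 uo.2 um.1 um.2) => //; exact: ltW.
  by apply: (@left_flux_jump _ _ s uo.2 (flow_P p uo) um.2 (flow_P p um)) => //; exact: ltW.
Unshelve. all: by end_near. Qed.

Lemma left_profile_trivial uo : A0 p uo -> left_profile uo uo (cst uo).
Proof.
move=> [u0 _ _].
have mc (a : R) : monotone_fun (cst a : R -> R) by left.
have cc (a : R) x : {for x, continuous (cst a : R -> R)} by exact: cvg_cst.
have e1 : fst \o cst uo = cst uo.1 :> (R -> R) by [].
have e2 : snd \o cst uo = cst uo.2 :> (R -> R) by [].
have e3 : flow_P p \o cst uo = cst (flow_P p uo) :> (R -> R) by [].
rewrite /left_profile e1 e2 e3; split.
- split=> //; split=> //; first by rewrite L1_id.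
  exact: Or31.
- by split; exact: mc.
- by exists 1; split.
- split; last exact: cvg_cst.
  by exists 0 => x _; split; exact: cc.
- split.
    apply: (@left_flux_jump _ _ 0 uo.1 uo.2 uo.1 uo.2) => //;
      by [move=> x; rewrite if_same|rewrite !subrr mulr0].
  apply: (@left_flux_jump _ _ 0 uo.2 (flow_P p uo) uo.2 (flow_P p uo)) => //;
    by [move=> x; rewrite if_same|rewrite !subrr mulr0].
Qed.

(** The profile equation inside a fan: with [Ff' = lam Wf'] and [lam (g x) = x], the two terms
    containing the derivative of [g] cancel. *)
Lemma flux_chain_rule (Wf Ff lam g : R -> R) (dW m x : R) :
  is_derive (g x) (1 : R) Wf dW -> is_derive (g x) (1 : R) Ff (lam (g x) * dW) ->
  lam (g x) = x -> is_derive x (1 : R) g m ->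
  is_derive x (1 : R) (fun y => Ff (g y) - y * Wf (g y)) (- Wf (g x)).
Proof.
move=> hW hF lx hg.
have h1 := @is_derive1_comp _ Ff g x _ _ hF hg.
have h2 := @is_derive1_comp _ Wf g x _ _ hW hg.
have h := is_deriveB h1 (is_derive_mul (is_derive_id x 1) h2).
by apply: is_derive_eq h _; rewrite lx /=; ring.
Qed.

Lemma is_derive_continuous (f : R -> R) x (d : R) :
  is_derive x (1 : R) f d -> {for x, continuous f}.
Proof.
by move=> h; apply/differentiable_continuous/derivable1_diffP; exact: ex_derive.
Qed.

(** * Centred rarefaction fans of the first family *)

Section Rarefaction.
Variables (uo : state R) (r : R).
Hypotheses (r0 : 0 < r) (ru : r < uo.1).
Let ro := uo.1.
(** The rarefaction formulas are used on all densities above [a], beyond both ends of [[r, ro]], so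
    that two-sided derivatives exist at the ends of the fan. *)
Let a := r / 2.
Let E := riemann_invariant p a.
Let v x := uo.2 / uo.1 + (E ro - E x).
Let lam x := v x - c x.

Let a0 : 0 < a. Proof. by rewrite divr_gt0. Qed.
Let ar : a < r. Proof. by rewrite ltr_pdivrMr// ltr_pMr// ltr1n. Qed.
Let ro0 : 0 < ro. Proof. exact: lt_trans ru. Qed.

Let vE x : a < x -> x <= ro -> L1 p x uo = x * v x.
Proof.
move=> ax xr; rewrite L1E ?(lt_trans a0)// (@lax_speed_rarefaction _ _ hp a)//.
by rewrite /v opprB.
Qed.

Let dv x : a < x -> is_derive x (1 : R) v (- (c x / x)).
Proof.
move=> ax; have h := is_deriveD (is_derive_cst (uo.2 / uo.1) x 1)
  (is_deriveB (is_derive_cst (E ro) x 1) (riemann_derive hp a0 ax)).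
by apply: is_derive_eq h _; rewrite add0r sub0r.
Qed.

Let dlam x : a < x -> exists2 d, d < 0 & is_derive x (1 : R) lam d.
Proof.
move=> ax; have x0 := lt_trans a0 ax; have [d d0 hd] := sound_speed_derive hp x0.
exists (- (c x / x) - d); last exact: is_deriveB (dv ax) hd.
by rewrite -opprD oppr_lt0 ltr_pwDl// divr_gt0// sound_speed_gt0.
Qed.

Let lam_decr x y : a < x -> x < y -> lam y < lam x.
Proof.
move=> ax xy; have D z : a < z -> is_derive z (1 : R) lam ('D_1 lam z).
  by move=> /dlam[d _ h]; apply: DeriveDef => //; exact: ex_derive.
have [z /andP[xz zy] e] := MVT_gt ax xy D.
have [d d0 h] := dlam (lt_trans ax xz).
rewrite -subr_lt0 e (@derive_val _ _ _ _ _ _ _ h).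
by rewrite nmulr_rlt0// subr_gt0.
Qed.

(* The inverse of [lam], which gives the density in the fan. *)
Let g y := xget r [set x | a < x /\ lam x = y].

Let gK x : a < x -> g (lam x) = x.
Proof.
move=> ax; rewrite /g; case: xgetP => [z _ [az e]|/(_ x)]; last by case.
have [zx|xz|//] := ltgtP z x.
  by have := lam_decr az zx; rewrite e ltxx.
by have := lam_decr ax xz; rewrite e ltxx.
Qed.

Let dg x : a < x -> exists m, is_derive (lam x) (1 : R) g m.
Proof.
move=> ax; have [d d0 h] := dlam ax; exists d^-1.
apply: (@is_derive_inverse _ lam) => //; last by rewrite lt_eqF.
  by near=> y; apply: gK; near: y; exact: lt_nbhsr.
near=> y; have ay : a < y by near: y; exact: lt_nbhsr.
by have [d' _] := dlam ay; exact: is_derive_continuous.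
Unshelve. all: by end_near. Qed.

Let x1 := lam ro.
Let x2 := lam r.
Let x12 : x1 < x2. Proof. exact: lam_decr. Qed.
(** Clamping to the speeds of the two end states covers the fan and both constant states by a single
    formula. *)
Let clamp x := Num.max x1 (Num.min x x2).

Let clampP x : exists2 y, r <= y <= ro & clamp x = lam y.
Proof.
have [||y] := @IVT R lam r ro (clamp x) (ltW ru).
- apply: derivable_within_continuous => y; rewrite in_itv/= => /andP[ry _].
  by have [d _ hd] := dlam (lt_le_trans ar ry); exact: ex_derive.
- rewrite (min_idPr (ltW x12)) (max_idPl (ltW x12)) /clamp le_max lexx/=.
  by rewrite ge_max (ltW x12)/= ge_min lexx orbT.
by rewrite in_itv/= => yr e; exists y.
Qed.

Let U x : state R := (g (clamp x), g (clamp x) * v (g (clamp x))).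

Let rho_range x : r <= g (clamp x) <= ro /\ lam (g (clamp x)) = clamp x.
Proof.
have [y yr ->] := clampP x; have /andP[ry _] := yr.
by rewrite gK ?(lt_le_trans ar).
Qed.

Let clamp_nd : nondecreasing_fun clamp.
Proof. by move=> x y xy; rewrite /clamp le_max2// le_min2. Qed.

Let rho_ni : nonincreasing_fun (g \o clamp).
Proof.
move=> x y xy /=; have [hx ex] := rho_range x; have [hy ey] := rho_range y.
rewrite leNgt; apply/negP => /(lam_decr (lt_le_trans ar (andP hx).1)).
by rewrite ex ey ltNge clamp_nd.
Qed.

Let clamp_continuous x : {for x, continuous clamp}.
Proof.
by apply: continuous_max; [exact: cvg_cst|apply: continuous_min; [exact: cvg_id|exact: cvg_cst]].
Qed.

Let rho_continuous x : {for x, continuous (g \o clamp)}.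
Proof.
apply: continuous_comp; first exact: clamp_continuous.
have [y /andP[ry _] ->] := clampP x.
by have [m] := dg (lt_le_trans ar ry); exact: is_derive_continuous.
Qed.

Let q y := y * v y.
Let P y := y * v y * v y + p y.

(** With the next fact, [P' = lam * q']: the rarefaction curve is an integral curve of the
    eigenvector [(1, lam)]. *)
Let dq y : a < y -> is_derive y (1 : R) q (lam y).
Proof.
move=> ay; have y0 := lt_trans a0 ay.
have h := is_derive_mul (is_derive_id y 1) (dv ay); apply: is_derive_eq h _.
by rewrite /lam; field; rewrite gt_eqF.
Qed.

Let dP y : a < y -> is_derive y (1 : R) P (lam y * lam y).
Proof.
move=> ay; have y0 := lt_trans a0 ay.
have h := is_deriveD (is_derive_mul (dq ay) (dv ay)) (pressure_derive hp y0).
apply: is_derive_eq h _; rewrite -sound_speed_sqr// /q /lam.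
by field; rewrite gt_eqF.
Qed.

Let flowE x : flow_P p (U x) = P (g (clamp x)).
Proof.
rewrite /flow_P /U /P /=; set y := g _; have [/andP[ry _] _] := rho_range x.
have y0 : 0 < y by exact: lt_le_trans ry.
by field; rewrite gt_eqF.
Qed.

Let lambda1E y : r <= y -> y <= ro -> lambda1 p (y, L1 p y uo) = lam y.
Proof.
move=> ry yro; have ay := lt_le_trans ar ry; have y0 := lt_trans a0 ay.
by rewrite /lambda1/= vE// mulrAC divff ?gt_eqF// mul1r.
Qed.

Let UE y : r <= y -> y <= ro -> U (lam y) = (y, L1 p y uo).
Proof.
move=> ry yro; have ay := lt_le_trans ar ry.
have x1y : x1 <= lam y.
  by move: yro; rewrite le_eqVlt => /predU1P[->//|/(lam_decr ay)/ltW].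
have yx2 : lam y <= x2.
  by move: ry; rewrite le_eqVlt => /predU1P[<-//|/(lam_decr ar)/ltW].
have -> : U (lam y) = (g (lam y), g (lam y) * v (g (lam y))).
  by rewrite /U /clamp (min_idPl yx2) (max_idPr x1y).
by rewrite gK// vE.
Qed.

Let U_le x : x <= x1 -> U x = uo.
Proof.
move=> xx1; have -> : U x = U x1.
  by rewrite /U /clamp (min_idPl (le_trans xx1 (ltW x12))) (min_idPl (ltW x12)) (max_idPl xx1) (max_idPl (lexx x1)).
by rewrite UE ?(ltW ru)// L1_id// [RHS]surjective_pairing.
Qed.

Let U_ge x : x2 <= x -> U x = (r, L1 p r uo).
Proof.
move=> xx2; have -> : U x = U x2.
  by rewrite /U /clamp (min_idPr xx2) (min_idPr (lexx x2)).
by rewrite UE ?(ltW ru).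
Qed.

Hypothesis (sub : lambda1 p (r, L1 p r uo) <= 0).

Let x20 : x2 <= 0. Proof. by rewrite /x2 -lambda1E// ltW. Qed.
Let x10 : x1 < 0. Proof. exact: lt_le_trans x20. Qed.

Let fan_nondecreasing (f df : R -> R) :
  (forall y : R, a < y -> is_derive y (1 : R) f (df y)) ->
  (forall y, r <= y -> df y <= 0) ->
  nondecreasing_fun (fun x => f (g (clamp x))).
Proof.
move=> dfE df0 x y xy; have [/andP[ry _] _] := rho_range y.
have := rho_ni xy; rewrite /= le_eqVlt => /predU1P[->//|lt_xy].
have [z /andP[yz _] e] := MVT_gt (lt_le_trans ar ry) lt_xy dfE.
rewrite -subr_le0 e; apply: mulr_le0_ge0; last by rewrite subr_ge0 ltW.
by apply: df0; rewrite (le_trans ry)// ltW.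
Qed.

Let mono_q : nondecreasing_fun (snd \o U).
Proof.
apply: (fan_nondecreasing dq) => y ry; rewrite (le_trans _ x20)//.
by move: ry; rewrite le_eqVlt => /predU1P[<-//|/(lam_decr ar)/ltW].
Qed.

Let mono_P : nonincreasing_fun (flow_P p \o U).
Proof.
have dPN (y : R) : a < y -> is_derive y (1 : R) (fun y => - P y) (- (lam y * lam y)).
  by move=> ay; exact: is_deriveN (dP ay).
have neg (y : R) : r <= y -> - (lam y * lam y) <= 0.
  by move=> _; rewrite oppr_le0 -expr2 sqr_ge0.
move=> x y xy /=; rewrite !flowE -lerN2.
exact: (fan_nondecreasing dPN neg).
Qed.

(** The second property keeps [lambda1] strictly negative at [x < 0] even if the end state is sonic,
    since there [lambda1] equals [clamp x]. *)
Lemma left_profile_rarefaction : exists2 U, left_profile uo (r, L1 p r uo) U &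
  forall x, x < 0 -> exists y, [/\ r <= y, y <= uo.1, U x = (y, L1 p y uo) &
                                   lambda1 p (y, L1 p y uo) < 0].
Proof.
have cq x : {for x, continuous (snd \o U)}.
  have -> : snd \o U = q \o (g \o clamp) by [].
  apply: continuous_comp; first exact: rho_continuous.
  have [/andP[ry _] _] := rho_range x.
  exact: is_derive_continuous (dq (lt_le_trans ar ry)).
have cP x : {for x, continuous (flow_P p \o U)}.
  have -> : flow_P p \o U = P \o (g \o clamp) by apply/funext => y; rewrite /= flowE.
  apply: continuous_comp; first exact: rho_continuous.
  have [/andP[ry _] _] := rho_range x.
  exact: is_derive_continuous (dP (lt_le_trans ar ry)).
pose N := 1 - x1.
have N0 : 0 < N by rewrite subr_gt0 (lt_trans x10).
have UN x : x < - N -> U x = uo.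
  move=> xN; apply: U_le; rewrite ltW// (lt_le_trans xN)//.
  by rewrite opprB lerBlDr lerDl.
have NU x : N < x -> U x = (r, L1 p r uo).
  by move=> Nx; apply: U_ge; rewrite ltW// (le_lt_trans x20)// (lt_trans N0).
have mono_rho : monotone_fun (fst \o U) by right; exact: rho_ni.
(* Serves both conservation laws: mass with [Wf = id], [Ff = q], and momentum with [Wf = q],
   [Ff = P]. *)
have flux (Wf Ff : R -> R) (dW : R -> R) (W F : R -> R) :
    (forall y : R, a < y -> is_derive y (1 : R) Wf (dW y)) ->
    (forall y : R, a < y -> is_derive y (1 : R) Ff (lam y * dW y)) ->
    (forall x, W x = Wf (g (clamp x))) -> (forall x, F x = Ff (g (clamp x))) ->
    monotone_fun W -> monotone_fun F -> left_flux W F.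
  move=> dWf dFf WE FE mW mF.
  have const (f : R -> R) (h : R -> R) : (forall x, f x = h (g (clamp x))) ->
      (forall x, x <= x1 -> f x = f x1) /\ (forall x, x2 <= x -> f x = f x2).
    move=> fE; split=> x hx; rewrite !fE /clamp.
      by rewrite (min_idPl (le_trans hx (ltW x12))) (min_idPl (ltW x12)) (max_idPl hx) (max_idPl (lexx x1)).
    by rewrite (min_idPr hx) (min_idPr (lexx x2)).
  have [Wl Wr] := const _ _ WE; have [Fl Fr] := const _ _ FE.
  have bnd (f : R -> R) : monotone_fun f -> (forall x, x <= x1 -> f x = f x1) ->
      (forall x, x2 <= x -> f x = f x2) -> forall x, `|f x| <= Num.max `|f x1| `|f x2|.
    move=> mf fl fr; apply: (monotone_bounded mf (N := N)) => // x hx.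
      by apply: fl; rewrite ltW// (lt_le_trans hx)// opprB lerBlDr lerDl.
    by apply: fr; rewrite ltW// (le_lt_trans x20)// (lt_trans N0).
  pose M := Num.max (Num.max `|W x1| `|W x2|) (Num.max `|F x1| `|F x2|).
  have cWF (f h dh : R -> R) : (forall x, f x = h (g (clamp x))) ->
      (forall y : R, a < y -> is_derive y (1 : R) h (dh y)) -> forall x, {for x, continuous f}.
    move=> fE dh' x; have -> : f = h \o (g \o clamp) by apply/funext => y; rewrite fE.
    apply: continuous_comp; first exact: rho_continuous.
    have [/andP[ry _] _] := rho_range x.
    exact: is_derive_continuous (dh' _ (lt_le_trans ar ry)).
  have cW := cWF _ _ _ WE dWf; have cF := cWF _ _ _ FE dFf.
  apply: (@left_flux_wave _ _ _ (fun x => F x - x * W x) M x1 x2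
    (W x1) (F x1) (W x2) (F x2)) => //.
  - exact: monotone_measurable.
  - exact: monotone_measurable.
  - by move=> x; rewrite (le_trans (bnd _ mW Wl Wr x))// le_max lexx.
  - by move=> x; rewrite (le_trans (bnd _ mF Fl Fr x))// le_max lexx orbT.
  - exact: ltW.
  - by move=> x xx1; rewrite Wl ?Fl// ltW.
  - by move=> x /andP[xx2 _]; rewrite Wr ?Fr// ltW.
  - apply: continuous_subspaceT => x; apply: cvgB; first exact: cF.
    by apply: cvgM; [exact: cvg_id|exact: cW].
  - by apply: continuous_subspaceT => x; exact: cW.
  - move=> x /andP[xx1 xx2]; split=> //.
    have [/andP[ry _] lx] := rho_range x; have ay := lt_le_trans ar ry.
    have clx : clamp x = x by rewrite /clamp (min_idPl (ltW xx2)) (max_idPr (ltW xx1)).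
    rewrite clx in ay lx; have [m hm] := dg ay; rewrite lx in hm.
    have h := flux_chain_rule (dWf _ ay) (dFf _ ay) lx hm.
    rewrite WE clx; apply: near_eq_is_derive h; near=> y.
    have cly : clamp y = y.
      have yx2 : y <= x2 by apply/ltW; near: y; exact: lt_nbhsl.
      have x1y : x1 <= y by apply/ltW; near: y; exact: lt_nbhsr.
      by rewrite /clamp (min_idPl yx2) (max_idPr x1y).
    by rewrite WE FE cly.
exists U; last first.
  move=> x x0; have [/andP[ry yr] lx] := rho_range x.
  exists (g (clamp x)); split=> //; first by rewrite /U vE// (lt_le_trans ar).
  by rewrite lambda1E// lx /clamp gt_max x10 gt_min x0.
split.
- split; last first.
    by move=> x; have [/andP[ry _] _] := rho_range x; exact: lt_le_trans ry.
  split=> //; apply: Or33; split=> //; split.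
  + have : lambda1 p (ro, L1 p ro uo) = x1 by exact: lambda1E (ltW ru) (lexx _).
    by rewrite (L1_id hp ro0) -surjective_pairing => -> x; exact: U_le.
  + by move=> x; rewrite lambda1E// ?(ltW ru)//; exact: U_ge.
  + move=> y; rewrite /= (min_idPr (ltW ru)) (max_idPl (ltW ru)) => ry yr.
    by rewrite lambda1E// UE.
- split=> //; first by left.
  by right.
- by exists N.
- split; first by exists 0 => x _; split; [exact: rho_continuous|exact: cq].
  have -> : (r, L1 p r uo) = U 0 by rewrite U_ge.
  apply: cvg_at_left_filter.
  have h1 : g (clamp z) @[z --> (0 : R)] --> g (clamp 0) by exact: rho_continuous.
  have h2 : q (g (clamp z)) @[z --> (0 : R)] --> q (g (clamp 0)) by exact: cq.
  exact: (cvg_pair h1 h2).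
- split.
    apply: (@flux id q (cst 1)) => //; last by left.
    by move=> y /dq h; apply: is_derive_eq h _; rewrite mulr1.
  by apply: (@flux q P lam) => //; [left|right].
Unshelve. all: by end_near. Qed.

End Rarefaction.

Lemma closure_A0P u : 0 < u.1 ->
  closure (A0 p) u <-> lambda1 p u <= 0 /\ 0 <= lambda2 p u.
Proof.
move=> u0.
have cvel : z.2 / z.1 @[z --> u] --> u.2 / u.1.
  apply: cvgM; first exact: cvg_snd.
  by apply: cvgV; [rewrite gt_eqF|exact: cvg_fst].
have cspeed : c z.1 @[z --> u] --> c u.1.
  exact: (cvg_comp fst c cvg_fst (sound_speed_continuous hp u0)).
split=> [clu|[l1 l2]].
- split; rewrite leNgt; apply/negP => lu.
  + have : lambda1 p z @[z --> u] --> lambda1 p u by exact: cvgB.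
    move=> /cvgr_gt /(_ _ lu) /clu[z [[_ z1 _] /= z2]].
    by have := lt_trans z1 z2; rewrite ltxx.
  + have : lambda2 p z @[z --> u] --> lambda2 p u by exact: cvgD.
    move=> /cvgr_lt /(_ _ lu) /clu[z [[_ _ z1] /= z2]].
    by have := lt_trans z1 z2; rewrite ltxx.
- have l12 : lambda1 p u < lambda2 p u.
    by rewrite /lambda1 /lambda2 ltrD2l gtrN// sound_speed_gt0.
  (* [m] is minus the velocity: the path multiplies the velocity by [1 - e] at constant density,
     which makes both inequalities strict. *)
  pose m := - (lambda1 p u + lambda2 p u) / 2.
  have cpath : (u.1, u.2 + u.1 * (e * m)) @[e --> (0 : R)^'+] --> u.
    rewrite [X in _ --> X]surjective_pairing; apply: cvg_at_right_filter.
    have h : u.2 + u.1 * (e * m) @[e --> (0 : R)] --> u.2 + u.1 * (0 * m).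
      apply: cvgD; first exact: cvg_cst.
      apply: cvgM; first exact: cvg_cst.
      by apply: cvgM; [exact: cvg_id|exact: cvg_cst].
    rewrite mul0r mulr0 addr0 in h; exact: (cvg_pair (cvg_cst u.1) h).
  move=> B /cpath nB.
  have [e [Be e0 e1]] : exists e : R, [/\ B (u.1, u.2 + u.1 * (e * m)), 0 < e & e < 1].
    apply: (@filter_ex _ ((0 : R)^'+)); near=> e; split; first by near: e.
      by near: e; exact: nbhs_right_gt.
    by near: e; exact: nbhs_right_lt.
  exists (u.1, u.2 + u.1 * (e * m)); split=> //.
  have lE (b : R) : (u.2 + u.1 * (e * m)) / u.1 + b = u.2 / u.1 + b + e * m.
    by field; rewrite gt_eqF.
  split=> //=; rewrite /lambda1 /lambda2 /= lE -/(lambda1 p u) -/(lambda2 p u) /m;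
    move: l1 l2 l12; move: (lambda1 p u) (lambda2 p u) => a b; nra.
Unshelve. all: by end_near. Qed.

(** * Almost everywhere arguments and one-sided traces *)

Lemma ae_exists_itv (P : R -> Prop) (a b : R) : a < b ->
  {ae lebesgue_measure, forall x : R, P x} -> exists2 x, a < x < b & P x.
Proof.
move=> ab [N [mN N0 PN]]; apply: contrapT => nP.
have sub : `]a, b[ `<=` N.
  move=> x; rewrite /= in_itv/= => xab; apply: PN => /= Px.
  by apply: nP; exists x.
have : (mu `]a, b[%classic <= mu N)%E by apply: le_measure => //; rewrite inE.
by rewrite N0 lebesgue_measure_itv/= lte_fin ab -EFinB lee_fin leNgt subr_gt0 ab.
Qed.

Lemma ae_and (P Q : R -> Prop) : {ae lebesgue_measure, forall x : R, P x} ->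
  {ae lebesgue_measure, forall x : R, Q x} ->
  {ae lebesgue_measure, forall x : R, P x /\ Q x}.
Proof.
have F := ae_filter_ringOfSetsType (@lebesgue_measure R : {measure set _ -> \bar R}).
by move=> hP hQ; exact: (@filterI _ _ F _ _ hP hQ).
Qed.

Lemma ae_mono (P Q : R -> Prop) : (forall x : R, P x -> Q x) ->
  {ae lebesgue_measure, forall x : R, P x} ->
  {ae lebesgue_measure, forall x : R, Q x}.
Proof.
move=> PQ; have F := ae_filter_ringOfSetsType (@lebesgue_measure R : {measure set _ -> \bar R}).
exact: (@filterS _ _ F).
Qed.

Lemma ae_opp (P : R -> Prop) : {ae lebesgue_measure, forall x : R, P x} ->
  {ae lebesgue_measure, forall x : R, P (- x)}.
Proof.
move=> [N [mN N0 PN]].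
have mN' : measurable [set x : R | N (- x)].
  rewrite -[X in measurable X]setTI.
  have mo : measurable_fun [set: R] (fun x : R => - x) by exact: oppr_measurable.
  exact: (mo measurableT N mN).
exists [set x | N (- x)]; split=> //.
  have n1 : -1 != 0 :> R by rewrite oppr_eq0 oner_eq0.
  have := lebesgue_measure_scale n1 mN.
  rewrite N0 normrN1 mul1e => /esym <-; congr (lebesgue_measure _).
  by apply/seteqP; split=> x /=; rewrite mulN1r.
by move=> x nPx; apply: PN.
Qed.

Lemma ae_neq s : {ae lebesgue_measure, forall x : R, x != s}.
Proof.
exists [set s]; split; [exact: measurable_set1|exact: lebesgue_measure_set1|].
by move=> x /= /negP; rewrite negbK => /eqP.
Qed.

Lemma ae_neq0 (P : R -> Prop) : (forall t : R, t != 0 -> P t) ->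
  {ae lebesgue_measure, forall t : R, P t}.
Proof. by move=> h; apply: ae_mono (ae_neq 0) => t; exact: h. Qed.

(** Two representatives agree with [f] somewhere in every interval, and every set of the filter
    contains an interval; limits in a Hausdorff space then coincide. *)
Lemma trace_unique (F : set_system R) (f : R -> R * R) (w w' : R * R) :
  ProperFilter F ->
  (forall P : set R, F P -> exists a b : R, a < b /\ forall x, a < x < b -> P x) ->
  (exists g, {ae lebesgue_measure, forall x : R, f x = g x} /\ g x @[x --> F] --> w) ->
  (exists g, {ae lebesgue_measure, forall x : R, f x = g x} /\ g x @[x --> F] --> w') ->
  w = w'.
Proof.
move=> FF Fitv [g [fg gw]] [g' [fg' gw']].
have h : hausdorff_space (R * R)%type by exact: norm_hausdorff.
apply: h => A B wA wB.
have gA : F (g @^-1` A) by exact: gw.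
have gB : F (g' @^-1` B) by exact: gw'.
have [a [b [ab abP]]] := Fitv _ (filterI gA gB).
have [x xab [e1 e2]] := ae_exists_itv ab (ae_and fg fg').
by have [/= hA hB] := abP _ xab; exists (f x); split; [rewrite e1|rewrite e2].
Qed.

Lemma at_left_itv (P : set R) : (0 : R)^'- P ->
  exists a b : R, a < b /\ forall x, a < x < b -> P x.
Proof.
move=> [e /= e0 he]; exists (- e), 0; split; first by rewrite oppr_lt0.
move=> x /andP[ex x0]; apply: he => //=.
by rewrite sub0r normrN ltr0_norm// ltrNl.
Qed.

Lemma left_trace_unique (f : R -> R * R) (w w' : R * R) :
  left_trace f w -> left_trace f w' -> w = w'.
Proof. exact/trace_unique/at_left_itv. Qed.

Lemma left_trace_refl (f : R -> state R) w :
  right_trace f w -> left_trace (fun x => refl (f (- x))) (refl w).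
Proof.
move=> [g [fg gw]]; exists (fun x => refl (g (- x))); split.
  by apply: ae_mono (ae_opp fg) => x /= ->.
have h : g (- x) @[x --> (0 : R)^'-] --> w.
  by move: gw; rewrite -[X in X^'+]oppr0 at_rightN.
have h1 : (g (- x)).1 @[x --> (0 : R)^'-] --> w.1 by exact: (cvg_comp _ _ h cvg_fst).
have h2 : - (g (- x)).2 @[x --> (0 : R)^'-] --> - w.2.
  by apply: cvgN; exact: (cvg_comp _ _ h cvg_snd).
exact: (cvg_pair h1 h2).
Qed.

(** * Reflection, uniqueness and admissible range of Lax waves *)

Lemma reflK u : refl (refl u) = u.
Proof. by rewrite /refl/= opprK -surjective_pairing. Qed.

Lemma lax_wave2_refl um uo U : lax_wave2 p um uo U ->
  lax_wave1 p (refl uo) (refl um) (fun x => refl (U (- x))).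
Proof.
move=> [m0 mE hU]; split=> //; first by rewrite /= mE L2rev_refl// opprK.
case: hU => [[e hU]|[lt hU]|[lt hU]]; [apply: Or31|apply: Or32|apply: Or33]; split=> //.
- by move=> x; rewrite hU.
- move: hU; rewrite /shock_profile /=.
  have -> : (uo.2 - um.2) / (uo.1 - um.1) = - ((- um.2 - - uo.2) / (um.1 - uo.1)).
    by field; rewrite !subr_eq0 gt_eqF// lt_eqF.
  set s := _ / (um.1 - _) => -[h1 h2]; split=> x xs.
    by rewrite h2// ltrN2.
  by rewrite h1// ltrN2.
- case: hU => [h1 h2 h3]; split.
  + by move=> x; rewrite lambda1_refl => xl; rewrite h2// lerNr.
  + by move=> x; rewrite lambda1_refl => xl; rewrite h1// lerNl.
  + move=> y; rewrite /= minC maxC => y1 y2.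
    have y0 : 0 < y by rewrite (lt_le_trans _ y1)// lt_min m0 (lt_trans m0).
    have e : (y, L1 p y (refl uo)) = refl (y, L2rev p y uo).
      by rewrite /refl/= L2rev_refl// opprK.
    by rewrite e lambda1_refl opprK h3.
Qed.

Lemma lax_wave1_refl um uo U : lax_wave1 p (refl uo) (refl um) U ->
  lax_wave2 p um uo (fun x => refl (U (- x))).
Proof.
move=> [/= m0 mE hU]; split=> //; first by rewrite L2rev_refl// -mE opprK.
case: hU => [[/= e hU]|[/= lt hU]|[/= lt hU]]; [apply: Or31|apply: Or32|apply: Or33]; split=> //.
- by move=> x; rewrite hU reflK.
- move: hU; rewrite /shock_profile /=.
  have -> : (uo.2 - um.2) / (uo.1 - um.1) = - ((- um.2 - - uo.2) / (um.1 - uo.1)).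
    by field; rewrite !subr_eq0 gt_eqF// lt_eqF.
  set s := _ / (um.1 - _) => -[h1 h2]; split=> x xs.
    by rewrite h2 ?reflK// ltrNr.
  by rewrite h1 ?reflK// ltrNl.
- case: hU => [h1 h2 h3]; split.
  + by move=> x xl; rewrite h2 ?reflK// lambda1_refl lerN2.
  + by move=> x xl; rewrite h1 ?reflK// lambda1_refl lerN2.
  + move=> y y1 y2.
    have y0 : 0 < y by rewrite (lt_le_trans _ y1)// lt_min m0 (lt_trans m0).
    have e : (y, L1 p y (refl uo)) = refl (y, L2rev p y uo).
      by rewrite /refl/= L2rev_refl// opprK.
    have := h3 y; rewrite /= minC maxC => /(_ y1 y2).
    by rewrite e lambda1_refl => ->; rewrite reflK.
Qed.

Lemma lambda1_L1_continuous uo y : 0 < uo.1 -> 0 < y ->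
  {for y, continuous (fun y => lambda1 p (y, L1 p y uo))}.
Proof.
move=> u0 y0; apply: cvgB; last exact: sound_speed_continuous.
apply: cvgM; first exact: L1_continuous.
by apply: cvgV; [rewrite gt_eqF|exact: cvg_id].
Qed.

(** [rarefaction_profile] prescribes the profile only at speeds of the form [lambda (r, L r)]; by
    continuity these fill the whole fan. *)
Lemma fan_inverse uo um x : 0 < um.1 -> um.1 < uo.1 -> um.2 = L1 p um.1 uo ->
  lambda1 p uo < x -> x < lambda1 p um ->
  exists2 y, um.1 <= y <= uo.1 & lambda1 p (y, L1 p y uo) = x.
Proof.
move=> m0 mu_ mE xl xr; have u0 := lt_trans m0 mu_.
apply: (@IVT_pos _ (fun y => lambda1 p (y, L1 p y uo)) _ _ x m0 (ltW mu_)).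
  by move=> y; exact: lambda1_L1_continuous.
have -> : (uo.1, L1 p uo.1 uo) = uo by rewrite L1_id// -surjective_pairing.
by rewrite -mE -surjective_pairing (ltW xl) (ltW xr) orbT.
Qed.

(** The exceptional speed is that of the shock, where the profile is left free. *)
Lemma lax_wave1_unique uo um U U' : lax_wave1 p uo um U -> lax_wave1 p uo um U' ->
  exists s, forall x, x != s -> U x = U' x.
Proof.
move=> [m0 mE h] [_ _ h'].
case: h => [[e hU]|[lt hU]|[lt hU]]; case: h' => [[e' hU']|[lt' hU']|[lt' hU']];
  try (by move: lt'; rewrite e ltxx); try (by move: lt; rewrite e' ltxx);
  try (by have := lt_trans lt lt'; rewrite ltxx).
- by exists 0 => x _; rewrite hU hU'.
- exists ((um.2 - uo.2) / (um.1 - uo.1)) => x; rewrite neq_lt => /orP[] xs.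
    by rewrite hU.1// hU'.1.
  by rewrite hU.2// hU'.2.
- case: hU => [a1 a2 a3]; case: hU' => [b1 b2 b3].
  exists 0 => x _; have [xl|lx] := leP x (lambda1 p uo); first by rewrite a1// b1.
  have [rx|xr] := leP (lambda1 p um) x; first by rewrite a2// b2.
  have [y /andP[y1 y2] <-] := fan_inverse m0 lt mE lx xr.
  by rewrite a3 ?b3// ?(min_idPr (ltW lt)) ?(max_idPl (ltW lt)).
Qed.

(** A shock from a subsonic state has negative speed, so [um] fills an open sector of [x < 0] and
    inherits the constraint on the values, closed or open. A fan satisfies the upper bound since
    [um.1 < uo.1 < k]; if [um.1 < h], it would straddle [x = 0], all densities at [x < 0] would be
    at least [h], and [um] could not be the trace. *)
Lemma left_wave_range uo um U (f : R -> state R) t h k :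
  A0 p uo -> sonic_densities p uo h k -> lax_wave1 p uo um U -> 0 < t ->
  left_trace f um -> {ae lebesgue_measure, forall x : R, x < 0 -> f x = U (x / t)} ->
  [/\ h <= um.1,
      ({ae lebesgue_measure, forall x : R, closure (A0 p) (f x)} -> um.1 <= k) &
      ({ae lebesgue_measure, forall x : R, A0 p (f x)} -> um.1 < k)].
Proof.
move=> Au [h0 hu uk s1 s2] [m0 mE hU] t0 [g [fg gm]] fU; have [u0 _ _] := Au.
have umE : um = (um.1, L1 p um.1 uo) by rewrite -mE -surjective_pairing.
case: hU => [[e _]|[lt hU]|[lt hU]].
- by rewrite e; split=> [|_|_]; rewrite ?ltW.
- have fm (Q : state R -> Prop) :
      {ae lebesgue_measure, forall x : R, Q (f x)} -> Q um.
    set s := (um.2 - uo.2) / (um.1 - uo.1) in hU => fQ.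
    have s0 : s < 0 by rewrite /s mE; exact: shock_speed_lt0.
    have st : s * t < 0 by rewrite pmulr_llt0.
    have [x /andP[x1 x2] [ef /(_ x2) eU]] := ae_exists_itv st (ae_and fQ fU).
    have xU : U (x / t) = um by rewrite hU.2// ltr_pdivlMr.
    by rewrite eU xU in ef.
  split=> [|/fm clm|/fm Am]; first by rewrite ltW// (lt_trans hu).
    by rewrite -(s2 _ m0).1 -umE; have [_] := (closure_A0P m0).1 clm.
  by rewrite -(s2 _ m0).2 -umE; case: Am.
- have muk : um.1 < k by exact: lt_trans uk.
  split=> [|_|_] //; last exact: ltW.
  rewrite leNgt; apply/negP => mh.
  have near_h : \forall x \near (0 : R)^'-, (g x).1 < h.
    have : (g x).1 @[x --> (0 : R)^'-] --> um.1 by exact: (cvg_comp _ _ gm cvg_fst).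
    by move=> /cvgr_lt; apply.
  have near_0 : \forall x \near (0 : R)^'-, x < 0 by exact: nbhs_left_lt.
  have [a [b [ab abP]]] := at_left_itv (filterI near_h near_0).
  have [x xab [e1 e2]] := ae_exists_itv ab (ae_and fg fU).
  have [/= gh x0] := abP _ xab.
  suff : h <= (U (x / t)).1 by rewrite -(e2 x0) e1 leNgt gh.
  have xt0 : x / t < 0 by rewrite pmulr_llt0// invr_gt0.
  case: hU => [h1 h2 h3].
  have [xl|lx] := leP (x / t) (lambda1 p uo); first by rewrite h1// ltW.
  have lm : 0 < lambda1 p um by rewrite umE ltNge (s1 _ m0).1 -ltNge.
  have [y /andP[y1 y2] ly] := fan_inverse m0 lt mE lx (lt_trans xt0 lm).
  rewrite -ly h3 ?(min_idPr (ltW lt)) ?(max_idPl (ltW lt))//=.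
  by rewrite -(s1 _ (lt_le_trans m0 y1)).1 ly ltW.
Qed.

(** A fan keeps its densities below [uo.1 < k]; a shock exposes its end state at [x < 0], and there
    [r < k] separates the open set from its closure. *)
Lemma left_profile_exists uo h k r : A0 p uo -> sonic_densities p uo h k ->
  h <= r -> r <= k ->
  exists U, [/\ left_profile uo (r, L1 p r uo) U,
    forall x, x < 0 -> closure (A0 p) (U x) &
    r < k -> forall x, x < 0 -> A0 p (U x)].
Proof.
move=> Au [h0 hu uk s1 s2] hr rk; have [u0 _ _] := Au; have r0 := lt_le_trans h0 hr.
have uoE : (uo.1, L1 p uo.1 uo) = uo by rewrite L1_id// -surjective_pairing.
have clAu := @subset_closure _ (A0 p) _ Au.
have [ru|ur|->] := ltgtP r uo.1; last first.
- by rewrite uoE; exists (cst uo); split=> //; exact: left_profile_trivial.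
- exists (fun x => if x < ((r, L1 p r uo).2 - uo.2) / ((r, L1 p r uo).1 - uo.1)
    then uo else (r, L1 p r uo)); split; first exact: left_profile_shock.
  + move=> x x0; case: ifP => // _; apply/closure_A0P => //.
    by rewrite (s1 _ r0).1 hr (s2 _ r0).1 rk.
  + move=> rk' x x0; case: ifP => // _; split=> //.
      by rewrite (s1 _ r0).2 (lt_trans hu).
    by rewrite (s2 _ r0).2.
- have sub : lambda1 p (r, L1 p r uo) <= 0 by rewrite (s1 _ r0).1.
  have [U lU UA] := left_profile_rarefaction r0 ru sub.
  have AU x : x < 0 -> A0 p (U x).
    move=> /UA[y [ry yu -> ly]]; have y0 := lt_le_trans r0 ry.
    by split=> //; rewrite (s2 _ y0).2 (le_lt_trans yu).
  by exists U; split=> // x /AU Ax; exact: subset_closure.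
Qed.

Lemma monotone_opp (f : R -> R) : monotone_fun f -> monotone_fun (fun x => f (- x)).
Proof.
by move=> [mf|mf]; [right|left] => x y xy; apply: mf; rewrite lerN2.
Qed.

Lemma monotone_neg (f : R -> R) : monotone_fun f -> monotone_fun (fun x => - f x).
Proof. by move=> [mf|mf]; [right|left] => x y xy; rewrite lerN2; exact: mf. Qed.

Lemma left_flux_neg (W F : R -> R) : left_flux W F ->
  left_flux (fun x => - W x) (fun x => - F x).
Proof.
move=> h psi dpsi N dpsiE cdpsi zero psi0.
rewrite -[RHS](h (fun x => - psi x) (fun x => - dpsi x) N); last first.
- by rewrite psi0 oppr0.
- by move=> x /zero[-> ->]; rewrite oppr0.
- by move=> x; apply: cvgN; exact: cdpsi.
by apply: eq_Rintegral => x _; ring.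
Qed.

Lemma flow_P_refl u : flow_P p (refl u) = flow_P p u.
Proof. by rewrite /flow_P/= sqrrN. Qed.

Lemma measurable_halves (f g : R -> R) :
  measurable_fun [set: R] f -> measurable_fun [set: R] g ->
  measurable_fun [set: R] (fun x => if x < 0 then f x else g x).
Proof.
move=> mf mg; apply: measurable_fun_ifT => //.
have h := @measurable_fun_ltr _ _ R setT (fun x : R => x) (fun=> 0).
by apply: h; [exact: measurable_id|exact: measurable_cst].
Qed.

Lemma halves_continuous (f g : R -> R) x : x != 0 -> {for x, continuous f} ->
  {for x, continuous g} -> {for x, continuous (fun x => if x < 0 then f x else g x)}.
Proof.
move=> x0 cf cg; rewrite /prop_for /continuous_at.
have [xl|xr|xE] := ltgtP x 0; last by rewrite xE eqxx in x0.
- apply: cvg_trans cf; apply: near_eq_cvg; near=> y.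
  by rewrite ifT//; near: y; exact: lt_nbhsl.
- apply: cvg_trans cg; apply: near_eq_cvg; near=> y.
  by rewrite ifF//; apply/negbTE; rewrite -leNgt ltW//; near: y; exact: lt_nbhsr.
Unshelve. all: by end_near. Qed.

(** * Gluing two profiles at the junction *)

Definition riemann_solution ul ur (U1 U2 : R -> state R) (t x : R) : state R :=
  if 0 < t then (if x < 0 then U1 (x / t) else U2 (x / t))
  else if x < 0 then ul else ur.

Section Component.
Variables (f : state R -> R) (ul ur wl wr : state R) (U1 U2 : R -> state R) (N s1 s2 : R).
Hypotheses (N0 : 0 < N) (m1 : monotone_fun (f \o U1)) (m2 : monotone_fun (f \o U2)).
Hypotheses (U1l : forall x, x < - N -> U1 x = ul) (U1r : forall x, N < x -> U1 x = wl).
Hypotheses (U2l : forall x, x < - N -> U2 x = wr) (U2r : forall x, N < x -> U2 x = ur).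

Definition component_bound := Num.max (Num.max `|f ul| `|f wl|) (Num.max `|f wr| `|f ur|).

Lemma component_bound1 x : `|f (U1 x)| <= component_bound.
Proof.
have h : `|f (U1 x)| <= Num.max `|f ul| `|f wl|.
  by apply: (monotone_bounded m1 _ _ N0) => y /=; [move=> /U1l ->|move=> /U1r ->].
by rewrite (le_trans h)// le_max lexx.
Qed.

Lemma component_bound2 x : `|f (U2 x)| <= component_bound.
Proof.
have h : `|f (U2 x)| <= Num.max `|f wr| `|f ur|.
  by apply: (monotone_bounded m2 _ _ N0) => y /=; [move=> /U2l ->|move=> /U2r ->].
by rewrite (le_trans h)// le_max lexx orbT.
Qed.

Lemma component_BV t : 0 <= t ->
  essentially_BV (fun x => f (riemann_solution ul ur U1 U2 t x)).
Proof.
rewrite le_eqVlt => /predU1P[<-|t0].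
  have -> : (fun x => f (riemann_solution ul ur U1 U2 0 x)) =
      (fun x => if x < 0 then f ul else f ur).
    by apply/funext => x; rewrite /riemann_solution ltxx; case: ifP.
  apply: (@essentially_BV_halves _ (cst (f ul)) (cst (f ur)) component_bound);
    try (by left); by move=> x; rewrite /component_bound !le_max lexx ?orbT.
have -> : (fun x => f (riemann_solution ul ur U1 U2 t x)) =
    (fun x => if x < 0 then (f \o U1 \o (fun x => x / t)) x else (f \o U2 \o (fun x => x / t)) x).
  by apply/funext => x; rewrite /riemann_solution t0; case: ifP.
have nd : nondecreasing_fun (fun x : R => x / t).
  by move=> x y xy; rewrite ler_pM2r// invr_gt0.
apply: (@essentially_BV_halves _ _ _ component_bound); try exact: monotone_comp.
  by move=> x; exact: component_bound1.
by move=> x; exact: component_bound2.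
Qed.

Lemma component_profile t x : 0 < t ->
  f (riemann_solution ul ur U1 U2 t x) =
  (fun y => if y < 0 then f (U1 y) else f (U2 y)) (x / t).
Proof.
by move=> t0; rewrite /riemann_solution t0 pmulr_llt0 ?invr_gt0//; case: ifP.
Qed.

Lemma component_measurable :
  measurable_fun [set: R] (fun y => if y < 0 then f (U1 y) else f (U2 y)).
Proof. by apply: measurable_halves; exact: monotone_measurable. Qed.

Lemma component_bounded x : `|if x < 0 then f (U1 x) else f (U2 x)| <= component_bound.
Proof. by case: ifP => _; [exact: component_bound1|exact: component_bound2]. Qed.

Lemma component_C0_L1loc :
  (forall x, x != s1 -> {for x, continuous (f \o U1)}) ->
  (forall x, x != s2 -> {for x, continuous (f \o U2)}) ->
  C0_L1loc (fun t x => f (riemann_solution ul ur U1 U2 t x)).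
Proof.
move=> c1 c2.
apply: (@C0_L1loc_selfsimilar _ _ component_bound N (f ul) (f ur) s1 s2 _
  component_measurable component_bounded N0).
- by move=> x xN; rewrite ifT ?U1l// (lt_trans xN)// oppr_lt0.
- by move=> x Nx; rewrite ifF ?U2r//; apply/negbTE; rewrite -leNgt ltW// (lt_trans N0).
- by move=> x x1 x2 x0; apply: halves_continuous => //; [exact: c1|exact: c2].
- by move=> t x; exact: component_profile.
- by move=> t x t0; rewrite /riemann_solution ltNge t0 /=; case: ifP.
Qed.

End Component.

Lemma weak_conservation_riemann (f g : state R -> R) ul ur wl wr U1 U2 N :
  0 < N -> (forall x, x < - N -> U1 x = ul) -> (forall x, N < x -> U1 x = wl) ->
  (forall x, x < - N -> U2 x = wr) -> (forall x, N < x -> U2 x = ur) ->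
  monotone_fun (f \o U1) -> monotone_fun (f \o U2) ->
  monotone_fun (g \o U1) -> monotone_fun (g \o U2) ->
  left_flux (f \o U1) (g \o U1) ->
  left_flux (fun x => f (U2 (- x))) (fun x => - g (U2 (- x))) ->
  weak_conservation (fun t x => f (riemann_solution ul ur U1 U2 t x))
                    (fun t x => g (riemann_solution ul ur U1 U2 t x)).
Proof.
move=> N0 U1l U1r U2l U2r f1 f2 g1 g2 fl fr.
have mf := component_measurable f1 f2; have mg := component_measurable g1 g2.
set M := Num.max (component_bound f ul ur wl wr) (component_bound g ul ur wl wr).
have bf x : `|if x < 0 then f (U1 x) else f (U2 x)| <= M.
  by rewrite (le_trans (component_bounded N0 f1 f2 U1l U1r U2l U2r x))// le_max lexx.
have bg x : `|if x < 0 then g (U1 x) else g (U2 x)| <= M.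
  by rewrite (le_trans (component_bounded N0 g1 g2 U1l U1r U2l U2r x))// le_max lexx orbT.
apply: (weak_conservation_selfsimilar mf mg bf bg).
- apply: (selfsimilar_flux_halves mf mg bf bg).
    by apply: eq_left_flux fl => x ->.
  by apply: eq_left_flux fr => x x0; rewrite oppr_lt0 ltNge (ltW x0).
- by move=> t x; exact: component_profile.
- by move=> t x; exact: component_profile.
Qed.

Lemma cvg_left_scale t : 0 < t -> x / t @[x --> (0 : R)^'-] --> (0 : R)^'-.
Proof.
move=> t0 P [e /= e0 he]; exists (e * t); first by rewrite /= mulr_gt0.
move=> x /= xe x0; apply: he => /=; last by rewrite pmulr_llt0// invr_gt0.
by move: xe; rewrite !sub0r !normrN normrM normfV (gtr0_norm t0) ltr_pdivrMr.
Qed.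

Lemma cvg_refl_right U w : U x @[x --> (0 : R)^'-] --> w ->
  refl (U (- x)) @[x --> (0 : R)^'+] --> refl w.
Proof.
move=> Uw.
have h : U (- x) @[x --> (0 : R)^'+] --> w.
  rewrite -[X in X^'+]oppr0 at_rightN.
  have e : (U \o -%R) \o -%R = U by apply/funext => x /=; rewrite opprK.
  by move: Uw; rewrite -{1}e.
have h1 : (U (- x)).1 @[x --> (0 : R)^'+] --> w.1 by exact: (cvg_comp _ _ h cvg_fst).
have h2 : - (U (- x)).2 @[x --> (0 : R)^'+] --> - w.2.
  by apply: cvgN; exact: (cvg_comp _ _ h cvg_snd).
exact: (cvg_pair h1 h2).
Qed.

Lemma riemann_solution_neg ul ur U1 U2 t x : 0 < t -> x < 0 ->
  riemann_solution ul ur U1 U2 t x = U1 (x / t).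
Proof. by rewrite /riemann_solution => -> ->. Qed.

Lemma riemann_solution_pos ul ur U1 U2 t x : 0 < t -> 0 < x ->
  riemann_solution ul ur U1 U2 t x = U2 (x / t).
Proof. by rewrite /riemann_solution => -> x0; rewrite ltNge (ltW x0). Qed.

Lemma left_trace_riemann ul ur U1 U2 w t : 0 < t ->
  U1 x @[x --> (0 : R)^'-] --> w -> left_trace (riemann_solution ul ur U1 U2 t) w.
Proof.
move=> t0 Uw; exists (riemann_solution ul ur U1 U2 t); split; first exact: aeW.
have h : U1 (x / t) @[x --> (0 : R)^'-] --> w.
  exact: (cvg_comp _ _ (cvg_left_scale t0) Uw).
apply: cvg_trans h; apply: near_eq_cvg; near=> x.
by rewrite riemann_solution_neg//; near: x; exact: nbhs_left_lt.
Unshelve. all: by end_near. Qed.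

Lemma right_trace_riemann ul ur U1 V w t : 0 < t ->
  V x @[x --> (0 : R)^'-] --> w ->
  right_trace (riemann_solution ul ur U1 (fun x => refl (V (- x))) t) (refl w).
Proof.
move=> t0 Vw; exists (riemann_solution ul ur U1 (fun x => refl (V (- x))) t).
split; first exact: aeW.
have h : V (x / t) @[x --> (0 : R)^'-] --> w.
  exact: (cvg_comp _ _ (cvg_left_scale t0) Vw).
apply: cvg_trans (cvg_refl_right h); apply: near_eq_cvg; near=> x.
by rewrite riemann_solution_pos ?mulNr//; near: x; exact: nbhs_right_gt.
Unshelve. all: by end_near. Qed.

Lemma closure_A0_refl u : closure (A0 p) u -> closure (A0 p) (refl u).
Proof.
move=> clu B nB.
have h : refl w @[w --> u] --> refl u.
  have h1 : w.1 @[w --> u] --> u.1 by exact: cvg_fst.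
  have h2 : - w.2 @[w --> u] --> - u.2 by apply: cvgN; exact: cvg_snd.
  exact: (cvg_pair h1 h2).
have [w [Aw Bw]] := clu _ (h _ nB).
by exists (refl w); split=> //; exact: A0_refl.
Qed.

(** * Existence, common density and uniqueness of (p)-solutions *)

Section Riemann.
Variables (al ar : R) (ul ur : state R) (h1 k1 h2 k2 : R).
Hypotheses (hal : 0 < al) (har : 0 < ar) (hul : A0 p ul) (hur : A0 p ur).
Hypotheses (S1 : sonic_densities p ul h1 k1) (S2 : sonic_densities p (refl ur) h2 k2).

Lemma p_solution_exists r : h1 <= r <= k1 -> h2 <= r <= k2 ->
  al * L1 p r ul + ar * L1 p r (refl ur) = 0 ->
  exists u : R -> R -> state R, [/\ p_solution p al ar ul ur u, valued_in (closure (A0 p)) u &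
    r < k1 -> r < k2 -> valued_in (A0 p) u].
Proof.
move=> /andP[hr1 rk1] /andP[hr2 rk2] Fr.
have r0 : 0 < r by case: S1 => h0 _ _ _ _; exact: lt_le_trans hr1.
have [U1 [[[w1 pos1] [mr1 mq1 mP1] [N1 [N10 Ul1 Ur1]] [[s1 c1] tr1] [fl1 fP1]] cl1 A1]] :=
  left_profile_exists hul S1 hr1 rk1.
have [V [[[w2 pos2] [mr2 mq2 mP2] [N2 [N20 Vl Vr]] [[s2 c2] tr2] [fl2 fP2]] cl2 A2]] :=
  left_profile_exists (A0_refl hur) S2 hr2 rk2.
pose wl := (r, L1 p r ul); pose wr := refl (r, L1 p r (refl ur)).
(* [V] is a first-family profile issued from the reflected right state; reflecting it back gives the
   second-family wave. *)
pose U2 x := refl (V (- x)); pose u := riemann_solution ul ur U1 U2.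
have [ul0 _ _] := hul; have [ur0 _ _] := hur.
pose N := Num.max N1 N2.
have N0 : 0 < N by rewrite lt_max N10.
have U1l x : x < - N -> U1 x = ul.
  by move=> xN; apply: Ul1; rewrite (lt_le_trans xN)// lerN2 le_max lexx.
have U1r x : N < x -> U1 x = wl.
  by move=> Nx; apply: Ur1; rewrite (le_lt_trans _ Nx)// le_max lexx.
have U2l x : x < - N -> U2 x = wr.
  by move=> xN; rewrite /U2 Vr// ltrNr (lt_le_trans xN)// lerN2 le_max lexx orbT.
have U2r x : N < x -> U2 x = ur.
  move=> Nx; rewrite /U2 Vl ?reflK// ltrN2.
  by rewrite (le_lt_trans _ Nx)// le_max lexx orbT.
have mr2' : monotone_fun (fst \o U2) by exact: monotone_opp mr2.
have mq2' : monotone_fun (snd \o U2) by exact: monotone_neg (monotone_opp mq2).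
have mP2' : monotone_fun (flow_P p \o U2).
  have -> : flow_P p \o U2 = fun x => (flow_P p \o V) (- x).
    by apply/funext => x; rewrite /= flow_P_refl.
  exact: monotone_opp mP2.
have cU2 x : x != - s2 -> {for x, continuous (fst \o U2)} /\ {for x, continuous (snd \o U2)}.
  move=> xs; have /c2[ca cb] : - x != s2 by rewrite eqr_oppLR.
  have oppc : {for x, continuous (@GRing.opp R)} by exact: cvgN.
  have e1 : fst \o U2 = (fst \o V) \o -%R by [].
  have e2 : snd \o U2 = fun x => - ((snd \o V) \o -%R) x by [].
  split; first by rewrite e1; exact: continuous_comp.
  by rewrite e2; apply: cvgN; exact: continuous_comp.
have trace t : 0 < t -> left_trace (u t) wl /\ right_trace (u t) wr.
  by move=> t0; split; [exact: left_trace_riemann|exact: right_trace_riemann].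
have wrE : wr = (r, L2rev p r ur) by rewrite /wr /refl/= L2rev_refl.
have junction : p_junction p al wl ar wr = (0, 0).
  by rewrite /p_junction /= subrr mulrN opprK Fr.
have posU2 x : 0 < (U2 x).1 by exact: pos2.
have values (B : set (state R)) : B ul -> B ur -> (forall x, x < 0 -> B (U1 x)) ->
    (forall x, 0 < x -> B (U2 x)) -> valued_in B u.
  move=> Bl Br B1 B2 t; rewrite le_eqVlt => /predU1P[<-|t0]; apply: ae_neq0 => x.
    by rewrite /u /riemann_solution ltxx; case: ifP.
  rewrite neq_lt => /orP[x0|x0].
    rewrite /u riemann_solution_neg//; apply: B1.
    by rewrite pmulr_llt0 ?invr_gt0.
  by rewrite /u riemann_solution_pos//; apply: B2; rewrite divr_gt0.
exists u; split.
- split; last first.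
    exists wl, wr, U1, U2; split=> //.
      by apply: lax_wave1_refl; rewrite reflK.
    move=> t t0; have [trl trr] := trace _ t0; split=> //; apply: aeW => x.
    by split=> x0; [exact: riemann_solution_neg|exact: riemann_solution_pos].
  split.
  + split.
    * move=> t _; apply: aeW => x; rewrite /u /riemann_solution.
      by case: ifP => _; case: ifP.
    * apply: (component_C0_L1loc N0 mr1 mr2' U1l U1r U2l U2r (s1 := s1) (s2 := - s2)).
        by move=> x /c1[].
      by move=> x /cU2[].
    * apply: (component_C0_L1loc N0 mq1 mq2' U1l U1r U2l U2r (s1 := s1) (s2 := - s2)).
        by move=> x /c1[].
      by move=> x /cU2[].
    * apply: aeW => t t0; split.
        exact: (component_BV N0 mr1 mr2' U1l U1r U2l U2r).
      exact: (component_BV N0 mq1 mq2' U1l U1r U2l U2r).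
  + split.
      apply: (weak_conservation_riemann (f := fst) (g := snd) N0 U1l U1r U2l U2r) => //.
      by apply: eq_left_flux fl2 => x _; rewrite /U2 /= !opprK.
    (* Reflection leaves the mass equation of [V] unchanged, but momentum is odd, so its equation
       appears with both terms negated. *)
    apply: (weak_conservation_riemann (f := snd) (g := flow_P p) N0 U1l U1r U2l U2r) => //.
    by apply: eq_left_flux (left_flux_neg fP2) => x _; rewrite /U2 /= flow_P_refl !opprK.
  + apply: aeW => x; rewrite /u /riemann_solution ltxx; split=> [->//|x0].
    by rewrite ltNge (ltW x0).
  (* At [t = 0] the traces are the data, which need not satisfy the junction condition; this single
     time is discarded. *)
  + apply: ae_neq0 => t t_neq0 t_ge0.
    have /trace[trl trr] : 0 < t by rewrite lt_def t_neq0.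
    by exists wl, wr.
- apply: values => //; try exact: subset_closure.
  by move=> x x0; apply: closure_A0_refl; apply: cl2; rewrite oppr_lt0.
- move=> rk1' rk2'; apply: values => //; first exact: A1.
  by move=> x x0; apply: A0_refl; apply: A2 => //; rewrite oppr_lt0.
Qed.

Lemma p_solution_density (u : R -> R -> state R) : p_solution p al ar ul ur u ->
  exists r U1 U2,
  let wl := (r, L1 p r ul) in let wr := (r, L2rev p r ur) in
  [/\ h1 <= r /\ h2 <= r, al * L1 p r ul + ar * L1 p r (refl ur) = 0,
      lax_wave1 p ul wl U1 /\ lax_wave2 p wr ur U2,
      (forall t, 0 < t -> {ae lebesgue_measure, forall x : R,
         (x < 0 -> u t x = U1 (x / t)) /\ (0 < x -> u t x = U2 (x / t))}) &
      (valued_in (closure (A0 p)) u -> r <= k1 /\ r <= k2) /\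
      (valued_in (A0 p) u -> r < k1 /\ r < k2)].
Proof.
move=> [[_ _ _ junction] [wl [wr [U1 [U2 [w1 w2 hw]]]]]].
(* One positive time at which the junction condition holds is enough, since the traces [wl], [wr] of
   the waves do not depend on time. *)
have [t /andP[t0 _] /(_ (ltW t0)) [wl' [wr' [trl' trr' J]]]] := ae_exists_itv (@ltr01 R) junction.
have [trl trr ut] := hw _ t0.
have el := left_trace_unique trl' trl.
have er : wr' = wr.
  rewrite -[LHS]reflK -[RHS]reflK; congr refl.
  exact: left_trace_unique (left_trace_refl trr') (left_trace_refl trr).
rewrite {}el {}er in J; move: J => [] /eqP J1 /eqP J2.
have [l0 lE _] := w1; have [w0 rE _] := w2.
have e : wl.1 = wr.1.
  by apply: (pressure_inj hp) => //; apply/eqP; rewrite -subr_eq0.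
have wlE : wl = (wl.1, L1 p wl.1 ul) by rewrite -lE -surjective_pairing.
have wrE : wr = (wl.1, L2rev p wl.1 ur) by rewrite e -rE -surjective_pairing.
have u1 : {ae lebesgue_measure, forall x : R, x < 0 -> u t x = U1 (x / t)}.
  by apply: ae_mono ut => x [].
have u2 : {ae lebesgue_measure, forall x : R, x < 0 -> refl (u t (- x)) = refl (U2 (- (x / t)))}.
  by apply: ae_mono (ae_opp ut) => x [_ h] x0; rewrite h ?mulNr// oppr_gt0.
have [a1 b1 c1] := left_wave_range hul S1 w1 t0 trl u1.
have [a2 b2 c2] := left_wave_range (A0_refl hur) S2 (lax_wave2_refl w2) t0 (left_trace_refl trr) u2.
rewrite /= -e in a2 b2 c2.
exists wl.1, U1, U2; split=> //=.
- by move: J1; rewrite subr_eq0 lE rE -e L2rev_refl// mulrN -addr_eq0 => /eqP.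
- by rewrite -wlE -wrE.
- by move=> s s0; have [] := hw _ s0.
- have t1 := ltW t0; split=> /(_ _ t1) hA.
    split; first exact: b1.
    by apply: b2; apply: ae_mono (ae_opp hA) => x; exact: closure_A0_refl.
  split; first exact: c1.
  by apply: c2; apply: ae_mono (ae_opp hA) => x; exact: A0_refl.
Qed.

Lemma p_solution_unique (u v : R -> R -> state R) :
  p_solution p al ar ul ur u -> p_solution p al ar ul ur v ->
  forall t, 0 <= t -> {ae lebesgue_measure, forall x : R, v t x = u t x}.
Proof.
move=> su sv t; rewrite le_eqVlt => /predU1P[<-|t0].
  have [[_ _ iu _] _] := su; have [[_ _ iv _] _] := sv.
  apply: ae_mono (ae_and (ae_neq 0) (ae_and iu iv)) => x [x0 [[ul0 ur0] [vl0 vr0]]].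
  by move: x0; rewrite neq_lt => /orP[x0|x0]; [rewrite ul0// vl0|rewrite ur0// vr0].
have [r [U1 [U2 /= [[h1r h2r] Fr [a1 a2] hu _]]]] := p_solution_density su.
have [r' [V1 [V2 /= [[h1r' h2r'] Fr' [b1 b2] hv _]]]] := p_solution_density sv.
have dec := junction_decreasing hp hal har S1 S2.
have rr' : r = r'.
  have [lt|lt|//] := ltgtP r r'.
    by have := dec _ _ _ lt; rewrite Fr Fr' ltxx ge_max h1r h2r => /(_ isT).
  by have := dec _ _ _ lt; rewrite Fr Fr' ltxx ge_max h1r' h2r' => /(_ isT).
rewrite -rr' in b1 b2.
have [s1 e1] := lax_wave1_unique a1 b1.
have [s2 e2] := lax_wave1_unique (lax_wave2_refl a2) (lax_wave2_refl b2).
(* The two exceptional rays are removed; the second carries the sign [- s2] because [e2] compares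
   reflected profiles. *)
apply: ae_mono (ae_and (ae_and (ae_neq 0) (ae_and (ae_neq (s1 * t)) (ae_neq (- s2 * t))))
                       (ae_and (hu _ t0) (hv _ t0))) => x [[x0 [xs1 xs2]] [[ul0 ur0] [vl0 vr0]]].
move: x0; rewrite neq_lt => /orP[x0|x0].
  rewrite ul0// vl0// e1//; apply: contraNneq xs1 => <-.
  by rewrite divfK// gt_eqF.
rewrite ur0// vr0//; have /= := e2 (- (x / t)).
rewrite opprK => h; rewrite -[LHS]reflK -[RHS]reflK h//.
by apply: contraNneq xs2 => <-; rewrite opprK divfK// gt_eqF.
Qed.

Let F r := al * L1 p r ul + ar * L1 p r (refl ur).

Lemma p_solution_closure_iff :
  exists_unique_p_solution_in (closure (A0 p)) p al ar ul ur <->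
  exists2 r, Num.max h1 h2 <= r <= Num.min k1 k2 & F r = 0.
Proof.
split=> [[u [su Au _]]|[r]].
  have [r [U1 [U2 /= [[a b] Fr _ _ [/(_ Au)[c d] _]]]]] := p_solution_density su.
  by exists r => //; rewrite ge_max a b le_min c d.
rewrite ge_max le_min => /andP[/andP[a b] /andP[c d]] Fr.
have rk1 : h1 <= r <= k1 by rewrite a.
have rk2 : h2 <= r <= k2 by rewrite b.
have [u [su Au _]] := p_solution_exists rk1 rk2 Fr.
by exists u; split=> // v sv _; exact: p_solution_unique.
Qed.

Lemma p_solution_iff :
  exists_unique_p_solution_in (A0 p) p al ar ul ur <->
  exists2 r, Num.max h1 h2 <= r < Num.min k1 k2 & F r = 0.
Proof.
split=> [[u [su Au _]]|[r]].
  have [r [U1 [U2 /= [[a b] Fr _ _ [_ /(_ Au)[c d]]]]]] := p_solution_density su.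
  by exists r => //; rewrite ge_max a b lt_min c d.
rewrite ge_max lt_min => /andP[/andP[a b] /andP[c d]] Fr.
have rk1 : h1 <= r <= k1 by rewrite a ltW.
have rk2 : h2 <= r <= k2 by rewrite b ltW.
have [u [su _ Au]] := p_solution_exists rk1 rk2 Fr.
by exists u; split=> // [|v sv _]; [exact: Au|exact: p_solution_unique].
Qed.

End Riemann.
End Profiles.

Unset Implicit Arguments.
Set Strict Implicit.
Set Printing Implicit Defensive.

(* In the limit case of equality in the second inequality the intermediate
   state is sonic and is attained on an open sector, so that the solution takes
   values in the closure of A0 but not in the open set A0. Hence the two
   versions: the stated condition for the closure, and the same condition with
   that equality excluded for A0 itself. *)
Theorem theorem2p6 (R : realType) (p : R -> R) (hp : pressure_law p)
    (check_l hat_l check_r hat_r : state R -> R)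
    (hphi : boundary_densities p check_l hat_l check_r hat_r)
    (al ar : R) (hal : 0 < al) (har : 0 < ar)
    (ul ur : state R) (hul : A0 p ul) (hur : A0 p ur) :
  let l' := Num.max (hat_l ul) (check_r ur) in
  let l'' := Num.min (check_l ul) (hat_r ur) in
  (exists_unique_p_solution_in (closure (A0 p)) p al ar ul ur <->
     (al * L1 p l' ul >= ar * L2rev p l' ur /\
      al * L1 p l'' ul <= ar * L2rev p l'' ur)) /\
  (exists_unique_p_solution_in (A0 p) p al ar ul ur <->
     (al * L1 p l' ul >= ar * L2rev p l' ur /\
      al * L1 p l'' ul < ar * L2rev p l'' ur)).
Proof.
move=> l' l''.
have S1 := boundary_densities_left hp hphi hul.
have S2 := boundary_densities_right hp hphi hur.
have [h10 _ _ _ _] := S1; have [u0 _ _] := hul; have [v0 _ _] := hur.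
have [_ h1u uk1 _ _] := S1; have [_ _ uk2 _ _] := S2.
have l'0 : 0 < l' by rewrite lt_max h10.
have l''0 : 0 < l'' by rewrite lt_min (lt_trans u0 uk1) (lt_trans v0 uk2).
rewrite !L2rev_refl// !mulrN.
rewrite -[_ <= al * _]subr_ge0 -[al * _ <= _]subr_le0 -[al * _ < _]subr_lt0 !opprK.
split.
  apply: iff_trans (p_solution_closure_iff hp hal har hul hur S1 S2) _.
  exact: iff_sym (junction_density_le hp hal har S1 S2).
apply: iff_trans (p_solution_iff hp hal har hul hur S1 S2) _.
exact: iff_sym (junction_density_lt hp hal har S1 S2).
Qed.
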